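(* Let $\{U(\rho,\tau):\rho,\tau\in\mathcal{T}\}$ be a biadmissible family that is uniformly right continuous along stopping times in expectation (URCE). Then $$\overline A=\underline A=\overline B=\underline B=\overline V=\underline V,$$ where $$\overline A:=\inf_{\boldsymbol\rho\in\mathbb{T}^{i}}\sup_{\tau\in\mathcal{T}}\mathbb{E}[U(\boldsymbol\rho(\tau),\tau)],\qquad \underline A:=\sup_{\boldsymbol\tau\in\mathbb{T}^{i}}\inf_{\rho\in\mathcal{T}}\mathbb{E}[U(\rho,\boldsymbol\tau(\rho))],$$ $$\overline B:=\inf_{\boldsymbol\rho\in\mathbb{T}^{ii}}\sup_{\tau\in\mathcal{T}}\mathbb{E}[U(\boldsymbol\rho(\tau),\tau)],\qquad \underline B:=\sup_{\boldsymbol\tau\in\mathbb{T}^{ii}}\inf_{\rho\in\mathcal{T}}\mathbb{E}[U(\rho,\boldsymbol\tau(\rho))],$$ $$\overline V:=\inf_{\rho\in\mathcal{T}}\sup_{\tau\in\mathcal{T}}\mathbb{E}\left[V^1(\tau)1_{\{\tau\leq\rho\}}+V^2(\rho)1_{\{\tau>\rho\}}\right],\qquad \underline V:=\sup_{\tau\in\mathcal{T}}\inf_{\rho\in\mathcal{T}}\mathbb{E}\left[V^1(\tau)1_{\{\tau\leq\rho\}}+V^2(\rho)1_{\{\tau>\rho\}}\right].$$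
   Context: Let $T\in(0,\infty)$ and let $(\Omega,\mathcal{F},\mathbb{F}=(\mathcal{F}_t)_{0\le t\le T},P)$ be a filtered probability space whose filtration satisfies the usual conditions. $\mathcal{T}$ is the set of $\mathbb{F}$-stopping times with values in $[0,T]$. For $\sigma\in\mathcal{T}$, $\mathcal{T}_\sigma$ is the set of $\rho\in\mathcal{T}$ with $\rho\ge\sigma$, and $\mathbb{E}_\sigma[\cdot]=\mathbb{E}[\cdot\mid\mathcal{F}_\sigma]$. Relations between random variables are understood to hold almost surely. Biadmissible: a family $\{Y(\rho,\tau):\rho,\tau\in\mathcal{T}\}$ is biadmissible if for all $\rho,\tau\in\mathcal{T}$, $Y(\rho,\tau)$ is a bounded $\mathcal{F}_{\rho\vee\tau}$-measurable random variable, and for all $\rho_1,\rho_2,\tau_1,\tau_2\in\mathcal{T}$, $Y(\rho_1,\tau_1)=Y(\rho_2,\tau_2)$ on $\{\rho_1=\rho_2\}\cap\{\tau_1=\tau_2\}$. URCE: a biadmissible family $Y$ is URCE if $\sup_{\rho,\tau\in\mathcal{T}}\mathbb{E}[Y(\rho,\tau)]<\infty$ and, for any $\rho,\tau\in\mathcal{T}$ and any sequences $(\rho_n),(\tau_n)\subset\mathcal{T}$ with $\rho_n\searrow\rho$ and $\tau_n\searrow\tau$, $$\lim_{n\to\infty}\sup_{\rho'\in\mathcal{T}}\left|\mathbb{E}[Y(\rho',\tau)-Y(\rho',\tau_n)]\right|=0\quad\text{and}\quad\lim_{n\to\infty}\sup_{\tau'\in\mathcal{T}}\left|\mathbb{E}[Y(\rho,\tau')-Y(\rho_n,\tau')]\right|=0.$$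 Stopping strategies: $\mathbb{T}^{i}$ (Type I) is the set of maps $\boldsymbol\rho:\mathcal{T}\to\mathcal{T}$ such that for any $\sigma_1,\sigma_2\in\mathcal{T}$ it holds a.s. that either $\boldsymbol\rho(\sigma_1)=\boldsymbol\rho(\sigma_2)\le\sigma_1\wedge\sigma_2$ or $\boldsymbol\rho(\sigma_1)\wedge\boldsymbol\rho(\sigma_2)>\sigma_1\wedge\sigma_2$. $\mathbb{T}^{ii}$ (Type II) is the set of maps $\boldsymbol\rho:\mathcal{T}\to\mathcal{T}$ such that for any $\sigma_1,\sigma_2\in\mathcal{T}$ it holds a.s. that either $\boldsymbol\rho(\sigma_1)=\boldsymbol\rho(\sigma_2)<\sigma_1\wedge\sigma_2$ or $\boldsymbol\rho(\sigma_1)\wedge\boldsymbol\rho(\sigma_2)\ge\sigma_1\wedge\sigma_2$. Dynkin payoffs: for $\tau,\rho\in\mathcal{T}$, $$V^1(\tau):=\operatorname*{ess\,inf}_{\rho'\in\mathcal{T}_\tau}\mathbb{E}_\tau[U(\rho',\tau)],\qquad V^2(\rho):=\operatorname*{ess\,sup}_{\tau'\in\mathcal{T}_\rho}\mathbb{E}_\rho[U(\rho,\tau')].$$ *)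

(* Defs.v *)
From HB Require Import structures.
From mathcomp Require Import all_boot all_order all_algebra.
From mathcomp Require Import all_classical all_reals all_analysis.
From mathcomp Require Import measurable_realfun.

Set Implicit Arguments.
Unset Strict Implicit.
Unset Printing Implicit Defensive.

Import Order.TTheory GRing.Theory Num.Def Num.Theory.
Import numFieldNormedType.Exports.

Local Open Scope classical_set_scope.
Local Open Scope ring_scope.

Section stopping_games.
Context d (Omega : measurableType d) (R : realType).
Variables (P : probability Omega R) (T : R) (F : R -> set (set Omega)).

(* Only the restriction of F to `[0, T] matters. *)
Record filtration : Prop := Filtration {
  filtration_sigma_algebra : forall t, 0 <= t <= T ->
    sigma_algebra [set: Omega] (F t) ;
  filtration_measurable : forall t, 0 <= t <= T ->
    F t `<=` d.-measurable ;
  filtration_nondecreasing : forall s t, 0 <= s -> s <= t -> t <= T ->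
    F s `<=` F t }.

Record usual_conditions : Prop := UsualConditions {
  usual_complete : forall N, P.-negligible N -> F 0 N ;
  usual_right_continuous : forall t : R, 0 <= t < T ->
    F t = \bigcap_(s in `]t, T]) F s }.

Definition stopping_time : set (Omega -> R) :=
  [set sigma | (forall w, 0 <= sigma w <= T) /\
    forall t, 0 <= t <= T -> F t [set w | sigma w <= t]].

Definition stopping_time_ge (sigma : Omega -> R) : set (Omega -> R) :=
  [set rho | stopping_time rho /\ \forall w \ae P, sigma w <= rho w].

Definition sigma_before (sigma : Omega -> R) : set (set Omega) :=
  [set A | forall t, 0 <= t <= T -> F t (A `&` [set w | sigma w <= t])].

Definition measurable_wrt (G : set (set Omega)) (X : Omega -> R) :=
  measurable_fun [set: g_sigma_algebraType G] X.

Definition is_cond_expectation (G : set (set Omega)) (X Z : Omega -> R) :=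
  [/\ measurable_wrt G Z,
      P.-integrable [set: Omega] (EFin \o Z) &
      forall A, G A -> (\int[P]_(w in A) (Z w)%:E = \int[P]_(w in A) (X w)%:E)%E].

(* An arbitrary version; versions exist and are a.s. unique when X is
   integrable and G is a sub-sigma-algebra. *)
Definition cond_expectation (G : set (set Omega)) (X : Omega -> R) :
    Omega -> R :=
  xget (cst 0) [set Z | is_cond_expectation G X Z].

(* Essential bounds of a family of random variables, as opposed to [ess_sup]
   and [ess_inf], which are the essential bounds of a single function. They may
   be infinite. *)
Definition is_family_ess_inf (Phi : set (Omega -> \bar R)) (V : Omega -> \bar R) :=
  [/\ measurable_fun [set: Omega] V,
      forall X, Phi X -> \forall w \ae P, (V w <= X w)%E &
      forall W, measurable_fun [set: Omega] W ->
        (forall X, Phi X -> \forall w \ae P, (W w <= X w)%E) ->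
        \forall w \ae P, (W w <= V w)%E].

Definition is_family_ess_sup (Phi : set (Omega -> \bar R)) (V : Omega -> \bar R) :=
  [/\ measurable_fun [set: Omega] V,
      forall X, Phi X -> \forall w \ae P, (X w <= V w)%E &
      forall W, measurable_fun [set: Omega] W ->
        (forall X, Phi X -> \forall w \ae P, (X w <= W w)%E) ->
        \forall w \ae P, (V w <= W w)%E].

Definition family_ess_inf (Phi : set (Omega -> \bar R)) : Omega -> \bar R :=
  xget (cst 0%E) [set V | is_family_ess_inf Phi V].

Definition family_ess_sup (Phi : set (Omega -> \bar R)) : Omega -> \bar R :=
  xget (cst 0%E) [set V | is_family_ess_sup Phi V].

Implicit Types (Y U : (Omega -> R) -> (Omega -> R) -> Omega -> R).

Record biadmissible Y : Prop := Biadmissible {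
  biadmissible_bounded : forall rho tau,
    stopping_time rho -> stopping_time tau ->
    exists M : R, \forall w \ae P, `|Y rho tau w| <= M ;
  biadmissible_measurable : forall rho tau,
    stopping_time rho -> stopping_time tau ->
    measurable_wrt (sigma_before (rho \max tau)) (Y rho tau) ;
  biadmissible_local : forall rho1 rho2 tau1 tau2,
    stopping_time rho1 -> stopping_time rho2 ->
    stopping_time tau1 -> stopping_time tau2 ->
    \forall w \ae P, rho1 w = rho2 w -> tau1 w = tau2 w ->
      Y rho1 tau1 w = Y rho2 tau2 w }.

Definition decreases_to (sigma_ : nat -> Omega -> R) (sigma : Omega -> R) :=
  (forall n, \forall w \ae P, sigma_ n.+1 w <= sigma_ n w) /\
  \forall w \ae P, sigma_ n w @[n --> \oo] --> sigma w.

Record urce Y : Prop := Urce {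
  urce_bounded :
    (ereal_sup [set 'E_P[Y s.1 s.2] | s in stopping_time `*` stopping_time]
      < +oo)%E ;
  urce_right_continuous : forall rho tau (rho_ tau_ : nat -> Omega -> R),
    stopping_time rho -> stopping_time tau ->
    (forall n, stopping_time (rho_ n)) -> (forall n, stopping_time (tau_ n)) ->
    decreases_to rho_ rho -> decreases_to tau_ tau ->
    ereal_sup [set `|'E_P[Y rho' tau \- Y rho' (tau_ n)]|%E
              | rho' in stopping_time] @[n --> \oo] --> 0%E /\
    ereal_sup [set `|'E_P[Y rho tau' \- Y (rho_ n) tau']|%E
              | tau' in stopping_time] @[n --> \oo] --> 0%E }.

(* Strategies are represented by total maps on functions Omega -> R that send
   stopping times to stopping times; their other values are irrelevant. *)
Definition strategyI : set ((Omega -> R) -> (Omega -> R)) :=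
  [set r | (forall sigma, stopping_time sigma -> stopping_time (r sigma)) /\
    forall s1 s2, stopping_time s1 -> stopping_time s2 ->
      \forall w \ae P,
        (r s1 w = r s2 w /\ r s2 w <= Num.min (s1 w) (s2 w)) \/
        Num.min (s1 w) (s2 w) < Num.min (r s1 w) (r s2 w)].

Definition strategyII : set ((Omega -> R) -> (Omega -> R)) :=
  [set r | (forall sigma, stopping_time sigma -> stopping_time (r sigma)) /\
    forall s1 s2, stopping_time s1 -> stopping_time s2 ->
      \forall w \ae P,
        (r s1 w = r s2 w /\ r s2 w < Num.min (s1 w) (s2 w)) \/
        Num.min (s1 w) (s2 w) <= Num.min (r s1 w) (r s2 w)].

Local Open Scope ereal_scope.

Definition upper_value (S : set ((Omega -> R) -> (Omega -> R))) U : \bar R :=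
  ereal_inf [set ereal_sup [set 'E_P[U (r tau) tau] | tau in stopping_time]
            | r in S].

Definition lower_value (S : set ((Omega -> R) -> (Omega -> R))) U : \bar R :=
  ereal_sup [set ereal_inf [set 'E_P[U rho (r rho)] | rho in stopping_time]
            | r in S].

Definition upperA U := upper_value strategyI U.
Definition lowerA U := lower_value strategyI U.
Definition upperB U := upper_value strategyII U.
Definition lowerB U := lower_value strategyII U.

Definition V1 U (tau : Omega -> R) : Omega -> \bar R :=
  family_ess_inf [set EFin \o cond_expectation (sigma_before tau) (U rho' tau)
                 | rho' in stopping_time_ge tau].

Definition V2 U (rho : Omega -> R) : Omega -> \bar R :=
  family_ess_sup [set EFin \o cond_expectation (sigma_before rho) (U rho tau')
                 | tau' in stopping_time_ge rho].

(* ['E_P[_]] only applies to real-valued functions, whereas V1 and V2 are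
   extended-real-valued. *)
Definition dynkin_payoff U (rho tau : Omega -> R) : \bar R :=
  \int[P]_w (V1 U tau w * (\1_[set x | tau x <= rho x]%R w)%:E +
             V2 U rho w * (\1_[set x | rho x < tau x]%R w)%:E).

Definition upperV U : \bar R :=
  ereal_inf [set ereal_sup [set dynkin_payoff U rho tau | tau in stopping_time]
            | rho in stopping_time].

Definition lowerV U : \bar R :=
  ereal_sup [set ereal_inf [set dynkin_payoff U rho tau | rho in stopping_time]
            | tau in stopping_time].

End stopping_games.

(* Main.v *)
Require Import Defs.
From HB Require Import structures.
From mathcomp Require Import all_boot all_order all_algebra.
From mathcomp Require Import all_classical all_reals all_analysis.
From mathcomp Require Import measurable_realfun.
From mathcomp Require Import lra.

(** All six values coincide with the initial value of one game: the minimizer commits to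
    a stopping time rho, the maximizer stops at some tau, and if tau < rho the minimizer
    may choose a new time after tau. Write v(sigma) for its conditional upper value at a
    stopping time sigma. Then V1(sigma) <= v(sigma) <= V2(sigma), because the maximizer,
    respectively the minimizer, may stop at once.

    Comparing an arbitrary strategy with its behaviour when the opponent never stops
    bounds it by a Dynkin payoff (upper_typeI_ge, upper_typeII_ge, lower_typeI_le,
    lower_typeII_le). Together with the inclusion of type I in type II this gives
    lowerA <= lowerV <= upperV <= upperB <= upperA and lowerA <= lowerB <= upperA. What
    remains is upperA <= lowerA. A plan rho with replies strictly after tau is a strategy
    of type I, and right continuity makes the strictness harmless, so upperA <= v(0)
    (upperA_le_value). For v(0) <= lowerA the maximizer needs a stopping time D with
    E[V1(D); D <= rho] + E[V2(rho); rho < D] >= v(0) - eta for all rho (lowerA_ge).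

    Let D be the minimal stopping time at which v <= V1 + e g, for a small e > 0
    (minimal_stop). It exists because the set of such stopping times is closed under
    decreasing limits (stop_region_closed). That closedness comes from dynamic
    programming over a short interval [D, s_n] and a form of right continuity that is
    uniform over all stopping times of the interval (uniformly_right_upper). Then v does
    not decrease in mean up to D: in the dynamic programming inequality on [0, rho /\ D],
    whose reason is that the minimizer may wait until rho /\ D (dynamic_programming), a
    nearly optimal tau can rarely stop before rho /\ D, since v > V1 + e g there
    (before_minimal, value_le_before). Hence v(0) <= E[v(rho /\ D)], and v is at most
    V1 + e g at D and at most V2 at rho (saddle_point).

    Only an upper bound on the expected payoffs is available; V1 may be -oo and there is
    no uniform integrability. This is why the tolerance is weighted by a random factor
    g(sigma), the essential supremum of all later payoffs plus a constant (slack): an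
    event that is small for the weight g contributes little to v. Conditional values are
    handled throughout as set functions B |-> E[. ; B] that are infima or suprema of
    expected payoffs; the payoffs can be glued along events, so these set functions are
    measures (directed_sup_density, directed_inf_density). *)

Set Implicit Arguments.
Unset Strict Implicit.
Unset Printing Implicit Defensive.

Import Order.TTheory GRing.Theory Num.Def Num.Theory.
Import numFieldNormedType.Exports.

Local Open Scope classical_set_scope.
Local Open Scope ring_scope.

(** * Integrals of functions bounded on one side *)

Lemma exists_natSinv_lt (R : archiRealFieldType) (e : R) :
  0 < e -> exists n : nat, n.+1%:R^-1 < e.
Proof.
move=> e0; exists (Num.bound e^-1); rewrite invf_plt ?posrE //.
apply: lt_trans (archi_boundP _) _; first by rewrite invr_ge0 ltW.
by rewrite ltr_nat.
Qed.

Section integration.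
Local Open Scope ereal_scope.
Context d (T : measurableType d) (R : realType).
Variable mu : {measure set T -> \bar R}.
Implicit Types (f g : T -> \bar R) (D : set T).

Lemma ae_le_integral D f g : measurable D ->
  measurable_fun D f -> measurable_fun D g ->
  (\forall w \ae mu, D w -> f w <= g w) ->
  \int[mu]_(w in D) f w <= \int[mu]_(w in D) g w.
Proof.
move=> mD mf mg fg; rewrite integralE [leRHS]integralE; apply: leeB.
- apply: ae_ge0_le_integral => //; [exact: measurable_funepos|
    exact: measurable_funepos|].
  by apply: filterS fg => w fg Dw; rewrite !funeposE ge_max le_max fg //= le_max
    lexx orbT.
- apply: ae_ge0_le_integral => //; [exact: measurable_funeneg|
    exact: measurable_funeneg|].
  apply: filterS fg => w fg Dw; rewrite !funenegE ge_max !le_max leeN2 fg //=.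
  by rewrite lexx orbT.
Qed.

(** An essential infimum of payoffs may take the value -oo, so its integrals are only
    bounded above; this dichotomy is what remains of integrability. *)
Lemma integrableVNy D f : measurable D -> measurable_fun D f ->
  \int[mu]_(w in D) f^\+ w < +oo ->
  mu.-integrable D f \/ \int[mu]_(w in D) f w = -oo.
Proof.
move=> mD mf fp.
have [fn|] := ltP (\int[mu]_(w in D) f^\- w) +oo.
  left; apply/integrableP; split=> //.
  rewrite (eq_integral (fun w => f^\+ w + f^\- w)); last first.
    by move=> w _; rewrite -[RHS]/((f^\+ \+ f^\-) w) -fune_abse.
  rewrite ge0_integralD //; first exact: lte_add_pinfty.
  - exact: measurable_funepos.
  - exact: measurable_funeneg.
rewrite leye_eq => /eqP fn; right; rewrite integralE fn.
by move: fp; rewrite lt_neqAle => /andP[fp _]; case: (X in X + _) fp.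
Qed.

Lemma upper_integrableS D E f : measurable D -> measurable E -> D `<=` E ->
  measurable_fun E f ->
  \int[mu]_(w in E) f^\+ w < +oo -> \int[mu]_(w in D) f^\+ w < +oo.
Proof.
move=> mD mE DE mf; apply: le_lt_trans.
by apply: ge0_subset_integral => //; exact: measurable_funepos.
Qed.

Lemma upper_integralD D f (g : T -> R) : measurable D -> measurable_fun D f ->
  \int[mu]_(w in D) f^\+ w < +oo -> mu.-integrable D (EFin \o g) ->
  \int[mu]_(w in D) (f w + (g w)%:E) =
  \int[mu]_(w in D) f w + \int[mu]_(w in D) (g w)%:E.
Proof.
move=> mD mf fp ig.
have [fi|fNy] := integrableVNy mD mf fp; first by rewrite integralD.
have mg : measurable_fun D (EFin \o g) by exact: measurable_int ig.
have mfg : measurable_fun D (fun w => f w + (g w)%:E) by exact: emeasurable_funD.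
rewrite fNy addNye.
have : \int[mu]_(w in D) (fun w => f w + (g w)%:E)^\+ w < +oo.
  apply: (@le_lt_trans _ _ (\int[mu]_(w in D) (f^\+ w + (EFin \o g)^\+ w))).
    apply: ge0_le_integral => //.
    - exact: measurable_funepos.
    - by apply: emeasurable_funD; exact: measurable_funepos.
    - move=> w Dw; rewrite !funeposE ge_max; apply/andP; split.
        by apply: leeD; rewrite le_max lexx.
      by rewrite adde_ge0 // le_max lexx orbT.
  rewrite ge0_integralD //; [|exact: measurable_funepos..].
  by apply: lte_add_pinfty => //; exact: integral_funepos_lt_pinfty.
move=> /(integrableVNy mD mfg)[fgi|//].
have : mu.-integrable D f.
  have := integrableB mD fgi ig.
  by apply: eq_integrable => // w _ /=; rewrite addeK.
by move=> /(integrable_fin_num mD); rewrite fNy.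
Qed.

Lemma ge0_integralDl D f (g : T -> R) : measurable D -> measurable_fun D f ->
  (forall w, D w -> 0 <= f w) -> mu.-integrable D (EFin \o g) ->
  \int[mu]_(w in D) (f w + (g w)%:E) =
  \int[mu]_(w in D) f w + \int[mu]_(w in D) (g w)%:E.
Proof.
move=> mD mf f0 ig; apply: oppe_inj.
have mg : measurable_fun D (EFin \o g) by exact: measurable_int ig.
have fn0 : \int[mu]_(w in D) (\- f)^\+ w = 0.
  rewrite funeposN (eq_integral (cst 0)) ?integral0 //.
  exact: ge0_funenegE.
have ign : mu.-integrable D (EFin \o (fun w => - g w)%R).
  by have := integrableN ig; apply: eq_integrable.
rewrite oppeD ?fin_num_adde_defl ?integrable_fin_num //.
have gN : \int[mu]_(w in D) (- g w)%:E = - \int[mu]_(w in D) (g w)%:E.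
  rewrite -integralN //.
  by rewrite fin_num_adde_defl // fin_numN integrable_neg_fin_num.
rewrite -gN -(integral_ge0N _ f0).
rewrite -upper_integralD //; [|exact: measurableT_comp|by rewrite fn0].
rewrite -integralN.
  by apply: eq_integral => w _; rewrite fin_num_oppeD.
rewrite fin_num_adde_defl // fin_numN ge0_fin_numE; last first.
  exact: integral_ge0.
apply: le_lt_trans (integral_funeneg_lt_pinfty mD ig).
apply: ge0_le_integral => //.
- by apply: measurable_funeneg; exact: emeasurable_funD.
- exact: measurable_funeneg.
- move=> w Dw; rewrite !funenegE ge_max !le_max leeN2 lexx orbT andbT.
  by rewrite leeDr // f0.
Qed.

Lemma integral_fset0 D N f : measurable D -> measurable N -> mu N = 0 ->
  measurable_fun D f ->
  \int[mu]_(w in D) f w = \int[mu]_(w in D `\` N) f w.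
Proof.
move=> mD mN N0 mf; rewrite integralE [RHS]integralE; congr (_ - _).
- by apply: ge0_negligible_integral => //; exact: measurable_funepos.
- by apply: ge0_negligible_integral => //; exact: measurable_funeneg.
Qed.

Lemma measurable_ereal_sup_range D (f : nat -> T -> \bar R) :
  (forall n, measurable_fun D (f n)) ->
  measurable_fun D (fun w => ereal_sup (range (f ^~ w))).
Proof.
move=> mf; rewrite (_ : (fun _ => _) = fun w => esups (f ^~ w) 0%N).
  exact: measurable_fun_esups.
apply/funext => w; rewrite /esups /=; congr ereal_sup.
by apply/seteqP; split => _ [n _ <-]; exists n.
Qed.

(** Monotone convergence for functions of any sign: after subtracting the integrable
    minorant h the terms are nonnegative. *)
Lemma nondecreasing_integral_sup D (h : T -> R) (f : nat -> T -> \bar R) :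
  measurable D -> mu.-integrable D (EFin \o h) ->
  (forall n, measurable_fun D (f n)) ->
  (\forall w \ae mu, (h w)%:E <= f 0%N w) ->
  (forall n, \forall w \ae mu, f n w <= f n.+1 w) ->
  \int[mu]_(w in D) ereal_sup (range (f ^~ w)) =
  ereal_sup (range (fun n => \int[mu]_(w in D) f n w)).
Proof.
move=> mD ih mf h0 ndf.
have ndf' : \forall w \ae mu, forall n, f n w <= f n.+1 w by exact: ae_foralln.
have [N [mN N0 subN]] : mu.-negligible
    (~` [set w | (h w)%:E <= f 0%N w /\ forall n, f n w <= f n.+1 w]).
  by apply: (filterS2 _ _ h0 ndf') => w; split.
set V := fun w => ereal_sup (range (f ^~ w)).
have mV : measurable_fun D V by exact: measurable_ereal_sup_range.
pose E := D `\` N.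
have mE : measurable E by exact: measurableD.
have sED : E `<=` D by exact: subDsetl.
rewrite (integral_fset0 mD mN N0 mV) -/E.
under [in RHS]eq_fun do rewrite (integral_fset0 mD mN N0 (mf _)) -/E.
have mEf n : measurable_fun E (f n) by exact: measurable_funS (mf n).
have mEV : measurable_fun E V by exact: measurable_funS mV.
have ihE : mu.-integrable E (EFin \o h) by exact: integrableS ih.
have mh : measurable_fun E (EFin \o h) by exact: measurable_int ihE.
have good w : E w -> (h w)%:E <= f 0%N w /\ forall n, f n w <= f n.+1 w.
  by move=> [_ nNw]; apply: contrapT => /subN.
have ndE w : E w -> nondecreasing_seq (f ^~ w).
  by move=> /good[_ nd]; apply/nondecreasing_seqP.
have hf w n : E w -> (h w)%:E <= f n w.
  move=> Ew; apply: le_trans (good w Ew).1 _; exact: ndE.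
pose g n w := f n w - (h w)%:E.
have mg n : measurable_fun E (g n) by exact: emeasurable_funB.
have g0 n w : E w -> 0 <= g n w by move=> Ew; rewrite sube_ge0 // hf.
have ndg w : E w -> nondecreasing_seq (g ^~ w).
  by move=> Ew m n mn; apply: leeB => //; exact: ndE.
have cf w : E w -> f ^~ w @ \oo --> V w.
  by move=> Ew; apply: ereal_nondecreasing_cvgn; exact: ndE.
have cg w : E w -> g ^~ w @ \oo --> V w - (h w)%:E.
  move=> Ew; apply: cvgeB; [exact: fin_num_adde_defl|exact: cf|exact: cvg_cst].
have fE n : \int[mu]_(w in E) f n w =
    \int[mu]_(w in E) g n w + \int[mu]_(w in E) (h w)%:E.
  rewrite -ge0_integralDl //; last exact: g0.
  by apply: eq_integral => w _; rewrite subeK.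
have VE : \int[mu]_(w in E) V w =
    \int[mu]_(w in E) (V w - (h w)%:E) + \int[mu]_(w in E) (h w)%:E.
  rewrite -ge0_integralDl //; last 2 first.
  - exact: emeasurable_funB.
  - move=> w Ew; rewrite sube_ge0 //; apply: le_trans (hf w 0%N Ew) _.
    by apply: ereal_sup_ubound; exists 0%N.
  by apply: eq_integral => w _; rewrite subeK.
have := @cvg_monotone_convergence _ _ _ mu E mE g mg g0 ndg.
rewrite (_ : \int[mu]_(x in E) _ = \int[mu]_(w in E) (V w - (h w)%:E)); last first.
  by apply: eq_integral => w /[!inE] Ew; apply/cvg_lim => //; exact: cg.
move=> cI.
have : (fun n => \int[mu]_(w in E) f n w) @ \oo --> \int[mu]_(w in E) V w.
  rewrite VE; under eq_fun do rewrite fE.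
  apply: cvgeD => //; last exact: cvg_cst.
  by apply: fin_num_adde_defl; exact: integrable_fin_num.
move/cvg_lim => <- //; apply/cvg_lim => //.
apply: ereal_nondecreasing_cvgn => m n mn; apply: ae_le_integral => //.
by apply: aeW => w Ew; exact: ndE.
Qed.
Lemma nonincreasing_integral_inf D (f : nat -> T -> R) : measurable D ->
  (forall n, mu.-integrable D (EFin \o f n)) ->
  (forall n, \forall w \ae mu, (f n.+1 w <= f n w)%R) ->
  \int[mu]_(w in D) ereal_inf (range (fun n => (f n w)%:E)) =
  ereal_inf (range (fun n => \int[mu]_(w in D) (f n w)%:E)).
Proof.
move=> mD fi fni.
have iN n : mu.-integrable D (EFin \o (fun w => - f n w)%R).
  by have := integrableN (fi n); apply: eq_integrable.
pose W w := ereal_sup (range (fun n => (- f n w)%:E)).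
have mW : measurable_fun D W.
  by apply: measurable_ereal_sup_range => n; exact: (measurable_int mu (iN n)).
have WE : \int[mu]_(w in D) W w =
    ereal_sup (range (fun n => \int[mu]_(w in D) (- f n w)%:E)).
  apply: (nondecreasing_integral_sup (f := fun n w => (- f n w)%:E) mD (iN 0%N)).
  - by move=> n; exact: (measurable_int mu (iN n)).
  - exact: aeW.
  - by move=> n; apply: filterS (fni n) => w; rewrite lee_fin lerN2.
have VW w : ereal_inf (range (fun n => (f n w)%:E)) = - W w.
  rewrite ereal_infEN; congr (- ereal_sup _); apply/seteqP.
  by split=> [_ [_ [n _ <-] <-]|_ [n _ <-]];
    [exists n|exists (f n w)%:E => //; exists n].
under eq_integral do rewrite VW.
rewrite integralN; last first.
  rewrite fin_num_adde_defl // fin_numN ge0_fin_numE; last exact: integral_ge0.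
  apply: le_lt_trans (integral_funepos_lt_pinfty mD (fi 0%N)).
  apply: ge0_le_integral => //.
  - exact: measurable_funeneg.
  - by apply: measurable_funepos; exact: (measurable_int mu (fi _)).
  - move=> w Dw; rewrite funenegE funeposE ge_max !le_max lexx orbT andbT.
    by rewrite leeNl; apply/orP; left; apply: ereal_sup_ubound; exists 0%N.
rewrite WE ereal_infEN; congr (- ereal_sup _); apply/seteqP.
have INE n : \int[mu]_(w in D) (- f n w)%:E = - \int[mu]_(w in D) (f n w)%:E.
  rewrite -integralN //.
  by rewrite fin_num_adde_defl // fin_numN (integrable_neg_fin_num mD (fi n)).
by split=> [_ [n _ <-]|_ [_ [n _ <-] <-]];
  [exists (\int[mu]_(w in D) (f n w)%:E) => //; exists n|exists n].
Qed.
End integration.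

(** * Conditional expectations *)

Section sub_sigma_algebra.
Local Open Scope ereal_scope.
Context d (T : measurableType d) (R : realType) (P : probability T R).
Variable G : set (set T).
Hypothesis sG : sigma_algebra [set: T] G.
Hypothesis Gm : G `<=` d.-measurable.

Definition sub_measurable (f : T -> \bar R) :=
  measurable_fun [set: g_sigma_algebraType G] f.

Lemma sub_sigma_algebraE : G.-sigma.-measurable = G.
Proof. exact: measurable_g_measurableTypeE. Qed.

Lemma sub_measurableW f : sub_measurable f -> measurable_fun [set: T] f.
Proof.
move=> mf _ B mB; have := mf measurableT B mB.
by rewrite sub_sigma_algebraE => /Gm.
Qed.

Lemma sub_measurable_le f g : sub_measurable f -> sub_measurable g ->
  G [set w | f w <= g w].
Proof.
move=> mf mg; have := @measurable_lee _ _ _ setT measurableT _ _ mf mg.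
by rewrite setTI sub_sigma_algebraE.
Qed.

Lemma sub_measurable_lt f g : sub_measurable f -> sub_measurable g ->
  G [set w | f w < g w].
Proof.
move=> mf mg; have := @measurable_lte _ _ _ setT measurableT _ _ mf mg.
by rewrite setTI sub_sigma_algebraE.
Qed.

Lemma sub_setI A B : G A -> G B -> G (A `&` B).
Proof. by rewrite -sub_sigma_algebraE => ? ?; exact: measurableI. Qed.

Lemma sub_setC A : G A -> G (~` A).
Proof. by rewrite -sub_sigma_algebraE => ?; exact: measurableC. Qed.

Lemma sub_setT : G setT.
Proof. by rewrite -sub_sigma_algebraE; exact: measurableT. Qed.

(** The conditional expectation is the Radon-Nikodym derivative of the charge
    A |-> \int_A X with respect to P, both restricted to G. The restriction is
    obtained as the image under the identity, seen as a measurable map from the full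
    sigma-algebra to G. *)
Lemma cond_expectation_exists (X : T -> R) :
  P.-integrable [set: T] (EFin \o X) -> exists Z, is_cond_expectation P G X Z.
Proof.
move=> iX.
pose i : T -> g_sigma_algebraType G := id.
have mi : measurable_fun [set: T] i.
  by move=> _ B; rewrite sub_sigma_algebraE setTI => /Gm.
pose nu_of : {charge set (g_sigma_algebraType G) -> \bar R} :=
  pushforward (induced_charge iX) i.
pose nu := nu_of mi.
pose i_mixin := isMeasurableFun.Build _ _ _ _ _ mi.
pose i_pack := MeasurableFun.Pack (MeasurableFun.Class i_mixin).
pose Q := distribution P i_pack : probability _ R.
have nuQ : nu `<< Q.
  apply/null_content_dominatesP => A mA QA0.
  have mA' : d.-measurable A by apply: Gm; rewrite -sub_sigma_algebraE.
  apply: null_set_integral => //; apply: measurable_funTS.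
  exact: (measurable_int P iX).
have [Zi ZE] := (Radon_Nikodym_integrable nuQ, fun A =>
  @Radon_Nikodym_integral _ _ _ _ _ A nuQ).
pose Z := fine \o Radon_Nikodym nu Q : T -> R.
have ZRN w : (Z w)%:E = Radon_Nikodym nu Q w.
  by rewrite /Z /= fineK // Radon_Nikodym_fin_num.
have mRN : measurable_fun [set: g_sigma_algebraType G] (Radon_Nikodym nu Q).
  exact: measurable_int Zi.
have mZ : measurable_wrt G Z by exact: measurableT_comp mRN.
have iZ : P.-integrable [set: T] (EFin \o Z).
  have /integrableP[_ fin] := Zi; apply/integrableP; split.
    apply/measurable_EFinP => _ B mB; have := mZ measurableT B mB.
    by rewrite sub_sigma_algebraE => /Gm.
  move: fin; rewrite ge0_integral_pushforward //.
    apply: le_lt_trans; rewrite le_eqVlt; apply/orP; left; apply/eqP.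
    by apply: eq_integral => w _; congr abse; exact: ZRN.
  exact: measurableT_comp.
exists Z; split=> // A GA.
have mA : measurable (A : set (g_sigma_algebraType G)) by rewrite sub_sigma_algebraE.
transitivity (\int[Q]_(w in (A : set (g_sigma_algebraType G))) Radon_Nikodym nu Q
  w); last first.
  exact: esym (ZE A mA).
rewrite integral_pushforward //.
  by apply: eq_integral => w _; exact: ZRN.
have := integrableS measurableT (Gm GA) (@subsetT _ _) iZ.
apply: eq_integrable; first exact: (Gm GA).
by move=> w _; exact: ZRN.
Qed.

(** On the event W < V intersected with -n <= V and W <= n both functions are
    integrable, so the comparison of the integrals forces this event to be null; these
    events exhaust W < V. *)
Lemma sub_measurable_ae_le (V W : T -> \bar R) : sub_measurable V ->
  sub_measurable W ->
  \int[P]_w V^\+ w < +oo ->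
  (forall B, G B -> \int[P]_(w in B) V w <= \int[P]_(w in B) W w) ->
  \forall w \ae P, V w <= W w.
Proof.
move=> gV gW Vp VW.
have mV := sub_measurableW gV; have mW := sub_measurableW gW.
pose B (n : nat) := [set w | W w < V w] `&`
  ([set w | (- n%:R)%:E <= V w] `&` [set w | W w <= n%:R%:E]).
have gcst (r : R) : sub_measurable (cst r%:E) by exact: measurable_cst.
have GB n : G (B n).
  apply: sub_setI; first exact: sub_measurable_lt.
  by apply: sub_setI; [exact: (sub_measurable_le (gcst _))|exact:
    (sub_measurable_le _ (gcst _))].
have B0 n : P (B n) = 0.
  have mB := Gm (GB n).
  have ic (r : R) : P.-integrable (B n) (EFin \o cst r).
    exact: finite_measure_integrable_cst.
  have iV : P.-integrable (B n) V.
    have [//|VNy] := integrableVNy mB (measurable_funTS mV)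
      (upper_integrableS mB measurableT (@subsetT _ _) mV Vp).
    have : \int[P]_(w in B n) (- n%:R)%:E <= \int[P]_(w in B n) V w.
      apply: ae_le_integral => //; first exact: measurable_funTS.
      by apply: aeW => w [_ []].
    rewrite VNy leeNy_eq => /eqP cNy.
    by have := integrable_fin_num mB (ic (- n%:R)%R); rewrite cNy.
  have iW : P.-integrable (B n) W.
    have Wp : \int[P]_(w in B n) W^\+ w < +oo.
      apply: le_lt_trans (integral_funepos_lt_pinfty mB (ic n%:R)).
      apply: ge0_le_integral => //.
      - by apply: measurable_funTS; exact: measurable_funepos.
      - by apply: measurable_funepos; exact: (measurable_int P (ic _)).
      - by move=> w [_ [_ /= Wn]]; rewrite !funeposE ge_max !le_max Wn lexx orbT.
    have [//|WNy] := integrableVNy mB (measurable_funTS mW) Wp.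
    have := VW _ (GB n); rewrite WNy leeNy_eq => /eqP cNy.
    by have := integrable_fin_num mB iV; rewrite cNy.
  have : \int[P]_(w in B n) (V w - W w) <= 0.
    by rewrite integralB // sube_le0 VW.
  have VW0 w : B n w -> 0 <= V w - W w.
    move=> [/= + _]; case: (V w) => [v| |]; case: (W w) => [u| |] //=.
    - by rewrite lte_fin lee_fin subr_ge0 => /ltW.
    - by rewrite leey.
    - by rewrite leey.
    - by rewrite leey.
  move=> I0.
  have : \int[P]_(w in B n) (V w - W w) = 0.
    by apply/eqP; rewrite eq_le I0 integral_ge0.
  have mVW : measurable_fun (B n) (fun w => V w - W w).
    by apply: emeasurable_funB; exact: measurable_funTS.
  rewrite (eq_integral (fun w => `|V w - W w|)); last first.
    by move=> w /[!inE] Bw; rewrite gee0_abs // VW0.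
  move/(ae_eq_integral_abs P mB mVW) => [N [mN N0 sN]].
  apply: (subset_measure0 mB mN _ N0) => w Bw; apply: sN => /= /(_ Bw).
  move: Bw => [/= WV [/= Vn Wn]].
  move: WV; case: (V w) => [v| |]; case: (W w) => [u| |] //=.
  by rewrite lte_fin => uv [] /eqP; rewrite subr_eq0 => /eqP vu;
    rewrite vu ltxx in uv.
suff : P.-negligible (~` [set w | V w <= W w]) by [].
apply: (@negligibleS _ _ _ _ (\bigcup_n B n)); last first.
  by apply: negligible_bigcup => n; apply/negligibleP; [exact: Gm (GB n)|exact: B0].
move=> w /= /negP; rewrite -ltNge => WV.
have [n nV] : exists n : nat, (- n%:R)%:E <= V w.
  case: (V w) WV => [v _| |]; last by rewrite ltNge leNye.
  - exists (Num.bound `|v|%R); rewrite lee_fin lerNl.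
    by apply: ltW; apply: le_lt_trans (ler_norm _) _; rewrite normrN;
      exact: archi_boundP.
  - by exists 0%N; exact: leey.
have [m mWn] : exists n : nat, W w <= n%:R%:E.
  case: (W w) WV => [v _| |].
  - exists (Num.bound `|v|%R); rewrite lee_fin.
    by apply: ltW; apply: le_lt_trans (ler_norm _) _; exact: archi_boundP.
  - by rewrite ltNge leey.
  - by exists 0%N; exact: leNye.
exists (maxn n m) => //; split => //; split => /=.
- by apply: le_trans nV; rewrite lee_fin lerN2 ler_nat leq_maxl.
- by apply: le_trans mWn _; rewrite lee_fin ler_nat leq_maxr.
Qed.

Lemma measurable_contract : measurable_fun [set: \bar R] (@contract R).
Proof.
apply: (measurability _ (RGenOInfty.measurableE R)) => // _ [_ [a ->] <-].
rewrite setTI.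
have [a1|a1] := leP `|a|%R 1%R.
  rewrite (_ : _ @^-1` _ = `]expand a, +oo[%classic); first exact: emeasurable_itv.
  apply/seteqP; split => x /=; rewrite !in_itv /= !andbT.
    by rewrite -lt_contract expandK.
  by rewrite -lt_contract expandK.
have [a0|a0] := leP 0%R a.
  rewrite ger0_norm // in a1.
  rewrite (_ : _ @^-1` _ = set0) //; apply/seteqP; split => // x /=.
  rewrite in_itv /= andbT => ax.
  have := contract_le1 x; rewrite leNgt => /negP; apply.
  by apply: lt_le_trans (ler_norm _); exact: lt_trans ax.
rewrite ltr0_norm // in a1.
rewrite (_ : _ @^-1` _ = setT); first exact: measurableT.
apply/seteqP; split => // x _ /=; rewrite in_itv /= andbT.
have := contract_le1 x; rewrite ler_norml => /andP[+ _].
by apply: lt_le_trans; rewrite ltrNr.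
Qed.
End sub_sigma_algebra.

(** * Essential suprema of directed families *)

Section directed.
Local Open Scope ereal_scope.
Context d (T : measurableType d) (R : realType) (P : probability T R).

Let k (f : T -> \bar R) w := contract (f w).

Let mk f : measurable_fun [set: T] f -> measurable_fun [set: T] (k f).
Proof. by move=> mf; exact: measurableT_comp (@measurable_contract R) mf. Qed.

Let ik f : measurable_fun [set: T] f -> P.-integrable [set: T] (EFin \o k f).
Proof.
move=> mf; apply: (@le_integrable _ _ _ _ _ measurableT _ (EFin \o cst 1%R)).
- exact/measurable_EFinP/mk.
- by move=> w _ /=; rewrite lee_fin normr1 contract_le1.
- exact: finite_measure_integrable_cst.
Qed.

(** The increasing bijection contract from the extended line to [-1, 1] makes every
    family member integrable. A sequence whose integrals approach the supremum can be
    chosen increasing because the family is directed, and its pointwise supremum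
    dominates each member, since otherwise some integral could be increased further. *)
Lemma directed_ess_sup (I : Type) (i0 : I) (phi : I -> T -> \bar R) :
  (forall i, measurable_fun [set: T] (phi i)) ->
  (forall i j, exists l, \forall w \ae P, phi i w <= phi l w /\ phi j w <= phi l w) ->
  exists s : nat -> I, [/\ \forall w \ae P, phi i0 w <= phi (s 0%N) w,
    forall n, \forall w \ae P, phi (s n) w <= phi (s n.+1) w &
    forall i, \forall w \ae P, phi i w <= ereal_sup (range (fun n => phi (s n) w))].
Proof.
move=> mphi dir.
pose c i := \int[P]_w (k (phi i) w)%:E.
pose m := ereal_sup (range c).
have c1 i : c i <= 1.
  rewrite /c; apply: (@le_trans _ _ (\int[P]_w (cst 1%:E w))).
    apply: le_integral => //; [exact: ik|exact: finite_measure_integrable_cst|].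
    by move=> w _; rewrite lee_fin (le_trans (ler_norm _)) // contract_le1.
  by rewrite integral_cst // mul1e; exact: probability_le1.
have m1 : m <= 1 by apply: ge_ereal_sup => _ [i _ <-].
have cf i : c i \is a fin_num by exact: integrable_fin_num (ik (mphi i)).
have mfin : m \is a fin_num.
  rewrite fin_real // (le_lt_trans m1) ?ltry // andbT.
  apply: (@lt_le_trans _ _ (c i0)); last by apply: ereal_sup_ubound; exists i0.
  by have := cf i0; rewrite fin_numElt => /andP[].
have near n : exists i, m - (n.+1%:R^-1)%:E < c i.
  have n0 : (0 < n.+1%:R^-1 :> R)%R by rewrite invr_gt0.
  have [_ [i _ <-] mi] := @ub_ereal_sup_adherent _ _ _ n0 mfin.
  by exists i.
pose j n := projT1 (cid (near n)).
pose l a b := projT1 (cid (dir a b)).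
have lP a b : \forall w \ae P, phi a w <= phi (l a b) w /\ phi b w <= phi (l a b) w.
  exact: projT2 (cid (dir a b)).
pose s := fix s n := if n is n'.+1 then l (s n') (j n'.+1) else l i0 (j 0%N).
have js n : \forall w \ae P, phi (j n) w <= phi (s n) w.
  case: n => [|n].
    by apply: filterS (lP i0 (j 0%N)) => w [].
  by apply: filterS (lP (s n) (j n.+1)) => w [].
have le_c a b : (\forall w \ae P, phi a w <= phi b w) -> c a <= c b.
  move=> ab; apply: ae_le_integral => //; [exact/measurable_EFinP/mk..|].
  by apply: filterS ab => w ab _; rewrite lee_fin le_contract.
exists s; split.
- by apply: filterS (lP i0 (j 0%N)) => w [].
- by move=> n; apply: filterS (lP (s n) (j n.+1)) => w [].
move=> i; pose V w := ereal_sup (range (fun n => phi (s n) w)).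
have sV n w : phi (s n) w <= V w by apply: ereal_sup_ubound; exists n.
have mV : measurable_fun [set: T] V.
  by apply: measurable_ereal_sup_range => n; exact: mphi.
pose h w := Num.max (k (phi i) w - k V w)%R 0%R.
have mh : measurable_fun [set: T] h.
  by apply: measurable_maxr => //; apply: measurable_funB; exact: mk.
have h0 w : (0 <= h w)%R by rewrite le_max lexx orbT.
have hn n : \int[P]_w (h w)%:E <= (n.+1%:R^-1)%:E.
  pose q := l (s n) i.
  have cq : c q - c (s n) <= (n.+1%:R^-1)%:E.
    have cqm : c q <= m by apply: ereal_sup_ubound; exists q.
    have := projT2 (cid (near n)); rewrite -/(j n) => mj.
    have mc := le_trans (ltW mj) (le_c _ _ (js n)).
    rewrite leeBlDr //; apply: le_trans cqm _.
    by rewrite -leeBlDl.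
  apply: le_trans cq; rewrite -integralB //; [|exact: ik..].
  apply: ae_le_integral => //.
  - exact/measurable_EFinP.
  - by apply: emeasurable_funB; exact/measurable_EFinP/mk.
  apply: filterS (lP (s n) i) => w [sq iq] _.
  rewrite -EFinB lee_fin ge_max /k subr_ge0 le_contract sq andbT.
  by apply: lerB; rewrite le_contract.
have hi0 : \int[P]_w (h w)%:E = 0.
  apply/eqP; rewrite eq_le integral_ge0 ?andbT; last by move=> w _; rewrite lee_fin.
  apply/lee_addgt0Pr => e e0; rewrite add0e.
  have [n ne] := exists_natSinv_lt e0.
  by apply: le_trans (hn n) _; rewrite lee_fin ltW.
have : \int[P]_w `|(h w)%:E| = 0.
  by rewrite -hi0; apply: eq_integral => w _; rewrite gee0_abs // lee_fin.
move/(ae_eq_integral_abs P measurableT); have /measurable_EFinP mhE := mh.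
move/(_ mhE); apply: filterS => w /(_ Logic.I) /eqP; rewrite eqe => /eqP hw0.
have : (h w <= 0)%R by rewrite hw0.
by rewrite ge_max subr_le0 /k le_contract => /andP[].
Qed.

Variable G : set (set T).
Hypothesis sG : sigma_algebra [set: T] G.
Hypothesis Gm : G `<=` d.-measurable.

(** Replaces an essential supremum by a supremum of set functions. The gluing
    hypothesis on the set functions makes their densities directed (glue along the
    event where one density is the larger), so by monotone convergence the supremum of
    the set functions is again a measure, with density the essential supremum. All later
    arguments about conditional values use such set functions, which spares the choice
    of versions. *)
Lemma directed_sup_density (I : Type) (i0 : I) (m : I -> set T -> \bar R)
    (phi : I -> T -> \bar R) :
  (forall i, sub_measurable G (phi i)) -> (forall i, \int[P]_w (phi i)^\+ w < +oo) ->
  P.-integrable [set: T] (phi i0) ->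
  (forall i B, G B -> \int[P]_(w in B) phi i w = m i B) ->
  (forall i j B, G B -> exists l, forall A, G A ->
     (A `<=` B -> m l A = m i A) /\ (A `<=` ~` B -> m l A = m j A)) ->
  exists s : nat -> I, let V := fun w => ereal_sup (range (fun n => phi (s n) w)) in
  [/\ sub_measurable G V, (forall i, \forall w \ae P, phi i w <= V w),
      (forall n, \forall w \ae P, phi (s n) w <= phi (s n.+1) w),
      (\forall w \ae P, phi i0 w <= phi (s 0%N) w) &
      forall B, G B -> \int[P]_(w in B) V w = ereal_sup (range (m ^~ B))].
Proof.
move=> gphi phip iphi0 phiE glue.
have mphi i := sub_measurableW sG Gm (gphi i).
have dir i j : exists l, \forall w \ae P, phi i w <= phi l w /\ phi j w <= phi l w.
  pose B := [set w | phi j w <= phi i w].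
  have GB : G B by exact: sub_measurable_le.
  have [l lP] := glue i j B GB.
  exists l.
  have restr (f : T -> \bar R) D : G D -> sub_measurable G f ->
    sub_measurable G (f \_ D).
    move=> GD gf; apply/(measurable_restrictT _ _).1 => //.
      by rewrite sub_sigma_algebraE.
    exact: measurable_funTS.
  have cmp i' D : G D -> (forall A, G A -> A `<=` D -> m l A = m i' A) ->
      \forall w \ae P, D w -> phi i' w <= phi l w.
    move=> GD HD.
    have : \forall w \ae P, (phi i' \_ D) w <= (phi l \_ D) w.
      apply: (sub_measurable_ae_le sG Gm (restr _ _ GD (gphi _))
        (restr _ _ GD (gphi _))).
        apply: le_lt_trans (phip i'); apply: ge0_le_integral => //.
        - by apply: measurable_funepos;
          exact: sub_measurableW (restr _ _ GD (gphi _)).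
        - exact: measurable_funepos.
        - move=> w _; rewrite !funeposE patchE; case: ifP => // _.
          by rewrite maxxx le_max lexx orbT.
      move=> A GA.
      have GAD : G (A `&` D) by exact: sub_setI.
      by rewrite -!integral_mkcondr !phiE // HD //; exact: subIsetr.
    by apply: filterS => w + Dw; rewrite !patchE mem_set.
  have c1 := cmp i B GB (fun A GA => (lP A GA).1).
  have c2 := cmp j (~` B) (sub_setC sG GB) (fun A GA => (lP A GA).2).
  apply: (filterS2 _ _ c1 c2) => w h1 h2.
  have [Bw|Bw] := pselect (B w).
    by split; [exact: h1|exact: le_trans (h1 Bw)].
  split; last exact: h2.
  apply: le_trans (h2 Bw).
  by move/negP: Bw; rewrite -ltNge => /ltW.
have [s [s0 snd sV]] := directed_ess_sup i0 mphi dir.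
exists s; split => //.
  by apply: (@measurable_ereal_sup_range _ (g_sigma_algebraType G)) => n; exact: gphi.
move=> B GB; have mB := Gm GB.
have ih : P.-integrable B (EFin \o (fun w => fine (phi i0 w))).
  apply: (@integrableS _ _ _ _ setT) => //.
  apply: (le_integrable measurableT _ _ iphi0) => /=.
    by apply/measurable_EFinP; exact: measurableT_comp.
  by move=> w _; case: (phi i0 w) => //=; rewrite normr0 leey.
have finphi : \forall w \ae P, phi i0 w \is a fin_num.
  by have := integrable_ae measurableT iphi0; apply: filterS => w; exact.
have VE : \int[P]_(w in B) ereal_sup (range (fun n => phi (s n) w)) =
    ereal_sup (range (fun n => \int[P]_(w in B) phi (s n) w)).
  apply: (nondecreasing_integral_sup mB ih).
  - by move=> n; exact: measurable_funTS.
  - by apply: (filterS2 _ _ finphi s0) => w fw; rewrite fineK.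
  - exact: snd.
apply/eqP; rewrite eq_le; apply/andP; split.
  rewrite VE; apply: ge_ereal_sup => _ [n _ <-]; rewrite phiE //.
  by apply: ereal_sup_ubound; exists (s n).
apply: ge_ereal_sup => _ [i _ <-]; rewrite -phiE //.
apply: ae_le_integral => //; [exact: measurable_funTS| |].
- by apply: measurable_ereal_sup_range => n; exact: measurable_funTS.
- by apply: filterS (sV i).
Qed.

Lemma directed_inf_density (I : Type) (i0 : I) (m : I -> set T -> \bar R)
    (phi : I -> T -> R) :
  (forall i, sub_measurable G (EFin \o phi i)) ->
  (forall i, P.-integrable [set: T] (EFin \o phi i)) ->
  (forall i B, G B -> \int[P]_(w in B) (phi i w)%:E = m i B) ->
  (forall i j B, G B -> exists l, forall A, G A ->
     (A `<=` B -> m l A = m i A) /\ (A `<=` ~` B -> m l A = m j A)) ->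
  exists s : nat -> I, let V := fun w =>
    ereal_inf (range (fun n => (phi (s n) w)%:E)) in
  [/\ sub_measurable G V, (forall i, \forall w \ae P, V w <= (phi i w)%:E),
      (forall n, \forall w \ae P, (phi (s n.+1) w <= phi (s n) w)%R) &
      forall B, G B -> \int[P]_(w in B) V w = ereal_inf (range (m ^~ B))].
Proof.
move=> gphi iphi phiE glue.
have iN i B : G B -> \int[P]_(w in B) (- phi i w)%:E = - m i B.
  move=> GB; have iB : P.-integrable B (EFin \o phi i).
    by apply: integrableS (iphi i) => //; exact: Gm.
  rewrite -phiE // -integralN //.
  by rewrite fin_num_adde_defl // fin_numN integrable_neg_fin_num //; exact: Gm.
have [|||||s [gV leV snd _ _]] := @directed_sup_density I i0 (fun i B => - m i B)
    (fun i => EFin \o (fun w => - phi i w)%R).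
- move=> i; apply/measurable_EFinP/measurable_funN/measurable_EFinP; exact: gphi.
- move=> i; apply: integral_funepos_lt_pinfty => //.
  by have := integrableN (iphi i); apply: eq_integrable.
- by have := integrableN (iphi i0); apply: eq_integrable.
- by move=> i B GB; exact: iN.
- move=> i j B /(glue i j)[l lP]; exists l => A GA.
  by split => AB; congr (- _); [exact: (lP A GA).1|exact: (lP A GA).2].
set W := fun w => _ in gV leV.
exists s => V.
have VW : V = fun w => - W w.
  apply/funext => w; rewrite /V ereal_infEN; congr (- ereal_sup _); apply/seteqP.
  by split=> [_ [_ [n _ <-] <-]|_ [n _ <-]];
    [exists n|exists (phi (s n) w)%:E => //; exists n].
have leVphi i : \forall w \ae P, V w <= (phi i w)%:E.
  by apply: filterS (leV i) => w; rewrite VW leeNl.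
have gV' : sub_measurable G V by rewrite VW; exact: measurableT_comp gV.
have phid n : \forall w \ae P, (phi (s n.+1) w <= phi (s n) w)%R.
  by apply: filterS (snd n) => w; rewrite /= lee_fin lerN2.
split => // B GB; have mB := Gm GB.
have iB i : P.-integrable B (EFin \o phi i) by exact: integrableS (iphi i).
apply/eqP; rewrite eq_le; apply/andP; split.
  apply: le_ereal_inf_tmp => _ [i _ <-]; rewrite -phiE //.
  apply: ae_le_integral => //.
  - by apply: measurable_funTS; exact: (sub_measurableW sG Gm gV').
  - exact: measurable_int (iB i).
  - by apply: filterS (leVphi i).
rewrite nonincreasing_integral_inf //; apply: le_ereal_inf_tmp => _ [n _ <-].
by rewrite phiE //; apply: ereal_inf_lbound; exists (s n).
Qed.
End directed.

(** * Stopping times *)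

Section stopping_times.
Context d (Omega : measurableType d) (R : realType) (P : probability Omega R).
Variables (T : R) (F : R -> set (set Omega)).
Hypothesis hT : 0 < T.
Hypothesis hF : filtration T F.
Local Notation st := (stopping_time T F).
Local Notation Fs := (sigma_before T F).
Implicit Types (A B : set Omega).

Lemma filt_sigma_algebra u : 0 <= u <= T -> sigma_algebra [set: Omega] (F u).
Proof. exact: filtration_sigma_algebra. Qed.

Let FtE u (hu : 0 <= u <= T) := sub_sigma_algebraE (filt_sigma_algebra hu).

Lemma st_ge0 s w : st s -> 0 <= s w.
Proof. by case=> /(_ w)/andP[]. Qed.

Lemma st_leT s w : st s -> s w <= T.
Proof. by case=> /(_ w)/andP[]. Qed.

Lemma st_le s u : st s -> 0 <= u <= T -> F u [set w | s w <= u].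
Proof. by case=> _; exact. Qed.

Lemma filtS u v : 0 <= u -> u <= v -> v <= T -> F u `<=` F v.
Proof. exact: filtration_nondecreasing. Qed.

Lemma filt0 u : 0 <= u <= T -> F u set0.
Proof. by move=> hu; rewrite -(FtE hu); exact: measurable0. Qed.

Lemma filtT u : 0 <= u <= T -> F u setT.
Proof. by move=> hu; rewrite -(FtE hu); exact: measurableT. Qed.

Lemma filtI u A B : 0 <= u <= T -> F u A -> F u B -> F u (A `&` B).
Proof. by move=> hu; rewrite -(FtE hu); exact: measurableI. Qed.

Lemma filtC u A : 0 <= u <= T -> F u A -> F u (~` A).
Proof. by move=> hu; rewrite -(FtE hu); exact: measurableC. Qed.

Lemma filt_le s u c : st s -> 0 <= u <= T -> c <= u -> F u [set w | s w <= c].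
Proof.
move=> hs hu cu; have /andP[u0 uT] := hu.
have [c0|c0] := ltP c 0.
  rewrite (_ : [set _ | _] = set0); first exact: filt0.
  apply/seteqP; split => // w /= sc.
  by have := le_lt_trans sc c0; rewrite ltNge st_ge0.
by apply: (filtS c0 cu uT); apply: st_le; rewrite // c0 (le_trans cu).
Qed.

Lemma measurable_min_st s u : st s -> 0 <= u <= T ->
  measurable_fun [set: g_sigma_algebraType (F u)] (fun w => Num.min (s w) u).
Proof.
move=> hs hu _.
apply: (measurability _ (RGenOInfty.measurableE R)) => // _ [_ [a ->] <-].
rewrite setTI FtE //.
rewrite (_ : _ @^-1` _ = [set w | a < Num.min (s w) u]); last first.
  by apply/seteqP; split => w /=; rewrite in_itv /= andbT.
have [ua|au] := leP u a.
  rewrite (_ : [set _ | _] = set0); first exact: filt0.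
  by apply/seteqP; split => // w /=; rewrite lt_min => /andP[_ /(le_lt_trans ua)];
    rewrite ltxx.
rewrite (_ : [set _ | _] = ~` [set w | s w <= a]).
  by apply: filtC => //; apply: filt_le => //; exact: ltW.
apply/seteqP; split => w /=; rewrite lt_min au andbT ltNge.
  by move/negP.
by move/negP.
Qed.

Lemma Fs_sigma_algebra s : st s -> sigma_algebra [set: Omega] (Fs s).
Proof.
move=> hs; split.
- by move=> u hu; rewrite set0I; exact: filt0.
- move=> A FA u hu; rewrite setTD.
  rewrite (_ : _ `&` _ = [set w | s w <= u] `&` ~` (A `&` [set w | s w <= u])).
    by apply: filtI; [|exact: st_le|apply: filtC => //; exact: FA].
  apply/seteqP; split => w /=; first by move=> [Aw sw]; split => // -[].
  by move=> [sw nA]; split => // Aw; exact: nA.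
- move=> A FA u hu; rewrite setI_bigcupl -(FtE hu).
  by apply: bigcup_measurable => k _; rewrite FtE //; exact: FA.
Qed.

Lemma Fs_measurable s : st s -> Fs s `<=` d.-measurable.
Proof.
move=> hs A /(_ T); rewrite lexx ltW //= => /(_ isT).
rewrite (_ : A `&` _ = A); last first.
  by apply/seteqP; split => w; [case|split => //=; exact: st_leT].
by apply: filtration_measurable hF _ _ _; rewrite lexx ltW.
Qed.

Lemma Fs_sub s t A : st s -> st t -> Fs s A -> A `<=` [set w | s w <= t w] -> Fs t A.
Proof.
move=> hs ht FA Ast u hu.
rewrite (_ : A `&` _ = (A `&` [set w | s w <= u]) `&` [set w | t w <= u]).
  by apply: filtI => //; [exact: FA|exact: st_le].
apply/seteqP; split => w /=; last by move=> [[]].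
by move=> [Aw tu]; split => //; split => //; apply: le_trans tu; exact: Ast.
Qed.

Lemma FsS s t : st s -> st t -> (forall w, s w <= t w) -> Fs s `<=` Fs t.
Proof. by move=> hs ht st_ A FA; apply: Fs_sub FA _ => // w _ /=. Qed.

Lemma FsI s A B : st s -> Fs s A -> Fs s B -> Fs s (A `&` B).
Proof. by move=> hs; exact: sub_setI (Fs_sigma_algebra hs) _ _. Qed.

Lemma FsC s A : st s -> Fs s A -> Fs s (~` A).
Proof. by move=> hs; exact: sub_setC (Fs_sigma_algebra hs) _. Qed.

Lemma FsD s A B : st s -> Fs s A -> Fs s B -> Fs s (A `\` B).
Proof. by move=> hs FA FB; rewrite setDE; apply: FsI => //; exact: FsC. Qed.

Lemma FsT s : st s -> Fs s setT.
Proof. by move=> hs; exact: sub_setT (Fs_sigma_algebra hs). Qed.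

Lemma Fs_le s t : st s -> st t -> Fs s [set w | s w <= t w].
Proof.
move=> hs ht u hu.
rewrite (_ : _ `&` _ = [set w | s w <= u] `&`
    [set w | Num.min (s w) u <= Num.min (t w) u]).
  apply: filtI => //; first exact: st_le.
  have := measurable_fun_ler (measurable_min_st hs hu) (measurable_min_st ht hu).
  move=> /(_ measurableT [set true]); rewrite setTI FtE //; exact.
apply/seteqP; split => w /= [].
  by move=> st_ su; split => //; rewrite le_min !ge_min st_ lexx orbT.
by move=> su; rewrite (min_l su) le_min => /andP[].
Qed.

Lemma Fs_ge s t : st s -> st t -> Fs s [set w | t w <= s w].
Proof.
move=> hs ht u hu.
rewrite (_ : _ `&` _ = [set w | t w <= u] `&` [set w | s w <= u] `&`
    [set w | Num.min (t w) u <= Num.min (s w) u]).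
  apply: filtI => //; first by apply: filtI => //; exact: st_le.
  have := measurable_fun_ler (measurable_min_st ht hu) (measurable_min_st hs hu).
  move=> /(_ measurableT [set true]); rewrite setTI FtE //; exact.
apply/seteqP; split => w /= [].
  move=> ts su; have tu := le_trans ts su.
  by split => //; rewrite (min_l tu) (min_l su).
by move=> [tu su]; rewrite (min_l tu) (min_l su).
Qed.

Lemma Fs_lt s t : st s -> st t -> Fs s [set w | s w < t w].
Proof.
move=> hs ht; rewrite (_ : [set _ | _] = ~` [set w | t w <= s w]).
  by apply: FsC => //; exact: Fs_ge.
by apply/seteqP; split => w /=; rewrite ltNge => /negP.
Qed.

Lemma Fs_gt s t : st s -> st t -> Fs s [set w | t w < s w].
Proof.
move=> hs ht; rewrite (_ : [set _ | _] = ~` [set w | s w <= t w]).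
  by apply: FsC => //; exact: Fs_le.
by apply/seteqP; split => w /=; rewrite ltNge => /negP.
Qed.

Lemma st_max s t : st s -> st t -> st (s \max t).
Proof.
move=> hs ht; split=> [w|u hu].
  by rewrite le_max ge_max (st_ge0 _ hs) !st_leT.
rewrite (_ : [set _ | _] = [set w | s w <= u] `&` [set w | t w <= u]).
  by apply: filtI => //; exact: st_le.
by apply/seteqP; split => w /=; rewrite ge_max => /andP.
Qed.

Lemma st_cst c : 0 <= c <= T -> st (cst c).
Proof.
move=> hc; split => // u hu; have [cu|uc] := leP c u.
  rewrite (_ : [set _ | _] = setT); first exact: filtT.
  by apply/seteqP; split.
rewrite (_ : [set _ | _] = set0); first exact: filt0.
by apply/seteqP; split => // w; rewrite /= leNgt uc.
Qed.

Lemma st_cst0 : st (cst 0).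
Proof. by apply: st_cst; rewrite lexx ltW. Qed.

Lemma st_cstT : st (cst T).
Proof. by apply: st_cst; rewrite lexx ltW. Qed.

Definition glue B (s t : Omega -> R) w := if `[< B w >] then s w else t w.

Lemma glue_in B s t w : B w -> glue B s t w = s w.
Proof. by move=> Bw; rewrite /glue asboolT. Qed.

Lemma glue_out B s t w : ~ B w -> glue B s t w = t w.
Proof. by move=> Bw; rewrite /glue asboolF. Qed.

Lemma st_glue B s t : st s -> st t -> Fs s B -> Fs t B -> st (glue B s t).
Proof.
move=> hs ht FsB FtB; split=> [w|u hu].
  by rewrite /glue; case: ifP => _; [exact: hs.1|exact: ht.1].
rewrite (_ : [set _ | _] =
    (B `&` [set w | s w <= u]) `|` (~` B `&` [set w | t w <= u])).
  rewrite -(FtE hu); apply: measurableU; rewrite FtE //.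
    exact: FsB.
  by apply: (FsC ht FtB).
apply/seteqP; split => w /=.
  by rewrite /glue; case: asboolP => Bw; [left|right].
by move=> [[Bw]|[Bw]]; rewrite ?(glue_in _ _ Bw) ?(glue_out _ _ Bw).
Qed.

Lemma st_min s t : st s -> st t -> st (s \min t).
Proof.
move=> hs ht.
rewrite (_ : s \min t = glue [set w | s w <= t w] s t).
  by apply: st_glue => //; [exact: Fs_le|exact: Fs_ge].
by apply/funext => w; rewrite /glue /= asboolb minEle.
Qed.

(** The plan of a minimizer who intends to stop at rho and, should the maximizer
    stop strictly earlier, goes on with r. *)
Definition reply rho r tau : Omega -> R :=
  glue [set w | tau w < rho w] (r \max tau) rho.

Lemma reply_lt rho r tau w : tau w < rho w ->
  reply rho r tau w = Num.max (r w) (tau w).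
Proof. by move=> tr; rewrite /reply glue_in. Qed.

Lemma reply_ge rho r tau w : rho w <= tau w -> reply rho r tau w = rho w.
Proof. by move=> tr; rewrite /reply glue_out //= ltNge tr. Qed.

Lemma st_reply rho r tau : st rho -> st r -> st tau -> st (reply rho r tau).
Proof.
move=> hrho hr htau; have hm := st_max hr htau.
apply: st_glue => //; last exact: Fs_gt.
apply: (FsS htau hm); last exact: Fs_lt.
by move=> w; rewrite /= le_max lexx orbT.
Qed.

Definition later (s : Omega -> R) (e : R) w := Num.min (s w + e) T.

Lemma st_later s e : st s -> 0 <= e -> st (later s e).
Proof.
move=> hs e0; split=> [w|u hu].
  by rewrite /later le_min ge_min lexx orbT andbT (ltW hT) addr_ge0 // st_ge0.
have /andP[u0 uT] := hu.
have [Tu|uT'] := leP T u.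
  rewrite (_ : [set _ | _] = setT); first exact: filtT.
  by apply/seteqP; split => // w _ /=; rewrite ge_min Tu orbT.
rewrite (_ : [set _ | _] = [set w | s w <= u - e]).
  by apply: filt_le => //; rewrite gerBl.
apply/seteqP; split => w /=; rewrite ge_min leNgt [T <= u]leNgt uT' orbF -leNgt.
  by rewrite lerBrDr.
by rewrite lerBrDr.
Qed.

Hypothesis rcF : forall t : R, 0 <= t < T -> F t = \bigcap_(s in `]t, T]) F s.

(** Right continuity of the filtration is what turns the event inf <= u, which is
    decided immediately after u, into an event of F u. *)
Lemma st_inf (s_ : nat -> Omega -> R) : (forall n, st (s_ n)) ->
  st (fun w => inf (range (s_ ^~ w))).
Proof.
move=> hs.
have lb w : has_lbound (range (s_ ^~ w)).
  by exists 0 => _ [n _ <-]; exact: st_ge0.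
have hi w : has_inf (range (s_ ^~ w)).
  by split; [exists (s_ 0%N w); exists 0%N|exact: lb].
split=> [w|u hu].
  apply/andP; split.
    by apply: lb_le_inf; [exists (s_ 0%N w); exists 0%N|move=> _ [n _ <-];
      exact: st_ge0].
  by apply: le_trans (st_leT w (hs 0%N)); apply: ge_inf => //; exists 0%N.
have /andP[u0 uT] := hu.
have [Tu|uT'] := leP T u.
  rewrite (_ : [set _ | _] = setT); first exact: filtT.
  apply/seteqP; split => // w _ /=; apply: le_trans Tu.
  by apply: le_trans (st_leT w (hs 0%N)); apply: ge_inf => //; exists 0%N.
rewrite rcF ?u0 // => v; rewrite /= in_itv /= => /andP[uv vT].
have hv : 0 <= v <= T by rewrite vT andbT (le_trans u0) // ltW.
rewrite (_ : [set _ | _] = \bigcap_m \bigcup_n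
    [set w | s_ n w <= Num.min v (u + m.+1%:R^-1)]).
  rewrite -(FtE hv); apply: bigcap_measurableType => m _.
  apply: bigcup_measurable => n _; rewrite FtE //.
  by apply: filt_le; rewrite // ge_min lexx.
apply/seteqP; split => w /=.
  move=> iu m _.
  have : inf (range (s_ ^~ w)) < Num.min v (u + m.+1%:R^-1).
    by apply: le_lt_trans iu _; rewrite lt_min uv ltrDl invr_gt0 ltr0n.
  by move=> /(inf_lt (hi w).1)[_ [n _ <-]] /ltW ?; exists n.
move=> H; apply/ler_addgt0Pr => e e0.
have [m me] := exists_natSinv_lt e0.
have [n _ /=] := H m Logic.I; rewrite le_min => /andP[_ snu].
apply: (@le_trans _ _ (s_ n w)); first by apply: ge_inf => //; exists n.
by apply: le_trans snu _; rewrite lerD2l ltW.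
Qed.

(** * Payoffs and their right continuity *)

Variable U : (Omega -> R) -> (Omega -> R) -> Omega -> R.
Hypothesis hU : biadmissible P T F U.

Lemma U_measurable rho tau : st rho -> st tau ->
  measurable_fun [set: Omega] (U rho tau).
Proof.
move=> hrho htau; have hm := st_max hrho htau.
move=> _ B mB; have := biadmissible_measurable hU hrho htau measurableT mB.
by rewrite (sub_sigma_algebraE (Fs_sigma_algebra hm)) => /(Fs_measurable hm).
Qed.

Lemma U_integrable rho tau : st rho -> st tau ->
  P.-integrable [set: Omega] (EFin \o U rho tau).
Proof.
move=> hrho htau; have mU := U_measurable hrho htau.
have [M UM] := biadmissible_bounded hU hrho htau.
apply/integrableP; split; first exact/measurable_EFinP.
apply: (@le_lt_trans _ _ (\int[P]_w (cst M%:E w))%E).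
  apply: ae_le_integral => //.
    by apply: measurableT_comp => //; exact/measurable_EFinP.
  by apply: filterS UM => w UM _; rewrite lee_fin.
by rewrite integral_cst // ltey_eq fin_numM // fin_num_measure.
Qed.

Definition payoff B rho tau := (\int[P]_(w in B) (U rho tau w)%:E)%E.

Lemma payoff_fin B rho tau : measurable B -> st rho -> st tau ->
  payoff B rho tau \is a fin_num.
Proof.
move=> mB hrho htau; apply: integrable_fin_num => //.
by apply: integrableS (U_integrable hrho htau).
Qed.

Lemma payoff_local_ae B rho1 tau1 rho2 tau2 : measurable B ->
  st rho1 -> st tau1 -> st rho2 -> st tau2 ->
  (\forall w \ae P, B w -> rho1 w = rho2 w /\ tau1 w = tau2 w) ->
  payoff B rho1 tau1 = payoff B rho2 tau2.
Proof.
move=> mB h1 h2 h3 h4 H; apply: ae_eq_integral => //.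
- by apply: measurable_funTS; exact/measurable_EFinP/U_measurable.
- by apply: measurable_funTS; exact/measurable_EFinP/U_measurable.
- apply: (filterS2 _ _ H (biadmissible_local hU h1 h3 h2 h4)) => w e loc /e[e1 e2].
  by rewrite loc.
Qed.

Lemma payoff_local B rho1 tau1 rho2 tau2 : measurable B ->
  st rho1 -> st tau1 -> st rho2 -> st tau2 ->
  (forall w, B w -> rho1 w = rho2 w) -> (forall w, B w -> tau1 w = tau2 w) ->
  payoff B rho1 tau1 = payoff B rho2 tau2.
Proof.
move=> mB h1 h2 h3 h4 e1 e2; apply: payoff_local_ae => //.
by apply: aeW => w Bw; split; [exact: e1|exact: e2].
Qed.

Lemma payoff_split B A rho tau : measurable B -> measurable A -> st rho -> st tau ->
  payoff B rho tau = (payoff (B `&` A) rho tau + payoff (B `\` A) rho tau)%E.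
Proof.
move=> mB mA hrho htau; rewrite /payoff -integral_setU.
- by rewrite setUIDK.
- exact: measurableI.
- exact: measurableD.
- by apply: measurable_funTS; exact/measurable_EFinP/U_measurable.
- by rewrite disj_set2E setDE setIACA setICr setI0 eqxx.
Qed.

Definition decreases (s_ : nat -> Omega -> R) (s : Omega -> R) :=
  (forall n w, s_ n.+1 w <= s_ n w) /\ (forall w, s_ n w @[n --> \oo] --> s w).

Lemma decreases_ae s_ s : decreases s_ s -> decreases_to P s_ s.
Proof. by move=> [d1 d2]; split => [n|]; exact: aeW. Qed.

Lemma decreases_squeeze s_ s (e : nat -> Omega -> R) :
  (forall n w, s_ n.+1 w <= s_ n w) -> (forall n w, s w <= s_ n w <= s w + e n w) ->
  (forall w, e n w @[n --> \oo] --> 0) -> decreases s_ s.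
Proof.
move=> sd se e0; split => // w.
apply: (@squeeze_cvgr _ _ _ _ (cst (s w)) (fun n => s w + e n w)).
- by apply: nearW => n; exact: se.
- exact: cvg_cst.
- by rewrite -[X in _ --> X]addr0; apply: cvgD; [exact: cvg_cst|exact: e0].
Qed.

Lemma decreases_ge s_ s n w : decreases s_ s -> s w <= s_ n w.
Proof.
move=> [d1 d2].
have ni : nonincreasing_seq (s_ ^~ w) by apply/nonincreasing_seqP => k; exact: d1.
have c : cvgn (s_ ^~ w) by apply/cvg_ex; exists (s w); exact: d2.
by have := nonincreasing_cvgn_ge ni c n; rewrite (cvg_lim _ (d2 w)).
Qed.

Lemma decreases_err s_ s w : decreases s_ s -> s_ n w - s w @[n --> \oo] --> 0.
Proof.
move=> [_ d2]; rewrite -(subrr (s w)).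
by apply: cvgB; [exact: d2|exact: cvg_cst].
Qed.

Definition mean_payoff rho tau := fine (payoff [set: Omega] rho tau).

Lemma mean_payoffE rho tau : st rho -> st tau ->
  (mean_payoff rho tau)%:E = payoff [set: Omega] rho tau.
Proof. by move=> h1 h2; rewrite /mean_payoff fineK // payoff_fin. Qed.

Hypothesis hrc : urce P T F U.

Lemma expectation_sub rho tau rho' tau' : st rho -> st tau -> st rho' -> st tau' ->
  ('E_P[U rho tau \- U rho' tau'])%E =
    (mean_payoff rho tau - mean_payoff rho' tau')%:E.
Proof.
move=> h1 h2 h3 h4; rewrite unlock EFinB !mean_payoffE // /payoff -integralB //.
  exact: U_integrable.
exact: U_integrable.
Qed.

Lemma sup_cvg0 (u : nat -> set (\bar R)) (e : R) :
  (ereal_sup (u n) @[n --> \oo] --> 0%E)%E -> 0 < e ->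
  exists N, forall n, (N <= n)%N -> forall x, u n x -> (x < e%:E)%E.
Proof.
move=> c e0; have : \forall n \near \oo, (ereal_sup (u n) < e%:E)%E.
  have : nbhs (0%E : \bar R) [set x | (x < e%:E)%E].
    by apply: open_nbhs_nbhs; split; [exact: open_ereal_lt_ereal|rewrite /= lte_fin].
  exact: c.
move=> [N _ HN]; exists N => n Nn x ux.
by apply: le_lt_trans (HN n Nn); exact: ereal_sup_ubound.
Qed.

Lemma right_continuous_tau tau tau_ e : st tau -> (forall n, st (tau_ n)) ->
  decreases tau_ tau -> 0 < e ->
  exists N, forall n, (N <= n)%N -> forall rho, st rho ->
    `|mean_payoff rho tau - mean_payoff rho (tau_ n)| < e.
Proof.
move=> h1 h2 h3 e0.
have hz := st_cst0.
have dz : decreases (fun=> cst 0) (cst 0) by split => // w; exact: cvg_cst.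
have [c _] := urce_right_continuous hrc hz h1 (fun=> hz) h2 (decreases_ae dz)
  (decreases_ae h3).
have [N HN] := sup_cvg0 c e0; exists N => n Nn rho hrho.
by rewrite -lte_fin; apply: (HN n Nn); exists rho => //; rewrite expectation_sub.
Qed.

Lemma right_continuous_rho rho rho_ e : st rho -> (forall n, st (rho_ n)) ->
  decreases rho_ rho -> 0 < e ->
  exists N, forall n, (N <= n)%N -> forall tau, st tau ->
    `|mean_payoff rho tau - mean_payoff (rho_ n) tau| < e.
Proof.
move=> h1 h2 h3 e0.
have hz := st_cst0.
have dz : decreases (fun=> cst 0) (cst 0) by split => // w; exact: cvg_cst.
have [_ c] := urce_right_continuous hrc h1 hz h2 (fun=> hz) (decreases_ae h3)
  (decreases_ae dz).
have [N HN] := sup_cvg0 c e0; exists N => n Nn tau htau.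
by rewrite -lte_fin; apply: (HN n Nn); exists tau => //; rewrite expectation_sub.
Qed.

Lemma decreases_max r s_ s : decreases s_ s ->
  decreases (fun n => r \max s_ n) (r \max s).
Proof.
move=> ds; apply: (@decreases_squeeze _ _ (fun n w => s_ n w - s w)).
- by move=> n w /=; rewrite ge_max !le_max lexx /= ds.1 orbT.
- move=> n w /=; have sn := decreases_ge n w ds.
  rewrite ge_max !le_max lexx sn /= orbT /=.
  rewrite ge_max; apply/andP; split.
    by rewrite -[leLHS]addr0 lerD ?subr_ge0 // le_max lexx.
  by rewrite -lerBlDr opprB addrCA subrr addr0 le_max lexx orbT.
- by move=> w; exact: decreases_err.
Qed.

(** Both arguments move with k_ n; changing them one after the other uses the
    uniformity of the right continuity in the other argument. *)
Lemma right_continuous_diag r kappa k_ e : st r -> st kappa ->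
  (forall n, st (k_ n)) ->
  decreases k_ kappa -> 0 < e ->
  exists N, forall n, (N <= n)%N ->
    `|mean_payoff (r \max kappa) kappa - mean_payoff (r \max k_ n) (k_ n)| < e.
Proof.
move=> hr hk hk_ dk e0; have e20 : 0 < e / 2 by rewrite divr_gt0.
have [N1 H1] := right_continuous_tau hk hk_ dk e20.
have [N2 H2] := right_continuous_rho (st_max hr hk) (fun n => st_max hr (hk_ n))
  (decreases_max r dk) e20.
exists (maxn N1 N2) => n; rewrite geq_max => /andP[n1 n2].
have := H1 n n1 _ (st_max hr (hk_ n)); have := H2 n n2 _ hk.
set a := mean_payoff _ _; set b := mean_payoff _ kappa;
  set c := mean_payoff _ _ => ab bc.
have -> : a - c = (a - b) + (b - c) by rewrite addrA subrK.
by apply: le_lt_trans (ler_normD _ _) _; rewrite [ltRHS]splitr ltrD.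
Qed.

(** If the bound failed, there would be bad times k n between D and s_ n for every n.
    They need not decrease, but right continuity keeps k n \max s_ m bad for m large, and
    these maxima, along a fast enough subsequence, form a decreasing sequence with
    limit D, along which right continuity gives a contradiction. *)
Lemma uniformly_right_upper r D s_ e : st r -> st D -> (forall n, st (s_ n)) ->
  decreases s_ D ->
  0 < e ->
  exists n, forall kappa, st kappa -> (forall w, D w <= kappa w <= s_ n w) ->
    mean_payoff (r \max kappa) kappa <= mean_payoff (r \max D) D + e.
Proof.
move=> hr hD hs ds e0; apply: contrapT => /forallNP H.
pose f k := mean_payoff (r \max k) k.
have bad n : exists kappa, [/\ st kappa, forall w, D w <= kappa w <= s_ n w &
    f D + e < f kappa].
  have /existsNP[k /not_implyP[hk /not_implyP[Dk /negP]]] := H n.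
  by rewrite -ltNge => ?; exists k.
pose k n := projT1 (cid (bad n)).
have kP n : [/\ st (k n), forall w, D w <= k n w <= s_ n w & f D + e < f (k n)].
  exact: projT2 (cid (bad n)).
have nxt n : exists m, (n < m)%N /\ f D + e < f (k n \max s_ m).
  have [hk Dk fk] := kP n.
  have dk : decreases (fun m => k n \max s_ m) (k n).
    have := decreases_max (k n) ds; congr decreases; apply/funext => w /=.
    by apply/max_idPl; have /andP[] := Dk w.
  have e1 : 0 < f (k n) - (f D + e) by rewrite subr_gt0.
  have [N HN] := right_continuous_diag hr hk (fun m => st_max hk (hs m)) dk e1.
  exists (maxn N n.+1); split; first by rewrite leq_max leqnn orbT.
  have := HN _ (leq_maxl N n.+1); rewrite ltr_norml => /andP[_].
  rewrite ltrBrDr -ltrBrDl opprB addrCA subrr addr0.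
  exact.
pose nx n := projT1 (cid (nxt n)).
have nxP n : (n < nx n)%N /\ f D + e < f (k n \max s_ (nx n)).
  exact: projT2 (cid (nxt n)).
pose ns i := iter i nx 0%N.
have nsi i : (i <= ns i)%N.
  by elim: i => // i IH; apply: leq_ltn_trans IH (nxP _).1.
have sd w : nonincreasing_seq (s_ ^~ w) by apply/nonincreasing_seqP => n; exact: ds.1.
have hkD n w : D w <= k n w by have [_ /(_ w)/andP[]] := kP n.
have hks n w : k n w <= s_ n w by have [_ /(_ w)/andP[]] := kP n.
(* kh i lies between s_ (ns i.+1) and s_ (ns i), so kh decreases. *)
pose kh i := k (ns i) \max s_ (ns i.+1).
have skh i : st (kh i) by apply: st_max => //; have [] := kP (ns i).
have khs i w : kh i w <= s_ (ns i) w.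
  rewrite ge_max hks sd //; exact: ltnW (nxP _).1.
have dkh : decreases kh D.
  apply: (@decreases_squeeze _ _ (fun n w => s_ n w - D w)).
  - move=> i w; apply: le_trans (khs i.+1 w) _.
    by rewrite le_max lexx orbT.
  - move=> i w; rewrite /kh le_max hkD /= addrC subrK.
    by apply: le_trans (khs i w) _; exact: sd (nsi i).
  - by move=> w; exact: decreases_err.
have [N /(_ N (leqnn _))] := right_continuous_diag hr hD skh dkh e0.
rewrite ltr_norml => /andP[+ _]; rewrite ltrBrDr addrC ltrBlDr.
by move=> /(lt_trans (nxP (ns N)).2); rewrite ltxx.
Qed.

Local Open Scope ereal_scope.

(** * Conditional values as set functions *)

(** The conditional values at a stopping time, recorded as set functions on the
    sigma-algebra at that time: intV1 and intV2 are the integrals of the Dynkin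
    obstacles V1 and V2. Stopping times after sigma are written r \max sigma with r
    arbitrary. *)
Definition intV1 tau B := ereal_inf [set payoff B (r \max tau)%R tau | r in st].
Definition intV2 rho B := ereal_sup [set payoff B rho (r \max rho)%R | r in st].
(** Integral of the essential supremum of all conditional payoffs after sigma. *)
Definition max_payoff sigma B :=
  ereal_sup [set payoff B (r.1 \max sigma)%R (r.2 \max sigma)%R | r in st `*` st].
Definition reply_payoff rho tau B :=
  ereal_inf [set payoff B (reply rho r tau) tau | r in st].
Definition reply_sup sigma rho B :=
  ereal_sup [set reply_payoff (rho \max sigma)%R (tau \max sigma)%R B | tau in st].
(** Integral of the conditional upper value at sigma of the game in which the
    minimizer commits to a time rho but may revise it, by reply, when the maximizer stops
    first. *)
Definition value sigma B := ereal_inf [set reply_sup sigma rho B | rho in st].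

Lemma image_range (I : Type) (D : set I) (J : Type) (f : I -> J) :
  [set f x | x in D] = range (fun i : {x | D x} => f (sval i)).
Proof.
apply/seteqP; split => [_ [x Dx <-]|_ [[x Dx] _ <-]]; last by exists x.
by exists (exist _ x Dx).
Qed.

Lemma cond_expectationP G X : sigma_algebra [set: Omega] G ->
  G `<=` d.-measurable -> P.-integrable [set: Omega] (EFin \o X) ->
  is_cond_expectation P G X (cond_expectation P G X).
Proof.
move=> sG Gm iX; have [Z ZX] := cond_expectation_exists sG Gm iX.
by rewrite /cond_expectation; apply: xgetPex; exists Z.
Qed.

Lemma ae_real_version (G : set (set Omega)) (V : Omega -> \bar R) :
  sigma_algebra [set: Omega] G -> G `<=` d.-measurable -> sub_measurable G V ->
  P.-integrable [set: Omega] V ->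
  [/\ sub_measurable G (EFin \o (fine \o V)),
    P.-integrable [set: Omega] (EFin \o (fine \o V)),
     \forall w \ae P, (fine (V w))%:E = V w &
     forall B, G B -> \int[P]_(w in B) (fine (V w))%:E = \int[P]_(w in B) V w].
Proof.
move=> sG Gm gV iV; have mV := sub_measurableW sG Gm gV.
have e : \forall w \ae P, (fine (V w))%:E = V w.
  by have := integrable_ae measurableT iV; apply: filterS => w /(_ Logic.I) /fineK.
have mf : measurable_fun [set: Omega] (EFin \o (fine \o V)).
  by apply/measurable_EFinP; exact: measurableT_comp.
split => //.
- by apply/measurable_EFinP; exact: measurableT_comp.
- apply: (le_integrable measurableT mf _ iV) => w _ /=.
  by case: (V w) => //=; rewrite normr0 leey.
- move=> B GB; apply: ae_eq_integral; [exact: Gm|exact: measurable_funTS..|].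
  by apply: filterS e.
Qed.

Lemma integrable_of_lower (V : Omega -> \bar R) (h : Omega -> \bar R) :
  measurable_fun [set: Omega] V -> P.-integrable [set: Omega] h ->
  (\forall w \ae P, h w <= V w) -> \int[P]_w V w < +oo ->
  P.-integrable [set: Omega] V.
Proof.
move=> mV ih hV Vy.
have Vn : \int[P]_w V^\- w < +oo.
  apply: le_lt_trans (integral_funeneg_lt_pinfty measurableT ih).
  apply: ae_le_integral => //; first exact: measurable_funeneg.
    by apply: measurable_funeneg; exact: (measurable_int P ih).
  apply: filterS hV => w hw _; rewrite !funenegE ge_max !le_max leeN2 hw /=.
  by rewrite lexx orbT.
have mNV : measurable_fun [set: Omega] (\- V) by exact: measurableT_comp.
have NVp : \int[P]_w (\- V)^\+ w < +oo by rewrite funeposN.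
have [iN|] := integrableVNy measurableT mNV NVp.
- by have := integrableN iN; apply: eq_integrable => // w _ /=; rewrite oppeK.
- rewrite integralN; last first.
    by rewrite fin_num_adde_defl // fin_numN ge0_fin_numE // integral_ge0.
  by move/eqP; rewrite eqe_oppLR /= => /eqP VNy; rewrite VNy in Vy.
Qed.

(** Conditional payoffs are closed under gluing along events known at sigma, because
    payoffs are local; hence their essential infimum is the density of the infimum of
    the unconditional payoffs. *)
Lemma payoff_inf_density sigma (I : Type) (i0 : I) (a b : I -> Omega -> R) :
  st sigma -> (forall i, st (a i)) -> (forall i, st (b i)) ->
  (forall i j B, Fs sigma B -> exists l,
    (forall w, B w -> a l w = a i w /\ b l w = b i w) /\
    (forall w, ~ B w -> a l w = a j w /\ b l w = b j w)) ->
  let phi i := cond_expectation P (Fs sigma) (U (a i) (b i)) in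
  exists s : nat -> I, let V := fun w =>
    ereal_inf (range (fun n => (phi (s n) w)%:E)) in
  [/\ sub_measurable (Fs sigma) V, (forall i, \forall w \ae P, V w <= (phi i w)%:E),
      \int[P]_w V^\+ w < +oo &
      forall B, Fs sigma B ->
        \int[P]_(w in B) V w = ereal_inf (range (fun i => payoff B (a i) (b i)))].
Proof.
move=> hs ha hb gl phi.
have sG := Fs_sigma_algebra hs; have Gm := Fs_measurable hs.
have cP i : is_cond_expectation P (Fs sigma) (U (a i) (b i)) (phi i).
  by apply: cond_expectationP => //; exact: U_integrable.
have iphi i : P.-integrable [set: Omega] (EFin \o phi i) by have [] := cP i.
have [|//|||s [gV leV _ intV]] := @directed_inf_density _ _ _ P _ sG Gm I i0
    (fun i B => payoff B (a i) (b i)) phi.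
- by move=> i; apply/measurable_EFinP; have [] := cP i.
- by move=> i B FB; have [_ _] := cP i; exact.
- move=> i j B FB; have [l [li lj]] := gl i j B FB; exists l => A FA.
  have mA := Gm _ FA.
  by split => AB; apply: payoff_local => // w /AB;
    [move/li|move/li|move/lj|move/lj] => -[].
exists s; split => //.
apply: le_lt_trans (integral_funepos_lt_pinfty measurableT (iphi (s 0%N))).
apply: ae_le_integral => //.
- by apply: measurable_funepos; exact: (sub_measurableW sG Gm gV).
- by apply: measurable_funepos; exact: (measurable_int P (iphi _)).
- apply: filterS (leV (s 0%N)) => w Vw _.
  by rewrite !funeposE ge_max !le_max Vw lexx orbT.
Qed.

Lemma payoff_sup_density sigma (I : Type) (i0 : I) (a b : I -> Omega -> R) :
  st sigma -> (forall i, st (a i)) -> (forall i, st (b i)) ->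
  (forall i j B, Fs sigma B -> exists l,
    (forall w, B w -> a l w = a i w /\ b l w = b i w) /\
    (forall w, ~ B w -> a l w = a j w /\ b l w = b j w)) ->
  let phi i := cond_expectation P (Fs sigma) (U (a i) (b i)) in
  exists s : nat -> I, let V := fun w =>
    ereal_sup (range (fun n => (phi (s n) w)%:E)) in
  [/\ sub_measurable (Fs sigma) V, (forall i, \forall w \ae P, (phi i w)%:E <= V w),
      P.-integrable [set: Omega] (EFin \o phi (s 0%N)) &
      forall B, Fs sigma B ->
        \int[P]_(w in B) V w = ereal_sup (range (fun i => payoff B (a i) (b i)))].
Proof.
move=> hs ha hb gl phi.
have sG := Fs_sigma_algebra hs; have Gm := Fs_measurable hs.
have cP i : is_cond_expectation P (Fs sigma) (U (a i) (b i)) (phi i).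
  by apply: cond_expectationP => //; exact: U_integrable.
have iphi i : P.-integrable [set: Omega] (EFin \o phi i) by have [] := cP i.
have [|||||s [gV leV _ _ intV]] := @directed_sup_density _ _ _ P _ sG Gm I i0
    (fun i B => payoff B (a i) (b i)) (fun i => EFin \o phi i).
- by move=> i; apply/measurable_EFinP; have [] := cP i.
- by move=> i; exact: integral_funepos_lt_pinfty.
- exact: iphi.
- by move=> i B FB; have [_ _] := cP i; exact.
- move=> i j B FB; have [l [li lj]] := gl i j B FB; exists l => A FA.
  have mA := Gm _ FA.
  by split => AB; apply: payoff_local => // w /AB;
    [move/li|move/li|move/lj|move/lj] => -[].
by exists s; split.
Qed.

(** * The Dynkin obstacles *)

Lemma cond_expectation_ae_eq sigma a b a' b' : st sigma ->
  st a -> st b -> st a' -> st b' ->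
  (\forall w \ae P, a w = a' w /\ b w = b' w) ->
  \forall w \ae P, cond_expectation P (Fs sigma) (U a b) w =
                   cond_expectation P (Fs sigma) (U a' b') w.
Proof.
move=> hs ha hb ha' hb' e.
have sG := Fs_sigma_algebra hs; have Gm := Fs_measurable hs.
have [m1 i1 e1] := cond_expectationP sG Gm (U_integrable ha hb).
have [m2 i2 e2] := cond_expectationP sG Gm (U_integrable ha' hb').
have E B : Fs sigma B -> payoff B a b = payoff B a' b'.
  by move=> FB; apply: payoff_local_ae => //; [exact: Gm|apply: filterS e].
have l1 := sub_measurable_ae_le sG Gm ((measurable_EFinP _ _).2 m1)
  ((measurable_EFinP _ _).2 m2)
  (integral_funepos_lt_pinfty measurableT i1).
have l2 := sub_measurable_ae_le sG Gm ((measurable_EFinP _ _).2 m2)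
  ((measurable_EFinP _ _).2 m1)
  (integral_funepos_lt_pinfty measurableT i2).
have h B : Fs sigma B ->
    \int[P]_(w in B) (cond_expectation P (Fs sigma) (U a b) w)%:E =
    \int[P]_(w in B) (cond_expectation P (Fs sigma) (U a' b') w)%:E.
  by move=> FB; rewrite e1 // e2 //; exact: E.
apply: (filterS2 _ _ (l1 _) (l2 _)) => [w|B FB|B FB].
- by rewrite /= !lee_fin => h1 h2; apply/eqP; rewrite eq_le h1 h2.
- by rewrite [leLHS](h B FB).
- by rewrite [leRHS](h B FB).
Qed.

Lemma glue_max sigma (a a' : Omega -> R) B : st sigma -> st a -> st a' ->
  Fs sigma B -> st (glue B (a \max sigma) (a' \max sigma))%R.
Proof.
move=> hs ha ha' FB; have h := st_max ha hs; have h' := st_max ha' hs.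
by apply: st_glue => //; apply: FsS FB => // w /=; rewrite le_max lexx orbT.
Qed.

(** The obstacle V1 is determined up to null sets by its two defining inequalities, and
    the density of intV1 satisfies both. *)
Lemma V1_density tau : st tau -> exists V, [/\ sub_measurable (Fs tau) V,
  measurable_fun [set: Omega] (V1 P T F U tau),
  \forall w \ae P, V1 P T F U tau w = V w, \int[P]_w V^\+ w < +oo &
  forall B, Fs tau B -> \int[P]_(w in B) V w = intV1 tau B].
Proof.
move=> ht; have sG := Fs_sigma_algebra ht; have Gm := Fs_measurable ht.
pose I := {r | st r}.
pose a (i : I) := (sval i \max tau)%R.
have ha i : st (a i) by apply: st_max => //; exact: (proj2_sig i).
have [|s [gV leV Vp intV]] := @payoff_inf_density tau I
    (exist _ _ st_cst0) a (fun=> tau) ht ha (fun=> ht).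
  move=> i j B FB.
  exists (exist _ _ (glue_max ht (proj2_sig i) (proj2_sig j) FB)); split => w Bw.
    by split => //; rewrite /a /= glue_in //= -maxA maxxx.
  by split => //; rewrite /a /= glue_out //= -maxA maxxx.
set V := fun w => _ in gV leV Vp intV *.
exists V.
have essV : is_family_ess_inf P [set EFin \o cond_expectation P (Fs tau) (U rho' tau)
                 | rho' in stopping_time_ge P T F tau] V.
  split; first exact: (sub_measurableW sG Gm gV).
  - move=> _ [r [hr tr] <-].
    have := leV (exist _ r hr); rewrite /a /=.
    have : \forall w \ae P, cond_expectation P (Fs tau) (U (r \max tau)%R tau) w =
                   cond_expectation P (Fs tau) (U r tau) w.
      apply: cond_expectation_ae_eq => //; first exact: st_max.
      by apply: filterS tr => w tr; split => //=; apply/max_idPl.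
    by apply: filterS2 => w -> .
  - move=> W mW WX; have : forall n, \forall w \ae P,
        W w <= (cond_expectation P (Fs tau) (U (a (s n)) tau) w)%:E.
      move=> n; apply: (WX (EFin \o cond_expectation P (Fs tau) (U (a (s n)) tau))).
      exists (a (s n)) => //; split; first exact: ha.
      by apply: aeW => w; rewrite /a /= le_max lexx orbT.
    move/ae_foralln; apply: filterS => w Wn.
    by apply: le_ereal_inf_tmp => _ [n _ <-]; exact: Wn.
have [mV1 V1l V1g] : is_family_ess_inf P
    [set EFin \o cond_expectation P (Fs tau) (U rho' tau)
      | rho' in stopping_time_ge P T F tau] (V1 P T F U tau).
  by apply: (xgetPex (cst 0)); exists V.
have [mV Vl Vg] := essV.
split => //.
- apply: (filterS2 _ _ (Vg _ mV1 V1l) (V1g _ mV Vl)) => w h1 h2.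
  by apply/eqP; rewrite eq_le h1 h2.
- by move=> B FB; rewrite intV // /intV1 [in RHS]image_range.
Qed.

Lemma V2_density rho C : st rho -> intV2 rho setT <= C%:E ->
  exists V : Omega -> R, [/\ sub_measurable (Fs rho) (EFin \o V),
  measurable_fun [set: Omega] (V2 P T F U rho),
  \forall w \ae P, V2 P T F U rho w = (V w)%:E,
    P.-integrable [set: Omega] (EFin \o V) &
  forall B, Fs rho B -> \int[P]_(w in B) (V w)%:E = intV2 rho B].
Proof.
move=> ht YC; have sG := Fs_sigma_algebra ht; have Gm := Fs_measurable ht.
pose I := {r | st r}.
pose a (i : I) := (sval i \max rho)%R.
have ha i : st (a i) by apply: st_max => //; exact: (proj2_sig i).
have [|s [gV leV i0 intV]] := @payoff_sup_density rho I
    (exist _ _ st_cst0) (fun=> rho) a ht (fun=> ht) ha.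
  move=> i j B FB.
  exists (exist _ _ (glue_max ht (proj2_sig i) (proj2_sig j) FB)); split => w Bw.
    by split => //; rewrite /a /= glue_in //= -maxA maxxx.
  by split => //; rewrite /a /= glue_out //= -maxA maxxx.
set V := fun w => _ in gV leV intV *.
have mV := sub_measurableW sG Gm gV.
have essV : is_family_ess_sup P [set EFin \o cond_expectation P (Fs rho) (U rho tau')
                 | tau' in stopping_time_ge P T F rho] V.
  split; first exact: mV.
  - move=> _ [r [hr tr] <-].
    have := leV (exist _ r hr); rewrite /a /=.
    have : \forall w \ae P, cond_expectation P (Fs rho) (U rho (r \max rho)%R) w =
                   cond_expectation P (Fs rho) (U rho r) w.
      apply: cond_expectation_ae_eq => //; first exact: st_max.
      by apply: filterS tr => w tr; split => //=; apply/max_idPl.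
    by apply: filterS2 => w -> .
  - move=> W mW WX; have : forall n, \forall w \ae P,
        (cond_expectation P (Fs rho) (U rho (a (s n))) w)%:E <= W w.
      move=> n; apply: (WX (EFin \o cond_expectation P (Fs rho) (U rho (a (s n))))).
      exists (a (s n)) => //; split; first exact: ha.
      by apply: aeW => w; rewrite /a /= le_max lexx orbT.
    move/ae_foralln; apply: filterS => w Wn.
    by apply: ge_ereal_sup => _ [n _ <-]; exact: Wn.
have [mV2 V2l V2g] : is_family_ess_sup P
    [set EFin \o cond_expectation P (Fs rho) (U rho tau')
      | tau' in stopping_time_ge P T F rho] (V2 P T F U rho).
  by apply: (xgetPex (cst 0)); exists V.
have [_ Vl Vg] := essV.
have VEY B : Fs rho B -> \int[P]_(w in B) V w = intV2 rho B.
  by move=> FB; rewrite intV // /intV2 [in RHS]image_range.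
have iV : P.-integrable [set: Omega] V.
  apply: (integrable_of_lower mV i0).
    by apply: aeW => w; apply: ereal_sup_ubound; exists 0%N.
  rewrite VEY; [exact: le_lt_trans YC (ltry _)|exact: FsT].
have [gf iF fV fE] := ae_real_version sG Gm gV iV.
exists (fine \o V); split => //.
- apply: filterS (filterI (filterI (Vg _ mV2 V2l) (V2g _ mV Vl)) fV) =>
  w [[h1 h2] /= ->].
  by apply/eqP; rewrite eq_le h1 h2.
- by move=> B FB; rewrite -VEY // -fE.
Qed.

(** * Locality and densities of the set functions *)

Lemma intV1_local A tau tau' : measurable A -> st tau -> st tau' ->
  (forall w, A w -> tau w = tau' w) -> intV1 tau A = intV1 tau' A.
Proof.
move=> mA h h' e; congr ereal_inf; apply: eq_imagel => r hr.
apply: payoff_local => //; [exact: st_max..|].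
by move=> w Aw /=; rewrite e.
Qed.

Lemma max_payoff_local A tau tau' : measurable A -> st tau -> st tau' ->
  (forall w, A w -> tau w = tau' w) -> max_payoff tau A = max_payoff tau' A.
Proof.
move=> mA h h' e; congr ereal_sup; apply: eq_imagel => -[r1 r2] [/= h1 h2].
by apply: payoff_local => //; [exact: st_max..| |];
  move=> w Aw /=; rewrite e.
Qed.

Lemma reply_payoff_local A rho rho' tau tau' : measurable A -> st rho -> st rho' ->
  st tau -> st tau' ->
  (forall w, A w -> rho w = rho' w) -> (forall w, A w -> tau w = tau' w) ->
  reply_payoff rho tau A = reply_payoff rho' tau' A.
Proof.
move=> mA h1 h2 h3 h4 e1 e2; congr ereal_inf; apply: eq_imagel => r hr.
apply: payoff_local => //; [exact: st_reply..|].
move=> w Aw; rewrite /reply /glue /= e1 // e2 //.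
Qed.

Lemma value_local A tau tau' : measurable A -> st tau -> st tau' ->
  (forall w, A w -> tau w = tau' w) -> value tau A = value tau' A.
Proof.
move=> mA h h' e; congr ereal_inf; apply: eq_imagel => r hr.
congr ereal_sup; apply: eq_imagel => t ht.
by apply: reply_payoff_local => //; [exact: st_max..| |]; move=> w Aw /=; rewrite e.
Qed.

Lemma reply_payoff_density sigma rho tau : st sigma -> st rho -> st tau ->
  (forall w, sigma w <= rho w)%R -> (forall w, sigma w <= tau w)%R ->
  exists V, [/\ sub_measurable (Fs sigma) V, \int[P]_w V^\+ w < +oo &
  forall B, Fs sigma B -> \int[P]_(w in B) V w = reply_payoff rho tau B].
Proof.
move=> hs hr ht sr stau; have Fst : Fs sigma `<=` Fs tau by exact: FsS.
pose I := {r | st r}.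
pose a (i : I) := reply rho (sval i) tau.
have ha i : st (a i) by apply: st_reply => //; exact: (proj2_sig i).
have [|s [gV leV Vp intV]] := @payoff_inf_density sigma I
    (exist _ _ st_cst0) a (fun=> tau) hs ha (fun=> ht).
  move=> i j B FB.
  exists (exist _ _ (glue_max ht (proj2_sig i) (proj2_sig j) (Fst _ FB)));
    split => w Bw.
    split => //; rewrite /a /=; case: (ltP (tau w) (rho w)) => tr.
      by rewrite !reply_lt // glue_in //= -maxA maxxx.
    by rewrite !reply_ge.
  split => //; rewrite /a /=; case: (ltP (tau w) (rho w)) => tr.
    by rewrite !reply_lt // glue_out //= -maxA maxxx.
  by rewrite !reply_ge.
by eexists; split; [exact: gV|exact: Vp|move=> B FB;
  rewrite intV // /reply_payoff [in RHS]image_range].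
Qed.

Variable C : R.
Hypothesis hC : forall rho tau, st rho -> st tau -> payoff setT rho tau <= C%:E.

Lemma reply_payoff_diag rho B : reply_payoff rho rho B = payoff B rho rho.
Proof.
rewrite /reply_payoff (_ : [set _ | _ in _] = [set payoff B rho rho]) ?ereal_inf1 //.
have e r : reply rho r rho = rho.
  apply/funext => w; by rewrite reply_ge.
apply/seteqP; split => [_ [r _ <-]|_ ->]; first by rewrite e.
by exists (cst 0)%R; [exact: st_cst0|rewrite e].
Qed.

Lemma reply_payoff_leC rho tau : st rho -> st tau ->
  reply_payoff rho tau setT <= C%:E.
Proof.
move=> h1 h2; apply: ge_ereal_inf.
exists (payoff setT (reply rho rho tau) tau); first by exists rho.
by apply: hC => //; exact: st_reply.
Qed.

(** Unlike V1 this density is integrable: the maximizer may stop together with the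
    minimizer, which gives an integrable minorant, and the payoffs have a common upper
    bound in expectation. *)
Lemma reply_sup_density sigma rho : st sigma -> st rho -> exists y : Omega -> R,
  [/\ sub_measurable (Fs sigma) (EFin \o y), P.-integrable [set: Omega] (EFin \o y) &
  forall B, Fs sigma B -> \int[P]_(w in B) (y w)%:E = reply_sup sigma rho B].
Proof.
move=> hs hr; have sG := Fs_sigma_algebra hs; have Gm := Fs_measurable hs.
pose I := {r | st r}.
have hi (i : I) : st (sval i) by exact: (proj2_sig i).
pose rs := (rho \max sigma)%R; have hrs : st rs by exact: st_max.
pose m (i : I) B := reply_payoff rs (sval i \max sigma)%R B.
have rep (i : I) : exists V, [/\ sub_measurable (Fs sigma) V, \int[P]_w V^\+ w < +oo &
    forall B, Fs sigma B -> \int[P]_(w in B) V w = m i B].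
  apply: reply_payoff_density => //; first by apply: st_max.
    by move=> w /=; rewrite le_max lexx orbT.
  by move=> w /=; rewrite le_max lexx orbT.
pose phi i := projT1 (cid (rep i)).
have phiP i : [/\ sub_measurable (Fs sigma) (phi i), \int[P]_w (phi i)^\+ w < +oo &
    forall B, Fs sigma B -> \int[P]_(w in B) phi i w = m i B].
  exact: projT2 (cid (rep i)).
pose i0 : I := exist _ rho hr.
have FT : Fs sigma setT by exact: FsT.
have i0int : P.-integrable [set: Omega] (phi i0).
  have [g0 p0 e0] := phiP i0.
  have [//|e] := integrableVNy measurableT (sub_measurableW sG Gm g0) p0.
  have := e0 _ FT; rewrite e /m /= reply_payoff_diag => eNy.
  by have := payoff_fin measurableT hrs hrs; rewrite -eNy.
have [|||||s [gV leV _ _ intV]] := @directed_sup_density _ _ _ P _ sG Gm I i0 m phi.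
- by move=> i; have [] := phiP i.
- by move=> i; have [] := phiP i.
- by [].
- by move=> i B FB; have [_ _] := phiP i; exact.
- move=> i j B FB.
  exists (exist _ _ (glue_max hs (hi i) (hi j) FB)) => A FA; have mA := Gm _ FA.
  split => AB; apply: reply_payoff_local => //; rewrite ?/m /=.
  + by apply: st_max => //; apply: glue_max.
  + by apply: st_max.
  + by move=> w /AB Bw /=; rewrite glue_in //= -maxA maxxx.
  + by apply: st_max => //; apply: glue_max.
  + by apply: st_max.
  + by move=> w /AB Bw /=; rewrite glue_out //= -maxA maxxx.
set V := fun w => _ in gV leV intV *.
have mV := sub_measurableW sG Gm gV.
have VES B : Fs sigma B -> \int[P]_(w in B) V w = reply_sup sigma rho B.
  by move=> FB; rewrite intV // /reply_sup [in RHS]image_range.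
have iV : P.-integrable [set: Omega] V.
  apply: (integrable_of_lower mV i0int (leV i0)).
  rewrite VES //; apply: (@le_lt_trans _ _ C%:E); last exact: ltry.
  apply: ge_ereal_sup => _ [t ht <-]; apply: reply_payoff_leC => //; exact: st_max.
have [gf iF fV fE] := ae_real_version sG Gm gV iV.
exists (fine \o V); split => // B FB.
by rewrite -VES // -fE.
Qed.

(** The density is exhibited as the infimum of a decreasing sequence of integrable
    functions, each coming from an actual plan s n of the minimizer; this yields near
    optimal plans. *)
Lemma value_density sigma : st sigma ->
  exists (s : nat -> Omega -> R) (y : nat -> Omega -> R),
  let V := fun w => ereal_inf (range (fun n => (y n w)%:E)) in
  [/\ sub_measurable (Fs sigma) V,
      forall n, st (s n) /\ [/\ sub_measurable (Fs sigma) (EFin \o y n),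
         P.-integrable [set: Omega] (EFin \o y n) &
         forall B, Fs sigma B ->
           \int[P]_(w in B) (y n w)%:E = reply_sup sigma (s n) B],
      forall n, \forall w \ae P, (y n.+1 w <= y n w)%R &
      forall B, Fs sigma B -> \int[P]_(w in B) V w = value sigma B].
Proof.
move=> hs; have sG := Fs_sigma_algebra hs; have Gm := Fs_measurable hs.
pose I := {r | st r}.
have hi (i : I) : st (sval i) by exact: (proj2_sig i).
pose phi (i : I) := projT1 (cid (reply_sup_density hs (hi i))).
have phiP i : [/\ sub_measurable (Fs sigma) (EFin \o phi i),
     P.-integrable [set: Omega] (EFin \o phi i) &
    forall B, Fs sigma B ->
      \int[P]_(w in B) (phi i w)%:E = reply_sup sigma (sval i) B].
  exact: projT2 (cid (reply_sup_density hs (hi i))).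
have [||||s [gV _ snd VEq]] := @directed_inf_density _ _ _ P _ sG Gm I
  (exist _ _ st_cst0)
  (fun i => reply_sup sigma (sval i)) phi.
- by move=> i; have [] := phiP i.
- by move=> i; have [] := phiP i.
- by move=> i B FB; have [_ _] := phiP i; exact.
- move=> i j B FB.
  exists (exist _ _ (glue_max hs (hi i) (hi j) FB)) => A FA; have mA := Gm _ FA.
  split => AB; congr ereal_sup; apply: eq_imagel => t ht.
    apply: reply_payoff_local; rewrite //=; try by apply: st_max => //;
      apply: glue_max.
    by move=> w /AB Bw /=; rewrite glue_in //= -maxA maxxx.
  apply: reply_payoff_local; rewrite //=; try by apply: st_max => //; apply: glue_max.
  by move=> w /AB Bw /=; rewrite glue_out //= -maxA maxxx.
exists (fun n => sval (s n)), (fun n => phi (s n)); split => //.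
by move=> B FB; rewrite VEq //; congr ereal_inf; exact: (esym (image_range _ _)).
Qed.

Lemma max_payoff_density sigma : st sigma -> exists y : Omega -> R,
  [/\ sub_measurable (Fs sigma) (EFin \o y), P.-integrable [set: Omega] (EFin \o y) &
  forall B, Fs sigma B -> \int[P]_(w in B) (y w)%:E = max_payoff sigma B].
Proof.
move=> hs; have sG := Fs_sigma_algebra hs; have Gm := Fs_measurable hs.
pose I := {r | (st `*` st) r}.
have hi1 (i : I) : st (sval i).1 by case: i => -[? ?] [].
have hi2 (i : I) : st (sval i).2 by case: i => -[? ?] [].
pose a (i : I) := ((sval i).1 \max sigma)%R.
pose b (i : I) := ((sval i).2 \max sigma)%R.
have h0 := st_cst0.
pose i0 : I := exist (st `*` st) (cst 0%R, cst 0%R) (conj h0 h0).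
have [|||s [gV leV int0 intV]] := @payoff_sup_density sigma I i0 a b hs.
- by move=> i; exact: st_max.
- by move=> i; exact: st_max.
- move=> i j B FB.
  pose gl := (glue B (a i) (a j), glue B (b i) (b j)).
  have hgl : (st `*` st) gl by split => /=; apply: glue_max.
  exists (exist _ gl hgl); split => w Bw.
    by rewrite /a /b /= !glue_in //= /a /b /= -!maxA !maxxx.
  by rewrite /a /b /= !glue_out //= /a /b /= -!maxA !maxxx.
set V := fun w => _ in gV leV intV *.
have mV := sub_measurableW sG Gm gV.
have VEG B : Fs sigma B -> \int[P]_(w in B) V w = max_payoff sigma B.
  by move=> FB; rewrite intV // /max_payoff [in RHS]image_range.
have iV : P.-integrable [set: Omega] V.
  apply: (integrable_of_lower mV int0).
    by apply: aeW => w; apply: ereal_sup_ubound; exists 0%N.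
  rewrite VEG; last exact: FsT.
  apply: (@le_lt_trans _ _ C%:E); last exact: ltry.
  by apply: ge_ereal_sup => _ [[r1 r2] [/= h1 h2] <-]; apply: hC; exact: st_max.
have [gf iF fV fE] := ae_real_version sG Gm gV iV.
exists (fine \o V); split => // B FB.
by rewrite -VEG // -fE.
Qed.

(** * Dynamic programming *)

Lemma density_split sigma (m : set Omega -> \bar R) (V : Omega -> \bar R) B A :
  st sigma -> sub_measurable (Fs sigma) V ->
  (forall B, Fs sigma B -> \int[P]_(w in B) V w = m B) ->
  Fs sigma B -> Fs sigma A -> m B = m (B `&` A) + m (B `\` A).
Proof.
move=> hs gV intV FB FA.
have FI : Fs sigma (B `&` A) by exact: FsI.
have FD : Fs sigma (B `\` A) by exact: FsD.
rewrite -!intV // -integral_setU; first by rewrite setUIDK.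
- exact: Fs_measurable FI.
- exact: Fs_measurable FD.
- by apply: measurable_funTS;
  exact: (sub_measurableW (Fs_sigma_algebra hs) (Fs_measurable hs) gV).
- by rewrite disj_set2E setDE setIACA setICr setI0 eqxx.
Qed.

Lemma intV1_split tau B A : st tau -> Fs tau B -> Fs tau A ->
  intV1 tau B = intV1 tau (B `&` A) + intV1 tau (B `\` A).
Proof.
by move=> ht; have [V [gV _ _ _ intV]] := V1_density ht; exact: density_split gV intV.
Qed.

Lemma reply_payoff_split sigma rho tau B A : st sigma -> st rho -> st tau ->
  (forall w, sigma w <= rho w)%R -> (forall w, sigma w <= tau w)%R ->
  Fs sigma B -> Fs sigma A ->
  reply_payoff rho tau B =
    reply_payoff rho tau (B `&` A) + reply_payoff rho tau (B `\` A).
Proof.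
move=> hs hr ht sr st_; have [V [gV _ intV]] := reply_payoff_density hs hr ht sr st_.
exact: density_split gV intV.
Qed.

Lemma value_split sigma B A : st sigma -> Fs sigma B -> Fs sigma A ->
  value sigma B = value sigma (B `&` A) + value sigma (B `\` A).
Proof.
by move=> ht; have [s [y [gV _ _ intV]]] := value_density ht;
  exact: density_split gV intV.
Qed.

Lemma max_absorb (r s : Omega -> R) : (forall w, s w <= r w)%R -> (r \max s)%R = r.
Proof. by move=> sr; apply/funext => w /=; apply/max_idPl. Qed.

Lemma reply_gel (rho r tau : Omega -> R) w :
  (tau w <= rho w)%R -> (tau w <= reply rho r tau w)%R.
Proof.
move=> tr; have [tr'|tr'] := ltP (tau w) (rho w); last by rewrite reply_ge.
by rewrite reply_lt // le_max lexx orbT.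
Qed.

(** A maximizer who stops at once leaves the minimizer with a reply. *)
Lemma intV1_le_value tau B : st tau -> intV1 tau B <= value tau B.
Proof.
move=> ht; apply: le_ereal_inf_tmp => _ [rho hrho <-].
apply: le_ereal_sup_tmp; exists (reply_payoff (rho \max tau)%R (tau \max tau)%R B).
  by exists tau.
apply: le_ereal_inf_tmp => _ [r hr <-]; rewrite (max_absorb (r := tau) (s := tau)) //.
apply: ereal_inf_lbound; exists (reply (rho \max tau)%R r tau).
  by apply: st_reply => //; exact: st_max.
by congr payoff; apply: max_absorb => w; apply: reply_gel;
  rewrite /= le_max lexx orbT.
Qed.

(** A minimizer who stops at once is never pre-empted. *)
Lemma reply_sup_self sigma B : st sigma -> reply_sup sigma sigma B <= intV2 sigma B.
Proof.
move=> hs; apply: ge_ereal_sup => _ [t ht <-].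
apply: ge_ereal_inf; exists (payoff B
  (reply (sigma \max sigma)%R sigma (t \max sigma)%R) (t \max sigma)%R).
  by exists sigma.
apply: ereal_sup_ubound; exists t => //; congr payoff.
apply/funext => w; rewrite reply_ge /=; first by rewrite maxxx.
by rewrite maxxx le_max lexx orbT.
Qed.

Lemma value_le_intV2 sigma B : st sigma -> value sigma B <= intV2 sigma B.
Proof.
move=> hs; apply: ge_ereal_inf; exists (reply_sup sigma sigma B);
  first by exists sigma.
exact: reply_sup_self.
Qed.

Lemma value_le_max sigma B : st sigma -> value sigma B <= max_payoff sigma B.
Proof.
move=> hs; apply: le_trans (value_le_intV2 B hs) _.
apply: ge_ereal_sup => _ [r hr <-]; apply: ereal_sup_ubound.
by exists (sigma, r) => //=; rewrite (max_absorb (r := sigma) (s := sigma)).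
Qed.

Lemma max_payoff_antitone sigma sigma' B : st sigma -> st sigma' ->
  (forall w, sigma w <= sigma' w)%R -> max_payoff sigma' B <= max_payoff sigma B.
Proof.
move=> hs hs' ss; apply: ge_ereal_sup => _ [[r1 r2] [/= h1 h2] <-].
apply: ereal_sup_ubound; exists (r1 \max sigma', r2 \max sigma')%R => /=.
  by split => /=; exact: st_max.
by congr payoff; apply: max_absorb => w /=; rewrite le_max ss orbT.
Qed.

(** Along the decreasing densities y n of value_density, the positive part of
    y n - z tends to 0 in mean by dominated convergence. *)
Lemma near_optimal theta (z : Omega -> R) e : st theta ->
  sub_measurable (Fs theta) (EFin \o z) -> P.-integrable [set: Omega] (EFin \o z) ->
  (forall A, Fs theta A -> value theta A <= \int[P]_(w in A) (z w)%:E) ->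
  (0 < e)%R ->
  exists2 rho, st rho & forall A, Fs theta A ->
    reply_sup theta rho A <= \int[P]_(w in A) (z w)%:E + e%:E.
Proof.
move=> ht gz iz Vz e0; have sG := Fs_sigma_algebra ht; have Gm := Fs_measurable ht.
have [s [y [gV ysP ynd yV]]] := value_density ht.
set V := fun w => _ in gV yV.
have iy n : P.-integrable [set: Omega] (EFin \o y n) by have [_ []] := ysP n.
have mV := sub_measurableW sG Gm gV.
have Vp : \int[P]_w V^\+ w < +oo.
  apply: le_lt_trans (integral_funepos_lt_pinfty measurableT (iy 0%N)).
  apply: ge0_le_integral => //; first exact: measurable_funepos.
    by apply: measurable_funepos; exact: (measurable_int P (iy _)).
  move=> w _; rewrite !funeposE ge_max !le_max lexx orbT andbT; apply/orP; left.
  by apply: ereal_inf_lbound; exists 0%N.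
have Vlez : \forall w \ae P, V w <= (z w)%:E.
  by apply: (sub_measurable_ae_le sG Gm gV gz Vp) => B FB; rewrite yV // Vz.
pose h n w := Num.max (y n w - z w)%R 0%R.
have mz : measurable_fun [set: Omega] z.
  by apply/measurable_EFinP; exact: (measurable_int P iz).
have my n : measurable_fun [set: Omega] (y n).
  by apply/measurable_EFinP; exact: (measurable_int P (iy n)).
have mh n : measurable_fun [set: Omega] (h n).
  by apply: measurable_maxr => //; exact: measurable_funB.
have h0 n w : (0 <= h n w)%R by rewrite le_max lexx orbT.
have ih n : P.-integrable [set: Omega] (EFin \o h n).
  have := integrable_abse (integrableB measurableT (iy n) iz).
  apply: le_integrable => //; first exact/measurable_EFinP.
  move=> w _ /=; rewrite lee_fin ger0_norm // normr_id ge_max normr_ge0 andbT.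
  exact: ler_norm.
have hnd : \forall w \ae P, forall n, (y n.+1 w <= y n w)%R by exact: ae_foralln.
have hcvg : \forall w \ae P, [set: Omega] w -> (h n w)%:E @[n --> \oo] --> 0.
  apply: (filterS2 _ _ Vlez hnd) => w Vw nd _.
  have ndw : nonincreasing_seq (y ^~ w) by apply/nonincreasing_seqP.
  apply/fine_cvgP; split; first exact: nearW.
  apply/cvgrPdist_le => /= r r0.
  have : V w < (z w + r)%:E by apply: le_lt_trans Vw _; rewrite lte_fin ltrDl.
  move=> /ereal_inf_lt[_ [n _ <-]]; rewrite lte_fin => yn.
  exists n => // k /= nk; rewrite sub0r normrN ger0_norm // ge_max (ltW r0) andbT.
  by rewrite lerBlDl; apply: le_trans (ltW yn); exact: ndw.
have hdom : \forall w \ae P, forall n, [set: Omega] w ->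
  `|(h n w)%:E| <= (h 0%N w)%:E.
  apply: filterS hnd => w nd n _.
  have ndw : nonincreasing_seq (y ^~ w) by apply/nonincreasing_seqP.
  rewrite abse_EFin lee_fin ger0_norm // ge_max !le_max lexx orbT andbT.
  by rewrite lerB // ndw.
have [_ _] := dominated_convergence measurableT
  (fun n => (measurable_EFinP _ _).2 (mh n)) (measurable_cst 0) hcvg (ih 0%N) hdom.
rewrite integral0 => c.
have : \forall n \near \oo, \int[P]_w (h n w)%:E < e%:E.
  have : nbhs (0 : \bar R) [set x | x < e%:E].
    by apply: open_nbhs_nbhs; split; [exact: open_ereal_lt_ereal|rewrite /= lte_fin].
  exact: c.
move=> [n _ /(_ n (leqnn n)) hn].
have [hsn [_ _ yE]] := ysP n.
exists (s n) => // A FA; have mA := Gm _ FA.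
rewrite -yE //; apply: (@le_trans _ _ (\int[P]_(w in A) ((h n w)%:E + (z w)%:E))).
  apply: ae_le_integral => //.
  - by apply: measurable_funTS; exact/measurable_EFinP.
  - by apply: emeasurable_funD; apply: measurable_funTS; exact/measurable_EFinP.
  - by apply: aeW => w _; rewrite -EFinD lee_fin -lerBlDr le_max lexx.
rewrite ge0_integralDl //.
- rewrite addeC leeD2l //; apply: le_trans (ltW hn).
  by apply: ge0_subset_integral => //;
    [exact/measurable_EFinP|move=> w _; rewrite lee_fin].
- by apply: measurable_funTS; exact/measurable_EFinP.
- by move=> w _; rewrite lee_fin.
- exact: integrableS iz.
Qed.

(** The minimizer waits until theta and then follows a near optimal plan. A maximizer
    who stops before theta gets the obstacle V1 at that moment; one who does not enters
    the game restarted at theta, worth at most z. *)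
Lemma dynamic_programming tau theta (z : Omega -> R) B (c : \bar R) :
  st tau -> st theta -> (forall w, tau w <= theta w)%R -> Fs tau B ->
  sub_measurable (Fs theta) (EFin \o z) -> P.-integrable [set: Omega] (EFin \o z) ->
  (forall A, Fs theta A -> value theta A <= \int[P]_(w in A) (z w)%:E) ->
  (forall kappa, st kappa -> (forall w, tau w <= kappa w <= theta w)%R ->
    intV1 kappa (B `&` [set w | kappa w < theta w]%R) +
    \int[P]_(w in B `\` [set w | kappa w < theta w]%R) (z w)%:E <= c) ->
  value tau B <= c.
Proof.
move=> ht hth tth FB gz iz Vz Hc; apply/lee_addgt0Pr => e e0.
have [rho hrho Hrho] := near_optimal hth gz iz Vz e0.
pose rho' := (rho \max theta)%R.
have hrho' : st rho' by exact: st_max.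
have rt w : (tau w <= rho' w)%R.
  by apply: le_trans (tth w) _; rewrite /= le_max lexx orbT.
apply: ge_ereal_inf; exists (reply_sup tau rho' B); first by exists rho'.
apply: ge_ereal_sup => _ [t0 ht0 <-].
rewrite (max_absorb rt); set t := (t0 \max tau)%R.
have htt : st t by exact: st_max.
have taut w : (tau w <= t w)%R by rewrite /= le_max lexx orbT.
pose kappa := (t \min theta)%R.
have hk : st kappa by exact: st_min.
have kt w : (kappa w <= t w)%R by rewrite /= ge_min lexx.
have kth w : (kappa w <= theta w)%R by rewrite /= ge_min lexx orbT.
have tk w : (tau w <= kappa w)%R by rewrite /= le_min taut tth.
have krho w : (kappa w <= rho' w)%R.
  by apply: le_trans (kth w) _; rewrite /= le_max lexx orbT.
pose A := [set w | (kappa w < theta w)%R].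
have FkA : Fs kappa A by exact: Fs_lt.
have FkB : Fs kappa B by apply: FsS FB.
have FkI : Fs kappa (B `&` A) by exact: FsI.
have FkD : Fs kappa (B `\` A) by exact: FsD.
have FtD : Fs theta (B `\` A) by apply: FsS FkD.
have mI := Fs_measurable hk FkI; have mD := Fs_measurable hk FkD.
rewrite (reply_payoff_split hk hrho' htt krho kt FkB FkA).
have := Hc _ hk (fun w => introT andP (conj (tk w) (kth w))).
rewrite -/A => Hk.
have -> : reply_payoff rho' t (B `&` A) = intV1 kappa (B `&` A).
  congr ereal_inf; apply: eq_imagel => r hr.
  apply: payoff_local => //; [exact: st_reply|exact: st_max| |] => w [_ Aw].
    have tw : (t w < theta w)%R by move: Aw; rewrite /A /= gt_min ltxx orbF.
    rewrite reply_lt /=; first by rewrite /kappa /= (min_l (ltW tw)).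
    by apply: lt_le_trans tw _; rewrite /= le_max lexx orbT.
  have tw : (t w < theta w)%R by move: Aw; rewrite /A /= gt_min ltxx orbF.
  by rewrite /kappa /= (min_l (ltW tw)).
have : reply_payoff rho' t (B `\` A) <= reply_sup theta rho (B `\` A).
  apply: ereal_sup_ubound; exists t => //; apply: reply_payoff_local => //;
    first exact: st_max.
  move=> w [_ Aw] /=; apply/max_idPl.
  by move/negP: Aw; rewrite /A /= gt_min ltxx orbF -leNgt.
move=> /le_trans /(_ (Hrho _ FtD)) H.
apply: (@le_trans _ _ (intV1 kappa (B `&` A) +
  (\int[P]_(w in B `\` A) (z w)%:E + e%:E))).
  exact: leeD2l.
by rewrite addeA; apply: leeD2r.
Qed.

(** * The stopping region *)

Section stopping_region.

Variable M : R.
Hypothesis M0 : (0 <= M)%R.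
Hypothesis hM : \forall w \ae P, (`|U (cst T) (cst T) w| <= M)%R.

(** The obstacle V1 may be -oo and the values have no common integrable bound, so the
    tolerance at a stopping time cannot be constant. Its density is 1 + M plus the
    essential supremum of all later payoffs: this dominates both 1 (the terminal
    payoff is at least -M) and the value, its integral is bounded, and like a
    supermartingale it decreases in sigma. *)
Definition slack sigma B := max_payoff sigma B + (M + 1)%:E * P B.

Lemma slack_density sigma : st sigma -> exists y : Omega -> R,
  [/\ sub_measurable (Fs sigma) (EFin \o y), P.-integrable [set: Omega] (EFin \o y) &
  forall B, Fs sigma B -> \int[P]_(w in B) (y w)%:E = slack sigma B].
Proof.
move=> hs; have [y [gy iy yE]] := max_payoff_density hs.
have ic B : measurable B -> P.-integrable B (EFin \o cst (M + 1)%R).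
  by move=> mB; exact: finite_measure_integrable_cst.
exists (fun w => y w + (M + 1))%R; split.
- by apply/measurable_EFinP; apply: measurable_funD => //; exact/measurable_EFinP.
- by have := integrableD measurableT iy (ic _ measurableT); apply: eq_integrable.
- move=> B FB; have mB := Fs_measurable hs FB.
  under eq_integral do rewrite EFinD.
  rewrite integralD //; [|exact: integrableS iy|exact: ic].
  by rewrite yE // integral_cst.
Qed.

Lemma slack_fin sigma B : st sigma -> Fs sigma B -> slack sigma B \is a fin_num.
Proof.
move=> hs FB; have [y [_ iy yE]] := slack_density hs; have mB := Fs_measurable hs FB.
by rewrite -yE //; apply: integrable_fin_num => //; exact: integrableS iy.
Qed.

Lemma slack_split sigma B A : st sigma -> Fs sigma B -> Fs sigma A ->
  slack sigma B = slack sigma (B `&` A) + slack sigma (B `\` A).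
Proof.
move=> hs FB FA; have [y [gy _ yE]] := slack_density hs.
exact: (@density_split sigma (slack sigma) (EFin \o y) B A hs gy yE FB FA).
Qed.

Lemma slack_ge sigma B : st sigma -> Fs sigma B -> P B <= slack sigma B.
Proof.
move=> hs FB; have mB := Fs_measurable hs FB.
have hTT : st (cst T) by exact: st_cstT.
have : - M%:E * P B <= max_payoff sigma B.
  apply: (@le_trans _ _ (payoff B (cst T) (cst T))).
    rewrite -EFinN -integral_cst //; apply: ae_le_integral => //.
      by apply: measurable_funTS; exact/measurable_EFinP/(U_measurable).
    by apply: filterS hM => w; rewrite ler_norml => /andP[h _] _; rewrite lee_fin.
  apply: ereal_sup_ubound; exists (cst T, cst T) => //=.
  have -> : (cst T \max sigma)%R = cst T; last by [].
  by apply: max_absorb => w; exact: (st_leT w hs).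
move=> h; rewrite /slack; apply: le_trans (leeD2r _ h).
rewrite -EFinN -muleDl ?fin_num_measure ?fin_num_adde_defl //.
by rewrite -EFinD addrA addNr add0r mul1e.
Qed.

Lemma slack_ge0 sigma B : st sigma -> Fs sigma B -> 0 <= slack sigma B.
Proof. by move=> hs FB; exact: le_trans (slack_ge hs FB). Qed.

Lemma slack_sub sigma A B : st sigma -> Fs sigma A -> Fs sigma B -> A `<=` B ->
  slack sigma A <= slack sigma B.
Proof.
move=> hs FA FB AB; rewrite (slack_split hs FB FA) setIidr //.
by rewrite leeDl // slack_ge0 //; exact: FsD.
Qed.

Lemma value_le_slack sigma B : st sigma -> value sigma B <= slack sigma B.
Proof.
move=> hs; apply: le_trans (value_le_max B hs) _; rewrite /slack leeDl //.
by rewrite mule_ge0 // lee_fin addr_ge0.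
Qed.

Lemma slack_antitone sigma sigma' B : st sigma -> st sigma' ->
  (forall w, sigma w <= sigma' w)%R -> slack sigma' B <= slack sigma B.
Proof. by move=> hs hs' ss; apply: leeD2r; exact: max_payoff_antitone. Qed.

Lemma slack_leC sigma B : st sigma -> Fs sigma B -> slack sigma B <= (C + M + 1)%:E.
Proof.
move=> hs FB; have h := slack_sub hs FB (FsT hs) (@subsetT _ B).
apply: le_trans h _; rewrite /slack.
rewrite -addrA (EFinD C); apply: leeD.
  by apply: ge_ereal_sup => _ [[r1 r2] [/= h1 h2] <-]; apply: hC; exact: st_max.
rewrite -[leRHS]mule1; apply: lee_wpmul2l; first by rewrite lee_fin addr_ge0.
exact: probability_le1.
Qed.

Lemma slack_local A tau tau' : measurable A -> st tau -> st tau' ->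
  (forall w, A w -> tau w = tau' w) -> slack tau A = slack tau' A.
Proof. by move=> mA h h' e; rewrite /slack (max_payoff_local mA h h' e). Qed.

Variable e : R.
Hypothesis e0 : (0 < e)%R.

(** Tested on all events known at sigma, the inequality says that almost surely
    v(sigma) <= V1(sigma) + e g(sigma), with g the density of slack. *)
Definition stop_region (sigma : Omega -> R) := st sigma /\
  forall B, Fs sigma B -> value sigma B <= intV1 sigma B + e%:E * slack sigma B.

Lemma scaled_slack_ge0 sigma B : st sigma -> Fs sigma B -> 0 <= e%:E * slack sigma B.
Proof. by move=> hs FB; rewrite mule_ge0 ?slack_ge0 // lee_fin ltW. Qed.

Lemma scaled_slack_fin sigma B : st sigma -> Fs sigma B ->
  e%:E * slack sigma B \is a fin_num.
Proof. by move=> hs FB; rewrite fin_numM // slack_fin. Qed.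

Lemma stop_region_T : stop_region (cst T).
Proof.
have hTT : st (cst T) by exact: st_cstT.
have aT r : st r -> (r \max cst T)%R = cst T.
  by move=> h; apply/funext => w /=; apply/max_idPr; exact: (st_leT w h).
split=> // B FB; apply: (@le_trans _ _ (intV1 (cst T) B));
  last by rewrite leeDl // scaled_slack_ge0.
apply: le_trans (value_le_intV2 B hTT) _.
apply: ge_ereal_sup => _ [r hr' <-]; apply: le_ereal_inf_tmp => _ [s hs <-].
by rewrite !aT.
Qed.

Lemma stop_region_glue sigma s1 s2 A : st sigma -> st s1 -> st s2 -> Fs sigma A ->
  (forall w, A w -> sigma w = s1 w) -> (forall w, ~ A w -> sigma w = s2 w) ->
  (forall B, Fs s1 B -> B `<=` A -> value s1 B <= intV1 s1 B + e%:E * slack s1 B) ->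
  (forall B, Fs s2 B -> B `<=` ~` A ->
    value s2 B <= intV1 s2 B + e%:E * slack s2 B) ->
  stop_region sigma.
Proof.
move=> hs h1 h2 FA e1 e2 H1 H2; split => // B FB.
have FI : Fs sigma (B `&` A) by exact: FsI.
have FD : Fs sigma (B `\` A) by exact: FsD.
have mI := Fs_measurable hs FI; have mD := Fs_measurable hs FD.
have F1 : Fs s1 (B `&` A) by apply: (Fs_sub hs) => // w [_ /e1 /= ->].
have F2 : Fs s2 (B `\` A) by apply: (Fs_sub hs) => // w [_ /e2 /= ->].
rewrite (value_split hs FB FA) (intV1_split hs FB FA) (slack_split hs FB FA).
have sI w : (B `&` A) w -> sigma w = s1 w by case=> _ /e1.
have sD w : (B `\` A) w -> sigma w = s2 w by case=> _ /e2.
rewrite (value_local mI hs h1 sI) (value_local mD hs h2 sD).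
rewrite (intV1_local mI hs h1 sI) (intV1_local mD hs h2 sD).
rewrite (slack_local mI hs h1 sI) (slack_local mD hs h2 sD).
rewrite muleDr ?fin_num_adde_defl ?slack_fin // addeACA.
by apply: leeD; [apply: H1|apply: H2] => // w [].
Qed.

Lemma stop_region_min s1 s2 : stop_region s1 -> stop_region s2 ->
  stop_region (s1 \min s2)%R.
Proof.
move=> [h1 H1] [h2 H2]; have hm := st_min h1 h2.
apply: (@stop_region_glue _ s1 s2 [set w | s1 w <= s2 w]%R) => //.
- apply: (Fs_sub h1) => //; first exact: Fs_le.
  by move=> w /= s12; rewrite le_min lexx.
- by move=> w /= s12; apply/min_idPl.
- by move=> w /negP; rewrite -ltNge => /ltW s21; apply/min_idPr.
- by move=> B FB _; exact: H1.
- by move=> B FB _; exact: H2.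
Qed.

Lemma uniformly_right_upper_on r D s_ B eta : st r -> st D -> (forall n, st (s_ n)) ->
  decreases s_ D -> Fs D B -> (0 < eta)%R ->
  exists n, forall kappa, st kappa -> (forall w, D w <= kappa w <= s_ n w)%R ->
    payoff B (r \max kappa)%R kappa <= payoff B (r \max D)%R D + eta%:E.
Proof.
move=> hr' hD hs ds FB eta0; have mB := Fs_measurable hD FB.
have [n Hn] := uniformly_right_upper hr' hD hs ds eta0.
exists n => kappa hk Dk.
have FkB : Fs kappa B by apply: (FsS hD hk) FB => w; have /andP[] := Dk w.
pose k := glue B kappa D.
have hkk : st k by exact: st_glue.
have Dkk w : (D w <= k w <= s_ n w)%R.
  rewrite /k /glue; case: ifP => // _; rewrite lexx /=.
  by have /andP[h1 h2] := Dk w; exact: le_trans h2.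
have := Hn _ hkk Dkk; rewrite -lee_fin EFinD !mean_payoffE //; try exact: st_max.
have mT : d.-measurable [set: Omega] := measurableT.
have hmk := st_max hr' hkk; have hmD := st_max hr' hD.
rewrite (payoff_split mT mB hmk hkk) (payoff_split mT mB hmD hD) setTI setTD.
have mCB : d.-measurable (~` B) by exact: measurableC.
rewrite (payoff_local (rho2 := (r \max kappa)%R) (tau2 := kappa) mB) //; first last.
- by move=> w Bw; rewrite /k glue_in.
- by move=> w Bw; rewrite /k /= glue_in.
- exact: st_max.
rewrite (payoff_local (rho2 := (r \max D)%R) (tau2 := D) mCB) //; first last.
- by move=> w Bw; rewrite /k glue_out.
- by move=> w Bw; rewrite /k /= glue_out.
by rewrite addeAC leeD2rE // payoff_fin.
Qed.

(** For each reply r, dynamic programming from D to s_ n with the conditional payoff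
    of r at s_ n plus the tolerance bounds the value at D by the payoffs of r at times
    between D and s_ n. By right continuity, uniform over such times, these are close to
    the payoff of r at D; the infimum over r is the obstacle. *)
Lemma stop_region_closed s_ D : (forall n, stop_region (s_ n)) -> st D ->
  decreases s_ D ->
  stop_region D.
Proof.
move=> Hs hD ds; split => // B FB.
have hs n : st (s_ n) by case: (Hs n).
have Ds n w : (D w <= s_ n w)%R by exact: decreases_ge.
rewrite -leeBlDr ?scaled_slack_fin //; apply: le_ereal_inf_tmp => _ [r hr' <-].
rewrite leeBlDr ?scaled_slack_fin //; apply/lee_addgt0Pr => eta eta0.
have [n Hn] := uniformly_right_upper_on hr' hD hs ds FB eta0.
have hsn := hs n; have sG := Fs_sigma_algebra hsn; have Gm := Fs_measurable hsn.
have hm := st_max hr' hsn.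
have [mZ iZ ZE] := cond_expectationP sG Gm (U_integrable hm hsn).
have [y [gy iy yE]] := slack_density hsn.
set Z := cond_expectation _ _ _ in mZ iZ ZE.
pose z w := (Z w + e * y w)%R.
have iey : P.-integrable [set: Omega] (EFin \o (fun w => e * y w)%R).
  by have := integrableZl measurableT e iy; apply: eq_integrable.
have zE A : Fs (s_ n) A -> \int[P]_(w in A) (z w)%:E =
    payoff A (r \max s_ n)%R (s_ n) + e%:E * slack (s_ n) A.
  move=> FA; have mA := Gm _ FA.
  under eq_integral do rewrite EFinD.
  rewrite integralD //; [|exact: integrableS iZ|exact: integrableS iey].
  rewrite ZE // -yE // -integralZl //; exact: integrableS iy.
apply: (dynamic_programming hD hsn (Ds n) FB (z := z)).
- apply/measurable_EFinP; apply: measurable_funD => //.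
  by apply: measurable_funM => //; exact/measurable_EFinP.
- by have := integrableD measurableT iZ iey; apply: eq_integrable.
- move=> A FA; rewrite zE //; apply: le_trans ((Hs n).2 _ FA) _.
  by apply: leeD2r; apply: ereal_inf_lbound; exists r.
move=> kappa hk Dk; set A := [set w | _].
have Dk1 w : (D w <= kappa w)%R by have /andP[] := Dk w.
have ks w : (kappa w <= s_ n w)%R by have /andP[] := Dk w.
have FkA : Fs kappa A by exact: Fs_lt.
have FkB : Fs kappa B by apply: FsS FB.
have FkD : Fs kappa (B `\` A) by exact: FsD.
have FsD' : Fs (s_ n) (B `\` A) by apply: FsS FkD.
have mD := Fs_measurable hk FkD.
have hmk := st_max hr' hk.
rewrite zE //.
have -> : payoff (B `\` A) (r \max s_ n)%R (s_ n) =
    payoff (B `\` A) (r \max kappa)%R kappa.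
  have e2 w : (B `\` A) w -> s_ n w = kappa w.
    move=> [_ /negP]; rewrite /A /= -leNgt => sk.
    by apply/eqP; rewrite eq_le sk ks.
  by apply: payoff_local => // w /e2 /= ->.
rewrite addeA; apply: (@le_trans _ _
  (payoff B (r \max kappa)%R kappa + e%:E * slack D B)).
  apply: leeD.
    rewrite [leRHS](payoff_split (Fs_measurable hk FkB)
      (Fs_measurable hk FkA) hmk hk).
    by apply: leeD2r; apply: ereal_inf_lbound; exists r.
  rewrite lee_pmul2l // ?lte_fin //.
  apply: le_trans (slack_antitone _ hk hsn ks) _.
  apply: le_trans (slack_antitone _ hD hk Dk1).
  by apply: slack_sub => // w [].
rewrite [leRHS]addeAC; apply: leeD2r; exact: Hn.
Qed.

(** * The minimal stopping time *)

Lemma st_measurable s : st s -> measurable_fun [set: Omega] s.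
Proof.
move=> hs; have hTT : (0 <= T <= T)%R by rewrite lexx ltW.
have := measurable_min_st hs hTT.
have -> : (fun w => Num.min (s w) T) = s.
  by apply/funext => w; apply/min_idPl; exact: (st_leT w hs).
move=> m _ B mB; have := m measurableT B mB.
rewrite (sub_sigma_algebraE (filt_sigma_algebra hTT)).
by apply: (filtration_measurable hF hTT).
Qed.

Lemma st_integrable s : st s -> P.-integrable [set: Omega] (EFin \o s).
Proof.
move=> hs; apply: (@le_integrable _ _ _ _ _ measurableT _ (EFin \o cst T)).
- by apply/measurable_EFinP; exact: st_measurable.
- move=> w _ /=; rewrite lee_fin ger0_norm ?(st_ge0 w hs) //.
  by rewrite ger0_norm ?(st_leT w hs) // ltW.
- exact: finite_measure_integrable_cst.
Qed.

(** The region is stable under minimum and under decreasing limits, so a sequence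
    minimizing the expectation can be taken decreasing, and its limit is in the region. *)
Lemma minimal_stop : exists D, stop_region D /\
  forall sigma, stop_region sigma -> (forall w, sigma w <= D w)%R ->
    P [set w | sigma w < D w]%R = 0.
Proof.
pose E (s : Omega -> R) := \int[P]_w (s w)%:E.
pose m := ereal_inf [set E s | s in stop_region].
have E0 s : st s -> 0 <= E s.
  by move=> hs; apply: integral_ge0 => w _; rewrite lee_fin (st_ge0 w hs).
have Efin s : st s -> E s \is a fin_num.
  by move=> hs; apply: integrable_fin_num => //; exact: st_integrable.
have ST : stop_region (cst T) by exact: stop_region_T.
have m0 : 0 <= m by apply: le_ereal_inf_tmp => _ [s [hs _] <-]; exact: E0.
have mT : m <= E (cst T) by apply: ereal_inf_lbound; exists (cst T).
have mfin : m \is a fin_num.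
  rewrite ge0_fin_numE //; apply: le_lt_trans mT _.
  by have := Efin _ ST.1; rewrite fin_numElt => /andP[].
have near n : exists s, stop_region s /\ E s < m + (n.+1%:R^-1)%:E.
  have n0 : (0 < n.+1%:R^-1 :> R)%R by rewrite invr_gt0.
  by have [_ [s hs <-] h] := lb_ereal_inf_adherent n0 mfin; exists s.
pose s n := projT1 (cid (near n)).
have sP n : stop_region (s n) /\ E (s n) < m + (n.+1%:R^-1)%:E.
  exact: projT2 (cid (near n)).
pose r := fix r n := if n is n'.+1 then (r n' \min s n)%R else s 0%N.
have rS n : stop_region (r n).
  elim: n => [|n IH]; first exact: (sP 0%N).1.
  exact: (stop_region_min IH (sP n.+1).1).
have rs n w : (r n w <= s n w)%R by case: n => [|n] //=; rewrite ge_min lexx orbT.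
have rd n w : (r n.+1 w <= r n w)%R by rewrite /= ge_min lexx.
have rst n : st (r n) by case: (rS n).
pose D w := inf (range (r ^~ w)).
have hD : st D by exact: st_inf.
have lb w : has_lbound (range (r ^~ w)).
  by exists 0%R => _ [n _ <-]; exact: (st_ge0 w (rst n)).
have Dr n w : (D w <= r n w)%R by apply: ge_inf => //; exists n.
have dD : decreases r D.
  split => // w; apply: nonincreasing_cvgn => //.
  by apply/nonincreasing_seqP => n; exact: rd.
have DS : stop_region D by exact: (stop_region_closed rS hD dD).
have EDm : E D <= m.
  apply/lee_addgt0Pr => eta eta0.
  have [n ne] := exists_natSinv_lt eta0.
  apply: (@le_trans _ _ (E (s n))).
    apply: le_integral => //; [exact: st_integrable|exact: st_integrable (sP n).1.1|].
    by move=> w _; rewrite lee_fin; apply: le_trans (Dr n w) (rs n w).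
  by apply: le_trans (ltW (sP n).2) _; rewrite leeD2l // lee_fin ltW.
exists D; split => // sigma hsig sD.
have hs : st sigma by case: hsig.
have : \int[P]_w ((D w)%:E - (sigma w)%:E) = 0.
  apply/eqP; rewrite eq_le; apply/andP; split.
    rewrite integralB //; [|exact: st_integrable..].
    rewrite sube_le0; apply: le_trans EDm _.
    by apply: ereal_inf_lbound; exists sigma.
  by apply: integral_ge0 => w _; rewrite -EFinB lee_fin subr_ge0.
rewrite (eq_integral (fun w => `|(D w - sigma w)%:E|)); last first.
  by move=> w _; rewrite -EFinB gee0_abs // lee_fin subr_ge0.
have mDs : measurable_fun [set: Omega] (fun w => (D w - sigma w)%:E).
  by apply/measurable_EFinP; apply: measurable_funB; exact: st_measurable.
move/(ae_eq_integral_abs P measurableT mDs) => [N [mN N0 sN]].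
have mS : d.-measurable [set w | (sigma w < D w)%R].
  exact: Fs_measurable hs _ (Fs_lt hs hD).
apply: (subset_measure0 mS mN _ N0) => w /= sDw; apply: sN => /= /(_ Logic.I) /eqP.
by rewrite eqe subr_eq0 => /eqP Dw; rewrite Dw ltxx in sDw.
Qed.

(** If the value were below the obstacle plus tolerance on a non-null part N of A,
    stopping at tau on N and at D elsewhere would still be in the region, against the
    minimality of D. *)
Lemma before_minimal D tau A : stop_region D ->
  (forall sigma, stop_region sigma -> (forall w, sigma w <= D w)%R ->
    P [set w | sigma w < D w]%R = 0) ->
  st tau -> Fs tau A -> A `<=` [set w | tau w < D w]%R ->
  intV1 tau A + e%:E * slack tau A <= value tau A.
Proof.
move=> SD Dmin ht FA AD; have hD : st D by case: SD.
have sG := Fs_sigma_algebra ht; have Gm := Fs_measurable ht.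
have [X [gX _ _ Xp intX]] := V1_density ht.
have [s [y [gV _ _ intV]]] := value_density ht.
set V := fun w => _ in gV intV.
have [g [gg ig intg]] := slack_density ht.
have ieg : P.-integrable [set: Omega] (EFin \o (fun w => e * g w)%R).
  by have := integrableZl measurableT e ig; apply: eq_integrable.
pose Z w := X w + (e * g w)%:E.
have gZ : sub_measurable (Fs tau) Z.
  apply: emeasurable_funD => //; apply/measurable_EFinP.
  by apply: measurable_funM => //; exact/measurable_EFinP.
have ZE B : Fs tau B -> \int[P]_(w in B) Z w = intV1 tau B + e%:E * slack tau B.
  move=> FB; have mB := Gm _ FB.
  rewrite upper_integralD //.
  - by rewrite intX // -intg // -integralZl //; exact: integrableS ig.
  - by apply: measurable_funTS; exact: (sub_measurableW sG Gm gX).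
  - apply: upper_integrableS Xp => //; exact: (sub_measurableW sG Gm gX).
  - exact: integrableS ieg.
have mV := sub_measurableW sG Gm gV; have mZ := sub_measurableW sG Gm gZ.
pose N := A `&` [set w | V w < Z w].
have FN : Fs tau N by apply: FsI => //; exact: sub_measurable_lt.
have ND : N `<=` [set w | (tau w < D w)%R] by move=> w [/AD].
have FDN : Fs D N by apply: (Fs_sub ht hD FN) => w /ND /= /ltW.
pose D' := glue N tau D.
have hD' : st D' by exact: st_glue.
have SD' : stop_region D'.
  apply: (stop_region_glue hD' ht hD (A := N)).
  - apply: (Fs_sub ht) => // w Nw /=; by rewrite /D' glue_in.
  - by move=> w Nw; rewrite /D' glue_in.
  - by move=> w Nw; rewrite /D' glue_out.
  - move=> B FB BN; rewrite -intV // -ZE //; have mB := Gm _ FB.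
    apply: ae_le_integral => //; [exact: measurable_funTS..|].
    by apply: aeW => w /BN[_ /ltW].
  - by move=> B FB _; exact: SD.2.
have D'D w : (D' w <= D w)%R.
  by rewrite /D' /glue; case: asboolP => // /ND /= /ltW.
have N0 : P N = 0.
  have mN := Gm _ FN.
  have mD' : d.-measurable [set w | (D' w < D w)%R].
    exact: Fs_measurable hD' _ (Fs_lt hD' hD).
  apply: (subset_measure0 mN mD' _ (Dmin _ SD' D'D)) => w Nw /=.
  by rewrite /D' glue_in //; exact: ND.
rewrite -ZE // -intV //; have mA := Gm _ FA.
apply: ae_le_integral => //; [exact: measurable_funTS..|].
have negN : P.-negligible N by apply/negligibleP => //; exact: Gm.
apply: negligibleS negN => w /= /not_implyP[Aw /negP].
by rewrite -ltNge.
Qed.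

(** * The saddle point inequality *)

Variable D : Omega -> R.
Hypothesis SD : stop_region D.
Hypothesis Dmin : forall sigma, stop_region sigma -> (forall w, sigma w <= D w)%R ->
    P [set w | sigma w < D w]%R = 0.

Let hD : st D. Proof. by case: SD. Qed.

(** Arithmetic of value_le_integral, with v0 the initial value, x, v, g and p the
    integrals over the event A of the obstacle, the value, the slack density and 1, and
    za, zc the integrals of z over A and its complement. The inequalities force
    e * g to be at most the optimization error, so that v and N * p, both controlled by g,
    are small. *)
Lemma real_estimate (v0 s x v g zc za p eta N : R) : (0 <= N)%R -> (0 < eta)%R ->
  (v0 <= s)%R -> (0 <= p <= g)%R -> (x + e * g <= v)%R -> (v + zc <= s)%R ->
  (v <= g)%R -> (- N * p <= za)%R ->
  (s - eta / (1 + (1 + N) / e) < x + zc)%R -> (v0 <= za + zc + eta)%R.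
Proof.
move=> N0 eta0 v0s /andP[p0 pg] xv vs vg Nza sx.
set k := (1 + (1 + N) / e)%R in sx; set dl := (eta / k)%R in sx.
have N1 : (0 < 1 + N)%R by lra.
have k0 : (0 < k)%R by rewrite /k addr_gt0 // divr_gt0.
have egd : (e * g <= dl)%R by lra.
have gd : (g <= dl / e)%R by rewrite ler_pdivlMr // mulrC.
have Ng : ((1 + N) * g <= (1 + N) * (dl / e))%R by apply: ler_wpM2l; lra.
have Np : (N * p <= N * g)%R by exact: ler_wpM2l.
have -> : eta = (dl + (1 + N) * (dl / e))%R.
  have : eta = (dl * k)%R by rewrite /dl divfK // gt_eqF.
  by move=> etaE; rewrite [LHS]etaE /k mulrDr mulr1 mulrCA.
have eg0 : (0 <= e * g)%R by apply: mulr_ge0; [exact: ltW|exact: le_trans p0 pg].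
have : ((1 + N) * g = g + N * g)%R by rewrite mulrDl mul1r.
lra.
Qed.

Lemma ereal_estimate (v0 s x v g zc za p : \bar R) (eta N : R) :
  v0 \is a fin_num -> s \is a fin_num -> x \is a fin_num -> v \is a fin_num ->
  g \is a fin_num -> zc \is a fin_num -> za \is a fin_num -> p \is a fin_num ->
  (0 <= N)%R -> (0 < eta)%R ->
  v0 <= s -> 0 <= p -> p <= g -> x + e%:E * g <= v -> v + zc <= s ->
  v <= g -> (- N)%:E * p <= za ->
  s - (eta / (1 + (1 + N) / e))%:E < x + zc -> v0 <= za + zc + eta%:E.
Proof.
case: v0 => // v0 _; case: s => // s _; case: x => // x _; case: v => // v _.
case: g => // g _; case: zc => // zc _; case: za => // za _; case: p => // p _.
move=> N0 eta0.
rewrite -!EFinM -!EFinN -!EFinD !lee_fin !lte_fin => v0s p0 pg xv vs vg Nza sx.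
by apply: (real_estimate N0 eta0 v0s _ xv vs vg Nza sx); rewrite p0.
Qed.

(** Let tau be nearly optimal in the dynamic programming bound for the initial value,
    and A the event that tau stops before theta. On A the obstacle is smaller than the
    value by e times the slack, so stopping on A wastes that amount, compared with
    dynamic programming restarted at tau. Near optimality thus makes A small, measured by
    the slack, and little is lost in replacing the payoff on A by z. *)
Lemma value_le_integral theta (z : Omega -> R) (N : R) : st theta -> (0 <= N)%R ->
  (forall w, theta w <= D w)%R ->
  sub_measurable (Fs theta) (EFin \o z) -> P.-integrable [set: Omega] (EFin \o z) ->
  (forall A, Fs theta A -> value theta A <= \int[P]_(w in A) (z w)%:E) ->
  (forall w, - N <= z w)%R -> value (cst 0%R) setT != -oo ->
  value (cst 0%R) setT <= \int[P]_w (z w)%:E.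
Proof.
move=> hth N0 thD gz iz Vz Nz v0y.
have h0 := st_cst0.
pose L (k : Omega -> R) := [set w | (k w < theta w)%R].
have FL k : st k -> Fs k (L k) by move=> hk; exact: Fs_lt.
pose Phi k := intV1 k (L k) + \int[P]_(w in ~` L k) (z w)%:E.
pose K := [set k | st k /\ forall w, (k w <= theta w)%R].
pose s := ereal_sup (Phi @` K).
have v0s : value (cst 0%R) setT <= s.
  apply: (dynamic_programming h0 hth _ (FsT h0) gz iz Vz).
    by move=> w; exact: (st_ge0 w hth).
  move=> k hk k0; rewrite setTI setTD.
  by apply: ereal_sup_ubound; exists k => //; split => // w; have /andP[] := k0 w.
have mz : measurable_fun [set: Omega] (EFin \o z) by exact: (measurable_int P iz).
have sK k : K k -> Phi k <= (C + M + 1)%:E + \int[P]_w `|(z w)%:E|.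
  move=> [hk kth]; have FLk := FL _ hk; apply: leeD.
    apply: le_trans (intV1_le_value _ hk) _.
    by apply: le_trans (value_le_slack _ hk) _; exact: slack_leC.
  have mCL : d.-measurable (~` L k) by apply: measurableC; exact: Fs_measurable FLk.
  apply: (@le_trans _ _ (\int[P]_(w in ~` L k) `|(z w)%:E|)).
    apply: ae_le_integral => //; first exact: measurable_funTS.
      by apply: measurable_funTS; exact: measurableT_comp.
    by apply: aeW => w _; exact: lee_abs.
  by apply: ge0_subset_integral => //; exact: measurableT_comp.
have sy : s < +oo.
  apply: (@le_lt_trans _ _ ((C + M + 1)%:E + \int[P]_w `|(z w)%:E|)).
    by apply: ge_ereal_sup => _ [k Kk <-]; exact: sK.
  by apply: lte_add_pinfty; [exact: ltry|have /integrableP[] := iz].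
have sfin : s \is a fin_num.
  rewrite fin_numElt sy andbT; apply: lt_le_trans v0s; by rewrite ltNye.
have v0fin : value (cst 0%R) setT \is a fin_num.
  by rewrite fin_numElt (le_lt_trans v0s sy) andbT ltNye.
apply/lee_addgt0Pr => eta eta0.
have dl0 : (0 < eta / (1 + (1 + N) / e))%R.
  by rewrite divr_gt0 // addr_gt0 // divr_gt0 //; lra.
(* This error, multiplied by 1 + (1 + N) / e, adds up to eta. *)
have [_ [tau [ht tth] <-] Htau] := ub_ereal_sup_adherent dl0 sfin.
rewrite -/s in Htau.
have FA := FL _ ht; set A := L tau in FA.
have mA := Fs_measurable ht FA.
have mCA : d.-measurable (~` A) by exact: measurableC.
have AD : A `<=` [set w | tau w < D w]%R.
  by move=> w Aw; exact: lt_le_trans Aw (thD w).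
have H2 := before_minimal SD Dmin ht FA AD.
have H4 := value_le_slack A ht.
have H5 := slack_ge ht FA.
have gfin := slack_fin ht FA.
have zcf : \int[P]_(w in ~` A) (z w)%:E \is a fin_num.
  by apply: integrable_fin_num => //; exact: integrableS iz.
have zaf : \int[P]_(w in A) (z w)%:E \is a fin_num.
  by apply: integrable_fin_num => //; exact: integrableS iz.
have zE : \int[P]_w (z w)%:E =
    \int[P]_(w in A) (z w)%:E + \int[P]_(w in ~` A) (z w)%:E.
  by rewrite -integral_setU ?setUv // disj_set2E setICr eqxx.
have H6 : (- N)%:E * P A <= \int[P]_(w in A) (z w)%:E.
  rewrite -integral_cst //; apply: ae_le_integral => //;
    first exact: measurable_funTS.
  by apply: aeW => w _; rewrite lee_fin.
have H3 : value tau A + \int[P]_(w in ~` A) (z w)%:E <= s.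
  rewrite -leeBrDr //.
  apply: (dynamic_programming ht hth tth FA gz iz Vz) => k hk tk.
  have tk1 w : (tau w <= k w)%R by have /andP[] := tk w.
  have LA : L k `<=` A by move=> w; exact: le_lt_trans (tk1 w).
  rewrite leeBrDr // -/(L k) (setIidr LA) -addeA.
  have -> : \int[P]_(w in A `\` L k) (z w)%:E + \int[P]_(w in ~` A) (z w)%:E =
      \int[P]_(w in ~` L k) (z w)%:E.
    have mLk := Fs_measurable hk (FL _ hk).
    have UE : A `\` L k `|` ~` A = ~` L k.
      apply/seteqP; split => w /=; first by move=> [[]//|nA /LA].
      by move=> nL; case: (pselect (A w)) => Aw; [left|right].
    rewrite -UE integral_setU //.
    - exact: measurableD.
    - by apply: measurable_funTS.
    - by rewrite disj_set2E setDE setIAC setICr set0I eqxx.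
  by apply: ereal_sup_ubound; exists k => //; split => // w; have /andP[] := tk w.
have Pfin : P A \is a fin_num by exact: fin_num_measure.
have P0 : 0 <= P A by exact: measure_ge0.
have xny : intV1 tau A \is a fin_num.
  rewrite fin_numElt; apply/andP; split.
    rewrite ltNye; apply/negP => /eqP xE; move: Htau.
    by rewrite /Phi -/A xE addNye ltNge leNye.
  apply: le_lt_trans (intV1_le_value _ ht) _; apply: le_lt_trans H4 _.
  by move: gfin; rewrite fin_numElt => /andP[].
have vfin : value tau A \is a fin_num.
  rewrite fin_numElt; apply/andP; split.
    apply: lt_le_trans (intV1_le_value _ ht).
    by move: xny; rewrite fin_numElt => /andP[].
  by apply: le_lt_trans H4 _; move: gfin; rewrite fin_numElt => /andP[].
rewrite zE; move: Htau; rewrite /Phi -/A => H1.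
exact: (ereal_estimate v0fin sfin xny vfin gfin zcf zaf Pfin N0 eta0 v0s
  P0 H5 H2 H3 H4 H6 H1).
Qed.

(** Up to the minimal time of the region the value does not decrease in mean:
    value_le_integral applies to the value truncated below at -n, and n tends to
    infinity. *)
Lemma value_le_before rho : st rho ->
  value (cst 0%R) setT <= value (rho \min D)%R setT.
Proof.
move=> hrho; set theta := (rho \min D)%R.
have hth : st theta by exact: st_min.
have [->|v0y] := eqVneq (value (cst 0%R) setT) -oo; first exact: leNye.
have sG := Fs_sigma_algebra hth; have Gm := Fs_measurable hth.
have [s_ [y [gV yP _ VEq]]] := value_density hth.
set V := fun w => _ in gV VEq.
have mV := sub_measurableW sG Gm gV.
have iy0 : P.-integrable [set: Omega] (EFin \o y 0%N) by have [_ []] := yP 0%N.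
have Vy w : V w <= (y 0%N w)%:E by apply: ereal_inf_lbound; exists 0%N.
pose z (n : nat) w := fine (maxe (V w) (- n%:R)%:E).
have zE n w : (z n w)%:E = maxe (V w) (- n%:R)%:E.
  rewrite /z fineK // fin_numElt; apply/andP; split.
    by rewrite lt_max ltNyr orbT.
  by rewrite gt_max ltry andbT (le_lt_trans (Vy w)) // ltry.
have gz n : sub_measurable (Fs theta) (EFin \o z n).
  rewrite (_ : EFin \o z n = fun w => maxe (V w) (- n%:R)%:E); last first.
    by apply/funext => w; rewrite -zE.
  by apply: measurable_maxe => //; exact: measurable_cst.
have iz n : P.-integrable [set: Omega] (EFin \o z n).
  have ib : P.-integrable [set: Omega] (EFin \o (fun w => `|y 0%N w| + n%:R)%R).
    have := integrableD measurableT (integrable_abse iy0)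
      (finite_measure_integrable_cst P (n%:R : R) measurableT).
    by apply: eq_integrable.
  apply: le_integrable ib => //; first exact: (sub_measurableW sG Gm (gz n)).
  move=> w _; rewrite /comp lee_fin [leRHS]ger0_norm ?addr_ge0 //.
  rewrite ler_norml; apply/andP; split.
    rewrite -lee_fin zE le_max; apply/orP; right.
    by rewrite lee_fin lerN2 lerDr.
  rewrite -lee_fin zE ge_max; apply/andP; split.
    apply: le_trans (Vy w) _; rewrite lee_fin.
    by apply: le_trans (ler_norm _) _; rewrite lerDl.
  by rewrite lee_fin (@le_trans _ _ 0%R) // ?oppr_le0 // addr_ge0.
have claim n : value (cst 0%R) setT <= \int[P]_w (z n w)%:E.
  apply: (@value_le_integral theta _ (n%:R)) => //.
  - by move=> w; rewrite /theta /= ge_min lexx orbT.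
  - move=> A FA; rewrite -VEq //; have mA := Gm _ FA.
    apply: ae_le_integral => //; first exact: measurable_funTS.
      by apply: measurable_funTS; exact: (sub_measurableW sG Gm (gz n)).
    by apply: aeW => w _; rewrite zE le_max lexx.
  - by move=> w; rewrite -lee_fin zE le_max lexx orbT.
have FT := FsT hth.
rewrite -VEq //.
have -> : \int[P]_w V w = \int[P]_w ereal_inf (range (fun n => (z n w)%:E)).
  apply: eq_integral => w _; apply/eqP; rewrite eq_le; apply/andP; split.
    by apply: le_ereal_inf_tmp => _ [n _ <-]; rewrite zE le_max lexx.
  case E : (V w) => [v| |]; last 2 first.
  - by rewrite leey.
  - rewrite leeNy_eq; apply/eqP/eq_ninfty => r; apply: ge_ereal_inf.
    exists (z (Num.bound `|r|%R) w)%:E; first by eexists.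
    rewrite zE E ge_max leNye /= lee_fin lerNl.
    by apply: ltW; apply: le_lt_trans (ler_norm _) _; rewrite normrN;
      exact: archi_boundP.
  apply: ge_ereal_inf; exists (z (Num.bound `|v|%R) w)%:E; first by eexists.
  rewrite zE E ge_max lexx /= lee_fin lerNl.
  by apply: ltW; apply: le_lt_trans (ler_norm _) _; rewrite normrN;
    exact: archi_boundP.
rewrite nonincreasing_integral_inf //; last first.
  move=> n; apply: aeW => w; rewrite -lee_fin !zE ge_max !le_max lexx /=.
  by rewrite lee_fin lerN2 ler_nat leqnSn orbT.
by apply: le_ereal_inf_tmp => _ [n _ <-]; exact: claim.
Qed.

(** Up to rho \min D the initial value is preserved; if D comes first the value there is
    within the tolerance of V1, and if rho comes first it is at most V2. *)
Lemma saddle_point rho : st rho ->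
  value (cst 0%R) setT <= intV1 D [set w | D w <= rho w]%R +
    intV2 rho [set w | rho w < D w]%R + (e * (C + M + 1))%:E.
Proof.
move=> hrho; apply: le_trans (value_le_before hrho) _.
set theta := (rho \min D)%R; have hth : st theta by exact: st_min.
pose A := [set w | (D w <= rho w)%R].
have FDA : Fs D A by exact: Fs_le.
have thD w : A w -> theta w = D w by move=> Aw; rewrite /theta /=; exact/min_idPr.
have FA : Fs theta A by apply: (Fs_sub hD hth FDA) => w Aw /=; rewrite thD.
have CA : ~` A = [set w | (rho w < D w)%R].
  by apply/seteqP; split => w; rewrite /A /= ltNge => /negP.
rewrite (value_split hth (FsT hth) FA) setTI setTD.
rewrite [leRHS]addeAC; apply: leeD.
  rewrite (value_local (Fs_measurable hth FA) hth hD thD).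
  apply: le_trans (SD.2 _ FDA) _; apply: leeD2l.
  rewrite EFinM; apply: lee_wpmul2l; first by rewrite lee_fin ltW.
  exact: slack_leC.
have mCA := measurableC (Fs_measurable hth FA).
rewrite (value_local mCA hth hrho).
  by rewrite CA; exact: value_le_intV2.
by move=> w; rewrite CA /= => /ltW rD; rewrite /theta /=; exact/min_idPl.
Qed.

End stopping_region.

(** * Strategies against Dynkin payoffs *)

Lemma expectation_payoff rho tau : 'E_P[U rho tau] = payoff setT rho tau.
Proof. by rewrite unlock. Qed.

Lemma le_add_sup (I : Type) (D : set I) (x S : \bar R) (a : I -> \bar R) :
  x < +oo -> (forall i, D i -> x + a i <= S) -> x + ereal_sup [set a i | i in D] <= S.
Proof.
case: x => // [x _ H|_ _]; last by rewrite addNye leNye.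
rewrite addeC -leeBrDr //; apply: ge_ereal_sup => _ [i Di <-].
by rewrite leeBrDr // addeC; exact: H.
Qed.

Lemma ge_add_inf (I : Type) (D : set I) (y S : \bar R) (a : I -> \bar R) :
  y \is a fin_num -> (forall i, D i -> S <= a i + y) ->
  S <= ereal_inf [set a i | i in D] + y.
Proof.
move=> yf H; rewrite -leeBlDr //; apply: le_ereal_inf_tmp => _ [i Di <-].
by rewrite leeBlDr //; exact: H.
Qed.

Lemma payoff_splitT rho tau A : st rho -> st tau -> measurable A ->
  payoff setT rho tau = payoff A rho tau + payoff (~` A) rho tau.
Proof.
by move=> h1 h2 mA; rewrite (payoff_split measurableT mA h1 h2) setTI setTD.
Qed.

Lemma decreases_strict sigma s B : st sigma -> st s -> Fs sigma B ->
  let k n := (s \max sigma \max later sigma n.+1%:R^-1)%R in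
  [/\ forall n, st (k n), forall n, st (glue B (k n) (s \max sigma)%R),
    forall n w, (sigma w <= k n w)%R,
    forall n w, (sigma w < T -> sigma w < k n w)%R &
    decreases (fun n => glue B (k n) (s \max sigma)%R) (s \max sigma)%R].
Proof.
move=> hs hss FB k.
have hm := st_max hss hs.
have n0 n : (0 < n.+1%:R^-1 :> R)%R by rewrite invr_gt0.
have hk n : st (k n).
  by apply: st_max => //; apply: st_later => //; exact: ltW.
have sk n w : (sigma w <= k n w)%R by rewrite /k /= !le_max lexx orbT.
have sm w : (sigma w <= (s \max sigma) w)%R by rewrite /= le_max lexx orbT.
have FBk n : Fs (k n) B by apply: FsS FB => // w; exact: sk.
have FBm : Fs (s \max sigma)%R B by apply: FsS FB.
split => //.
- by move=> n; exact: st_glue.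
- move=> n w sT; rewrite /k /= lt_max; apply/orP; right.
  by rewrite /later lt_min sT andbT ltrDl.
apply: (decreases_squeeze (e := fun n w => (n.+1%:R^-1)%R)).
- move=> n w; rewrite /glue; case: ifP => // _; rewrite /k /=.
  rewrite ge_max; apply/andP; split; first by rewrite le_max lexx.
  rewrite le_max; apply/orP; right.
  rewrite /later le_min !ge_min lexx orbT andbT; apply/orP; left.
  by rewrite lerD2l lef_pV2 ?posrE // ler_nat.
- move=> n w; rewrite /glue; case: ifP => _; last by rewrite lexx lerDl ltW.
  apply/andP; split; first by rewrite /k /= le_max lexx.
  rewrite /k /= ge_max; apply/andP; split; first by rewrite lerDl ltW.
  by rewrite /later ge_min lerD2r le_max lexx orbT.
- move=> w; apply/cvgrPdist_lt => eta eta0.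
  have [n ne] := exists_natSinv_lt eta0.
  exists n => // m /= nm; rewrite sub0r normrN ger0_norm ?invr_ge0 //.
  by apply: le_lt_trans ne; rewrite lef_pV2 ?posrE // ler_nat.
Qed.

(** Right continuity allows a player who wants to act at s after sigma to act strictly
    after sigma (or at T) at small cost. This is needed wherever the opponent's strategy
    is only known to react strictly later. *)
Lemma strict_tau rho sigma s B eta : st rho -> st sigma -> st s -> Fs sigma B ->
  (0 < eta)%R -> exists s', [/\ st s', forall w, (sigma w <= s' w)%R,
    forall w, (sigma w < T -> sigma w < s' w)%R &
    payoff B rho (s \max sigma)%R <= payoff B rho s' + eta%:E].
Proof.
move=> hrho hs hss FB eta0.
have [hk hg sk sT dk] := decreases_strict hs hss FB.
have hm := st_max hss hs.
have [N /(_ N (leqnn N) rho hrho)] := right_continuous_tau hm hg dk eta0.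
set k := (s \max sigma \max later sigma N.+1%:R^-1)%R.
rewrite ltr_norml => /andP[_ H].
have mB := Fs_measurable hs FB; have mCB := measurableC mB.
exists k; split => //; [exact: hk|exact: sk|exact: sT|].
have : payoff setT rho (s \max sigma)%R <=
    payoff setT rho (glue B k (s \max sigma)%R) + eta%:E.
  rewrite -!mean_payoffE //; last exact: (hg N).
  by rewrite -EFinD lee_fin -lerBlDl ltW.
rewrite (payoff_splitT hrho hm mB) (payoff_splitT hrho (hg N) mB).
rewrite (payoff_local (rho2 := rho) (tau2 := k) mB hrho (hg N)) //;
  [|exact: hk|by move=> w Bw; rewrite glue_in].
rewrite (payoff_local (rho2 := rho) (tau2 := (s \max sigma)%R) mCB hrho (hg N)) //;
  last first.
  by move=> w Bw; rewrite glue_out.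
by rewrite [X in _ <= X]addeAC leeD2rE // payoff_fin.
Qed.

Lemma strict_rho tau sigma s B eta : st tau -> st sigma -> st s -> Fs sigma B ->
  (0 < eta)%R -> exists s', [/\ st s', forall w, (sigma w <= s' w)%R,
    forall w, (sigma w < T -> sigma w < s' w)%R &
    payoff B s' tau <= payoff B (s \max sigma)%R tau + eta%:E].
Proof.
move=> htau hs hss FB eta0.
have [hk hg sk sT dk] := decreases_strict hs hss FB.
have hm := st_max hss hs.
have [N /(_ N (leqnn N) tau htau)] := right_continuous_rho hm hg dk eta0.
set k := (s \max sigma \max later sigma N.+1%:R^-1)%R.
rewrite ltr_norml => /andP[H _].
have mB := Fs_measurable hs FB; have mCB := measurableC mB.
exists k; split => //; [exact: hk|exact: sk|exact: sT|].
have : payoff setT (glue B k (s \max sigma)%R) tau <=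
    payoff setT (s \max sigma)%R tau + eta%:E.
  rewrite -!mean_payoffE //; last exact: (hg N).
  by rewrite -EFinD lee_fin -lerBlDl; move: H; rewrite ltrNl opprB => /ltW.
rewrite (payoff_splitT hm htau mB) (payoff_splitT (hg N) htau mB).
rewrite (payoff_local (rho2 := k) (tau2 := tau) mB (hg N) htau) //;
  [|exact: hk|by move=> w Bw; rewrite glue_in].
rewrite (payoff_local (rho2 := (s \max sigma)%R) (tau2 := tau) mCB (hg N) htau) //;
  last first.
  by move=> w Bw; rewrite glue_out.
by rewrite [X in _ <= X]addeAC leeD2rE // payoff_fin.
Qed.

(** Comparison of the response to s with the response to never stopping, r (cst T): the
    opponent observes s only when it occurs, so a response up to that moment is the same
    in both cases. *)
Lemma strategyI_spec r s : strategyI P T F r -> st s ->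
  \forall w \ae P, (r (cst T) w <= s w -> r s w = r (cst T) w)%R /\
    (s w < r (cst T) w -> s w < r s w)%R.
Proof.
move=> [hr H] hs; have hTT := st_cstT.
apply: filterS (H _ _ hs hTT) => w.
rewrite (min_l (st_leT w hs)) => -[[-> le]|];
  first by split => // /(le_lt_trans le); rewrite ltxx.
by rewrite lt_min => /andP[h1 h2]; split => // /(lt_le_trans h2); rewrite ltxx.
Qed.

Lemma strategyII_spec r s : strategyII P T F r -> st s ->
  \forall w \ae P, (r (cst T) w < s w -> r s w = r (cst T) w)%R /\
    (s w <= r (cst T) w -> s w <= r s w)%R.
Proof.
move=> [hr H] hs; have hTT := st_cstT.
apply: filterS (H _ _ hs hTT) => w.
rewrite (min_l (st_leT w hs)) => -[[-> le]|];
  first by split => // /(lt_le_trans le); rewrite ltxx.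
by rewrite le_min => /andP[h1 h2]; split => // /(le_lt_trans h2); rewrite ltxx.
Qed.

Lemma strategyI_sub : strategyI P T F `<=` strategyII P T F.
Proof.
move=> r [hr H]; split => // s1 s2 h1 h2; apply: filterS (H _ _ h1 h2) => w.
move=> [[e le]|lt]; last by right; exact: ltW.
have [lt|eq] := ltP (r s2 w) (Num.min (s1 w) (s2 w)); first by left.
by right; rewrite e le_min eq.
Qed.

Lemma reply_strategyI D f : st D ->
  (forall s, st s -> st (f s) /\ forall w, (s w < T -> s w < f s w)%R) ->
  strategyI P T F (fun s => reply D (f s) s).
Proof.
move=> hD hf; split.
  by move=> s hs; apply: st_reply => //; exact: (hf s hs).1.
move=> s1 s2 h1 h2; apply: aeW => w.
have key s : st s -> (Num.min (s1 w) (s2 w) <= s w)%R ->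
    (Num.min (s1 w) (s2 w) < D w)%R -> (Num.min (s1 w) (s2 w) < reply D (f s) s w)%R.
  move=> hs ms mD; have [sD|Ds] := ltP (s w) (D w); last by rewrite reply_ge.
  rewrite reply_lt // lt_max; apply/orP; left; apply: le_lt_trans ms _.
  by apply: (hf s hs).2; exact: lt_le_trans sD (st_leT w hD).
have [mD|] := ltP (Num.min (s1 w) (s2 w)) (D w).
  by right; rewrite lt_min !key // ge_min lexx ?orbT.
by rewrite le_min => /andP[D1 D2]; left; rewrite !reply_ge // le_min D1 D2.
Qed.

(** The Dynkin payoffs for the two conventions at a tie: on rho = tau the first one
    gives V1 and the second V2. *)
Definition dynkin_ties1 rho tau :=
  intV1 tau [set w | tau w <= rho w]%R + intV2 rho [set w | rho w < tau w]%R.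
Definition dynkin_ties2 rho tau :=
  intV1 tau [set w | tau w < rho w]%R + intV2 rho [set w | rho w <= tau w]%R.

Lemma intV1_lty tau B : measurable B -> st tau -> intV1 tau B < +oo.
Proof.
move=> mB ht; apply: (@le_lt_trans _ _ (payoff B (tau \max tau)%R tau)).
  by apply: ereal_inf_lbound; exists tau.
have : payoff B (tau \max tau)%R tau \is a fin_num.
  by apply: payoff_fin => //; exact: st_max.
by rewrite fin_numElt => /andP[].
Qed.

Lemma intV2_leC rho : st rho -> intV2 rho setT <= C%:E.
Proof.
by move=> h; apply: ge_ereal_sup => _ [r hr <-]; apply: hC => //; exact: st_max.
Qed.

Lemma intV2_fin rho B : st rho -> Fs rho B -> intV2 rho B \is a fin_num.
Proof.
move=> h FB; have [V [_ _ _ iV intV]] := V2_density h (intV2_leC h).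
have mB := Fs_measurable h FB.
by rewrite -intV //; apply: integrable_fin_num => //; exact: integrableS iV.
Qed.

Lemma dynkin_payoffE rho tau : st rho -> st tau ->
  dynkin_payoff P T F U rho tau = dynkin_ties1 rho tau.
Proof.
move=> hrho htau.
have [X [gX mX X1 _ intX]] := V1_density htau.
have [Y [gY mY Y1 iY intY]] := V2_density hrho (intV2_leC hrho).
have sG := Fs_sigma_algebra htau; have sG' := Fs_sigma_algebra hrho.
pose A := [set w | (tau w <= rho w)%R].
have CA : ~` A = [set w | (rho w < tau w)%R].
  by apply/seteqP; split => w; rewrite /A /= ltNge => /negP.
have FA : Fs tau A by exact: Fs_le.
have FCA : Fs rho (~` A) by rewrite CA; exact: Fs_lt.
have mA := Fs_measurable htau FA; have mCA := Fs_measurable hrho FCA.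
rewrite /dynkin_payoff /dynkin_ties1 -/A -CA.
have mind B : measurable B -> measurable_fun [set: Omega] (fun w => (\1_B w : R)%:E).
  by move=> mB; apply/measurable_EFinP; exact: measurable_indic.
have mf : measurable_fun [set: Omega] (fun w => V1 P T F U tau w * (\1_A w : R)%:E +
    V2 P T F U rho w * (\1_(~` A) w : R)%:E).
  by apply: emeasurable_funD; apply: emeasurable_funM => //; exact: mind.
rewrite -[in LHS](setUv A) integral_setU //; last 2 first.
- by rewrite setUv.
- by rewrite disj_set2E setICr eqxx.
congr (_ + _).
  rewrite -intX //; transitivity (\int[P]_(w in A) V1 P T F U tau w).
    apply: eq_integral => w Aw; rewrite !indicE Aw in_setC Aw /=.
    by rewrite mule1 mule0 adde0.
  apply: ae_eq_integral => //; [exact: measurable_funTS| |by apply: filterS X1].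
  by apply: measurable_funTS; exact: (sub_measurableW sG (Fs_measurable htau) gX).
rewrite -intY //; transitivity (\int[P]_(w in ~` A) V2 P T F U rho w).
  apply: eq_integral => w Aw; rewrite !indicE Aw; move: Aw;
    rewrite in_setC => /negbTE -> /=.
  by rewrite mule1 mule0 add0e.
apply: ae_eq_integral => //; [exact: measurable_funTS| |by apply: filterS Y1].
by apply: measurable_funTS; exact: (sub_measurableW sG' (Fs_measurable hrho) gY).
Qed.

(** Against r the maximizer plans to stop at D; if r0, the time at which r stops when
    unprovoked, comes first, then r stops there and the maximizer, having seen it, can
    realize V2. If D comes strictly first, r can at best realize V1. A strategy of type I
    keeps to r0 even when the maximizer stops at the same moment, so at a tie the
    maximizer may still wait and realize V2. *)
Lemma upper_typeI_ge r D : strategyI P T F r -> st D ->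
  dynkin_ties2 (r (cst T)) D <= ereal_sup [set 'E_P[U (r tau) tau] | tau in st].
Proof.
move=> hr hD; have h0 := hr.1 _ st_cstT; set r0 := r (cst T) in h0 *.
pose A := [set w | (r0 w <= D w)%R].
have FA : Fs r0 A by exact: Fs_le.
have FDA : Fs D A by exact: Fs_ge.
have mA := Fs_measurable h0 FA; have mCA := measurableC mA.
have CA : ~` A = [set w | (D w < r0 w)%R].
  by apply/seteqP; split => w; rewrite /A /= ltNge => /negP.
rewrite /dynkin_ties2 -CA -/A; apply: le_add_sup; first exact: intV1_lty.
move=> s hs; have hsr := st_max hs h0.
(* The maximizer stops at D unless r0 comes first, and then at s. *)
pose t := glue A (s \max r0)%R D.
have ht : st t.
  by apply: st_glue => //; apply: FsS FA => // w; rewrite /= le_max lexx orbT.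
have hrt := hr.1 _ ht.
apply: le_ereal_sup_tmp; exists 'E_P[U (r t) t]; first by exists t.
rewrite expectation_payoff (payoff_splitT hrt ht mA) [leRHS]addeC.
have spec := strategyI_spec hr ht.
apply: leeD.
- apply: ereal_inf_lbound; exists (r t) => //.
  apply: payoff_local_ae => //; first exact: st_max.
  apply: filterS spec => w [_ s2] Aw; have tw : t w = D w by rewrite /t glue_out.
  split => //=; apply/max_idPl; rewrite -tw; apply/ltW/s2.
  by rewrite tw; move: Aw; rewrite CA.
- rewrite (payoff_local_ae (rho2 := r0) (tau2 := (s \max r0)%R) mA) //.
  apply: filterS spec => w [s1 _] Aw;
    have tw : t w = (s \max r0)%R w by rewrite /t glue_in.
  by rewrite s1 // tw /= le_max lexx orbT.
Qed.

(** As for type I, except that a strategy of type II can react to simultaneous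
    stopping. A tie thus counts for the minimizer, and the maximizer, in order not to
    trigger a reaction at r0, has to act strictly later. *)
Lemma upper_typeII_ge r D : strategyII P T F r -> st D ->
  dynkin_ties1 (r (cst T)) D <= ereal_sup [set 'E_P[U (r tau) tau] | tau in st].
Proof.
move=> hr hD; have h0 := hr.1 _ st_cstT; set r0 := r (cst T) in h0 *.
pose A := [set w | (r0 w < D w)%R].
have FA : Fs r0 A by exact: Fs_lt.
have FDA : Fs D A by exact: Fs_gt.
have mA := Fs_measurable h0 FA; have mCA := measurableC mA.
have CA : ~` A = [set w | (D w <= r0 w)%R].
  by apply/seteqP; split => w; rewrite /A /= leNgt => /negP.
rewrite /dynkin_ties1 -CA -/A; apply: le_add_sup; first exact: intV1_lty.
move=> s hs; have hsr := st_max hs h0.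
apply/lee_addgt0Pr => eta eta0.
have [s' [hs' rs' strict IUs']] := strict_tau h0 h0 hs FA eta0.
pose t := glue A s' D.
have ht : st t by apply: st_glue => //; apply: FsS FA.
have hrt := hr.1 _ ht.
apply: (@le_trans _ _ ('E_P[U (r t) t] + eta%:E)); last first.
  by apply: leeD2r; apply: ereal_sup_ubound; exists t.
rewrite expectation_payoff (payoff_splitT hrt ht mA) [X in _ <= X + _]addeC -addeA.
have spec := strategyII_spec hr ht.
apply: leeD.
- apply: ereal_inf_lbound; exists (r t) => //.
  apply: payoff_local_ae => //; first exact: st_max.
  apply: filterS spec => w [_ s2] Aw; have tw : t w = D w by rewrite /t glue_out.
  split => //=; apply/max_idPl; rewrite -tw; apply: s2.
  by rewrite tw; move: Aw; rewrite CA.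
- apply: le_trans IUs' _; apply: leeD2r.
  rewrite (payoff_local_ae (rho2 := r t) (tau2 := t) mA) //.
  apply: filterS spec => w [s1 _] Aw; have tw : t w = s' w by rewrite /t glue_in.
  rewrite tw s1 // tw; apply: strict; exact: lt_le_trans Aw (st_leT w hD).
Qed.

(** The same comparison with the roles of the players exchanged; at a tie the strategy
    of the maximizer has already stopped, and the minimizer realizes V1. *)
Lemma lower_typeI_le t rho : strategyI P T F t -> st rho ->
  ereal_inf [set 'E_P[U r (t r)] | r in st] <= dynkin_ties1 rho (t (cst T)).
Proof.
move=> hst hrho; have hD := hst.1 _ st_cstT; set D := t (cst T) in hD *.
pose A := [set w | (D w <= rho w)%R].
have FA : Fs D A by exact: Fs_le.
have FrA : Fs rho A by exact: Fs_ge.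
have mA := Fs_measurable hD FA; have mCA := measurableC mA.
have CA : ~` A = [set w | (rho w < D w)%R].
  by apply/seteqP; split => w; rewrite /A /= ltNge => /negP.
have FCA : Fs rho (~` A) by exact: FsC.
rewrite /dynkin_ties1 -CA -/A; apply: ge_add_inf; first exact: intV2_fin.
move=> s hs; have hsD := st_max hs hD.
pose r := glue A (s \max D)%R rho.
have hr : st r.
  by apply: st_glue => //; apply: FsS FA => // w; rewrite /= le_max lexx orbT.
have htr := hst.1 _ hr.
apply: ge_ereal_inf; exists 'E_P[U r (t r)]; first by exists r.
rewrite expectation_payoff (payoff_splitT hr htr mA).
have spec := strategyI_spec hst hr.
apply: leeD.
- rewrite (payoff_local_ae (rho2 := (s \max D)%R) (tau2 := D) mA) //.
  apply: filterS spec => w [s1 _] Aw;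
    have rw : r w = (s \max D)%R w by rewrite /r glue_in.
  by rewrite s1 // rw /= le_max lexx orbT.
- apply: ereal_sup_ubound; exists (t r) => //.
  apply: payoff_local_ae => //; first exact: st_max.
  apply: filterS spec => w [_ s2] Aw; have rw : r w = rho w by rewrite /r glue_out.
  split => //=; apply/max_idPl; rewrite -rw; apply/ltW/s2.
  by rewrite rw; move: Aw; rewrite CA.
Qed.

Lemma lower_typeII_le t rho : strategyII P T F t -> st rho ->
  ereal_inf [set 'E_P[U r (t r)] | r in st] <= dynkin_ties2 rho (t (cst T)).
Proof.
move=> hst hrho; have hD := hst.1 _ st_cstT; set D := t (cst T) in hD *.
pose A := [set w | (D w < rho w)%R].
have FA : Fs D A by exact: Fs_lt.
have FrA : Fs rho A by exact: Fs_gt.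
have mA := Fs_measurable hD FA; have mCA := measurableC mA.
have CA : ~` A = [set w | (rho w <= D w)%R].
  by apply/seteqP; split => w; rewrite /A /= leNgt => /negP.
have FCA : Fs rho (~` A) by exact: FsC.
rewrite /dynkin_ties2 -CA -/A; apply: ge_add_inf; first exact: intV2_fin.
move=> s hs; have hsD := st_max hs hD.
apply/lee_addgt0Pr => eta eta0.
have [s' [hs' Ds' strict IUs']] := strict_rho hD hD hs FA eta0.
pose r := glue A s' rho.
have hr : st r by apply: st_glue => //; apply: FsS FA.
have htr := hst.1 _ hr.
apply: ge_ereal_inf; exists 'E_P[U r (t r)]; first by exists r.
rewrite expectation_payoff (payoff_splitT hr htr mA) [leRHS]addeAC.
have spec := strategyII_spec hst hr.
apply: leeD.
- apply: le_trans IUs'.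
  rewrite (payoff_local_ae (rho2 := s') (tau2 := D) mA) //.
  apply: filterS spec => w [s1 _] Aw; have rw : r w = s' w by rewrite /r glue_in.
  rewrite rw s1 // rw; apply: strict; exact: lt_le_trans Aw (st_leT w hrho).
- apply: ereal_sup_ubound; exists (t r) => //.
  apply: payoff_local_ae => //; first exact: st_max.
  apply: filterS spec => w [_ s2] Aw; have rw : r w = rho w by rewrite /r glue_out.
  split => //=; apply/max_idPl; rewrite -rw; apply: s2.
  by rewrite rw; move: Aw; rewrite CA.
Qed.

(** * Optimal strategies *)

Lemma stopping_time_choice (Q : (Omega -> R) -> (Omega -> R) -> Prop) :
  (forall s, st s -> exists s', Q s s') ->
  exists f, forall s, st s -> Q s (f s).
Proof.
move=> H; have H' s : exists s', st s -> Q s s'.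
  have [hs|nhs] := pselect (st s); last by exists s.
  by have [s' Qs] := H s hs; exists s'.
by exists (fun s => projT1 (cid (H' s))) => s; exact: projT2 (cid (H' s)).
Qed.

Lemma strict_above rho s B (c : R) : st rho -> st s -> Fs rho B ->
  c%:E < payoff B rho (s \max rho)%R -> exists s', [/\ st s',
    forall w, (rho w <= s' w)%R,
    forall w, (rho w < T -> rho w < s' w)%R & c%:E < payoff B rho s'].
Proof.
move=> hrho hs FB cI; have mB := Fs_measurable hrho FB.
have If := payoff_fin mB hrho (st_max hs hrho).
have eta0 : (0 < (fine (payoff B rho (s \max rho)%R) - c) / 2)%R.
  by rewrite divr_gt0 // subr_gt0 -lte_fin fineK.
have [s' [h1 h2 h3 h4]] := strict_tau hrho hrho hs FB eta0.
exists s'; split => //.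
have If' := payoff_fin mB hrho h1.
move: eta0 h4; rewrite -(fineK If) -(fineK If') -EFinD lee_fin lte_fin /=.
set a := fine _; set b := fine _; lra.
Qed.

Lemma strict_below tau s B (c : R) : st tau -> st s -> Fs tau B ->
  payoff B (s \max tau)%R tau < c%:E -> exists s', [/\ st s',
    forall w, (tau w <= s' w)%R,
    forall w, (tau w < T -> tau w < s' w)%R & payoff B s' tau < c%:E].
Proof.
move=> htau hs FB cI; have mB := Fs_measurable htau FB.
have If := payoff_fin mB (st_max hs htau) htau.
have eta0 : (0 < (c - fine (payoff B (s \max tau)%R tau)) / 2)%R.
  by rewrite divr_gt0 // subr_gt0 -lte_fin fineK.
have [s' [h1 h2 h3 h4]] := strict_rho htau htau hs FB eta0.
exists s'; split => //.
have If' := payoff_fin mB h1 htau.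
move: eta0 h4; rewrite -(fineK If) -(fineK If') -EFinD lee_fin lte_fin /=.
set a := fine _; set b := fine _; lra.
Qed.

(** Plans rho with replies that come strictly after the maximizer's time are
    strategies of type I, so the minimizer can secure the initial value up to any
    eta. *)
Lemma upperA_le_value : upperA P T F U <= value (cst 0%R) setT.
Proof.
apply: le_ereal_inf_tmp => _ [rho hrho <-].
have h0 := st_cst0.
have max0 s : st s -> (s \max cst 0)%R = s.
  by move=> hs; apply/funext => w /=; apply/max_idPl; exact: (st_ge0 w hs).
have [y [_ iy yE]] := reply_sup_density h0 hrho.
have SEf : reply_sup (cst 0%R) rho setT \is a fin_num.
  by rewrite -yE; [exact: integrable_fin_num|exact: FsT].
apply/lee_addgt0Pr => eta eta0.
rewrite -(fineK SEf) -EFinD; set c := (_ + eta)%R.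
have [f fP] : exists f, forall tau, st tau -> [/\ st (f tau),
    forall w, (tau w < T -> tau w < f tau w)%R &
    payoff setT (reply rho (f tau) tau) tau < c%:E].
  apply: (stopping_time_choice (Q := fun tau r => [/\ st r,
    forall w, (tau w < T -> tau w < r w)%R &
    payoff setT (reply rho r tau) tau < c%:E])) => tau htau.
  have : reply_payoff rho tau setT < c%:E.
    apply: (@le_lt_trans _ _ (reply_sup (cst 0%R) rho setT)).
      by apply: ereal_sup_ubound; exists tau => //; rewrite !max0.
    by rewrite -(fineK SEf) lte_fin ltrDl.
  move=> /ereal_inf_lt[_ [r hr <-]].
  have hrep := st_reply hrho hr htau.
  pose A := [set w | (tau w < rho w)%R].
  have FA : Fs tau A by exact: Fs_lt.
  have mA := Fs_measurable htau FA; have mCA := measurableC mA.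
  have repA r' : st r' ->
      payoff A (reply rho r' tau) tau = payoff A (r' \max tau)%R tau.
    move=> hr'; apply: payoff_local => //; [exact: st_reply|exact: st_max|].
    by move=> w Aw; rewrite reply_lt.
  have repCA r' : st r' -> payoff (~` A) (reply rho r' tau) tau = payoff (~` A) rho
    tau.
    move=> hr'; apply: payoff_local => //; first exact: st_reply.
    by move=> w /negP; rewrite -leNgt => Aw; rewrite reply_ge.
  rewrite (payoff_splitT hrep htau mA) repA // repCA //.
  have bf := payoff_fin mCA hrho htau.
  rewrite -lteBrDr // -(fineK bf) -EFinB.
  move=> /(strict_below htau hr FA)[s' [hs' ts' strict Is']].
  exists s'; split => //.
  rewrite (payoff_splitT (st_reply hrho hs' htau) htau mA) repA // repCA //.
  by rewrite (max_absorb ts') -lteBrDr // -(fineK bf) -EFinB.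
apply: ge_ereal_inf; exists (ereal_sup
  [set 'E_P[U (reply rho (f tau) tau) tau] | tau in st]).
  exists (fun tau => reply rho (f tau) tau) => //.
  apply: reply_strategyI => // s hs.
  by have [h1 h2 _] := fP s hs.
apply: ge_ereal_sup => _ [tau htau <-]; rewrite expectation_payoff.
by have [_ _ /ltW] := fP tau htau.
Qed.

(** Stopping at D, with a near optimal reply when the minimizer stops strictly
    before, is a strategy of type I that realizes both obstacles. *)
Lemma lowerA_ge D (c : R) : st D -> (forall rho, st rho ->
  c%:E < dynkin_ties1 rho D) ->
  c%:E <= lowerA P T F U.
Proof.
move=> hD Hc.
have [f fP] : exists f, forall rho, st rho -> [/\ st (f rho),
    forall w, (rho w < T -> rho w < f rho w)%R &
    c%:E <= payoff setT rho (reply D (f rho) rho)].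
  apply: (stopping_time_choice (Q := fun rho r => [/\ st r,
    forall w, (rho w < T -> rho w < r w)%R &
    c%:E <= payoff setT rho (reply D r rho)])) => rho hrho.
  pose A := [set w | (rho w < D w)%R].
  have FA : Fs rho A by exact: Fs_lt.
  have mA := Fs_measurable hrho FA; have mCA := measurableC mA.
  have CA : ~` A = [set w | (D w <= rho w)%R].
    by apply/seteqP; split => w; rewrite /A /= leNgt => /negP.
  have FDCA : Fs D (~` A) by rewrite CA; exact: Fs_le.
  have := Hc rho hrho; rewrite /dynkin_ties1 -CA -/A.
  have xy := intV1_lty mCA hD.
  case xE : (intV1 D (~` A)) xy => [x| |] // _.
  rewrite addeC -lteBlDr // -EFinB => /ereal_sup_gt[_ [s hs <-]].
  move=> /(strict_above hrho hs FA)[s' [hs' rs' strict Is']].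
  exists s'; split => //.
  have hrep := st_reply hD hs' hrho.
  rewrite (payoff_splitT hrho hrep mA).
  rewrite (payoff_local (rho2 := rho) (tau2 := s') mA) //; last first.
    by move=> w Aw; rewrite reply_lt //; apply/max_idPl.
  have : x%:E <= payoff (~` A) rho (reply D s' rho).
    rewrite -xE; apply: ereal_inf_lbound; exists rho => //.
    apply: payoff_local => //; first exact: st_max.
      by move=> w; rewrite CA => Aw /=; apply/max_idPl.
    by move=> w; rewrite CA => Aw; rewrite reply_ge.
  move=> xI; apply: le_trans (leeD (ltW Is') xI).
  by rewrite -EFinD lee_fin subrK.
apply: le_ereal_sup_tmp.
exists (ereal_inf [set 'E_P[U rho (reply D (f rho) rho)] | rho in st]).
  exists (fun rho => reply D (f rho) rho) => //.
  apply: reply_strategyI => // s hs.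
  by have [h1 h2 _] := fP s hs.
apply: le_ereal_inf_tmp => _ [rho hrho <-]; rewrite expectation_payoff.
by have [_ _] := fP rho hrho.
Qed.

(** The minimal time D of the region with small tolerance e is a near saddle point: by
    saddle_point it secures the initial value up to e times a constant. *)
Lemma value_le_lowerA : value (cst 0%R) setT <= lowerA P T F U.
Proof.
have hTT := st_cstT; have h0 := st_cst0.
have [M0 UM0] := biadmissible_bounded hU hTT hTT.
pose M := Num.max M0 0%R.
have M0' : (0 <= M)%R by rewrite le_max lexx orbT.
have UM : \forall w \ae P, (`|U (cst T) (cst T) w| <= M)%R.
  by apply: filterS UM0 => w h; rewrite le_max h.
have [->|v0y] := eqVneq (value (cst 0%R) setT) -oo; first exact: leNye.
have v0C : value (cst 0%R) setT <= (C + M + 1)%:E.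
  apply: le_trans (value_le_slack M0' _ h0) _.
  by apply: (slack_leC M0' UM) => //; exact: FsT.
have v0f : value (cst 0%R) setT \is a fin_num.
  by rewrite fin_numElt ltNye v0y (le_lt_trans v0C) // ltry.
apply/lee_addgt0Pr => eta eta0.
(* The maximum with 0 covers a negative C. *)
pose k := Num.max (C + M + 1)%R 0%R.
have k0 : (0 <= k)%R by rewrite le_max lexx orbT.
have k1 : (0 < k + 1)%R by rewrite ltr_wpDl.
pose e := (eta / 2 / (k + 1))%R.
have e0 : (0 < e)%R by rewrite !divr_gt0.
have [D [SD Dmin]] := minimal_stop UM e0.
have hD : st D by case: SD.
rewrite -leeBlDr // -(fineK v0f) -EFinB; apply: (lowerA_ge hD) => rho hrho.
have := saddle_point M0' UM e0 SD Dmin hrho.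
rewrite -/(dynkin_ties1 rho D) => H.
have ek : (e * (C + M + 1) < eta)%R.
  apply: (@le_lt_trans _ _ (e * (k + 1))%R).
    apply: ler_wpM2l; first exact: ltW.
    by rewrite (@le_trans _ _ k) // ?lerDl // le_max lexx.
  by rewrite /e divfK ?gt_eqF // ltr_pdivrMr // ltr_pMr // ltr1n.
apply: (@lt_le_trans _ _ (value (cst 0%R) setT - (e * (C + M + 1))%:E)).
  by rewrite -(fineK v0f) -EFinB lte_fin ltrD2l ltrN2.
by rewrite leeBlDr.
Qed.

End stopping_times.

Theorem theorem2p1 (d : measure_display) (Omega : measurableType d)
  (R : realType) (P : probability Omega R) (T : R) (hT : 0 < T)
  (F : R -> set (set Omega))
  (hF : filtration T F) (hu : usual_conditions P T F)
  (U : (Omega -> R) -> (Omega -> R) -> Omega -> R)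
  (hU : biadmissible P T F U) (hrc : urce P T F U) :
  upperA P T F U = lowerA P T F U /\
  lowerA P T F U = upperB P T F U /\
  upperB P T F U = lowerB P T F U /\
  lowerB P T F U = upperV P T F U /\
  upperV P T F U = lowerV P T F U.
Proof.
have [C hC] : exists C : R, forall rho tau, stopping_time T F rho ->
    stopping_time T F tau -> (payoff P U setT rho tau <= C%:E)%E.
  have := urce_bounded hrc; set S := [set _ | _ in _] => Sy.
  have [C SC] : exists C : R, (ereal_sup S <= C%:E)%E.
    case: (ereal_sup S) Sy => [C _| //|_]; first by exists C.
    by exists 0; exact: leNye.
  exists C => rho tau h1 h2; apply: le_trans SC; rewrite -expectation_payoff.
  by apply: ereal_sup_ubound; exists (rho, tau).
have hTT := st_cstT hT hF.
have hr := usual_right_continuous hu.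
have AA : (upperA P T F U <= lowerA P T F U)%E.
  exact: le_trans (upperA_le_value hT hF hU hrc hC)
    (value_le_lowerA hT hF hr hU hrc hC).
have LAV : (lowerA P T F U <= lowerV P T F U)%E.
  apply: ge_ereal_sup => _ [t ht <-].
  apply: le_ereal_sup_tmp; exists (ereal_inf
    [set dynkin_payoff P T F U rho (t (cst T)) | rho in stopping_time T F]).
    by exists (t (cst T)) => //; exact: ht.1.
  apply: le_ereal_inf_tmp => _ [rho hrho <-].
  rewrite (dynkin_payoffE hT hF hU hC) //; last exact: ht.1.
  exact: (lower_typeI_le hT hF hU hC).
have LVV : (lowerV P T F U <= upperV P T F U)%E.
  apply: ge_ereal_sup => _ [tau ht <-]; apply: le_ereal_inf_tmp => _ [rho hrho <-].
  apply: (@le_trans _ _ (dynkin_payoff P T F U rho tau)).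
    by apply: ereal_inf_lbound; exists rho.
  by apply: ereal_sup_ubound; exists tau.
have VUB : (upperV P T F U <= upperB P T F U)%E.
  apply: le_ereal_inf_tmp => _ [r hrr <-].
  apply: ge_ereal_inf; exists (ereal_sup
    [set dynkin_payoff P T F U (r (cst T)) tau | tau in stopping_time T F]).
    by exists (r (cst T)) => //; exact: hrr.1.
  apply: ge_ereal_sup => _ [tau htau <-].
  rewrite (dynkin_payoffE hT hF hU hC) //; last exact: hrr.1.
  exact: (upper_typeII_ge hT hF hU hrc).
have UBA : (upperB P T F U <= upperA P T F U)%E.
  by apply: le_ereal_inf; apply: image_subset; exact: strategyI_sub.
have LAB : (lowerA P T F U <= lowerB P T F U)%E.
  by apply: ereal_sup_le; apply: image_subset; exact: strategyI_sub.
have LBA : (lowerB P T F U <= upperA P T F U)%E.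
  apply: ge_ereal_sup => _ [t ht <-]; apply: le_ereal_inf_tmp => _ [r hrr <-].
  apply: (@le_trans _ _ (dynkin_ties2 P T F U (r (cst T)) (t (cst T)))).
    by apply: (lower_typeII_le hT hF hU hrc hC) => //; exact: hrr.1.
  by apply: (upper_typeI_ge hT hF hU) => //; exact: ht.1.
have eqA x : (lowerA P T F U <= x)%E -> (x <= upperA P T F U)%E -> x = lowerA P T F U.
  by move=> h1 h2; apply/eqP; rewrite eq_le h1 andbT (le_trans h2 AA).
have -> := eqA _ (le_trans LAV (le_trans LVV (le_trans VUB UBA))) (lexx _).
have -> := eqA _ (le_trans LAV (le_trans LVV VUB)) UBA.
have -> := eqA _ LAB LBA.
have -> := eqA _ (le_trans LAV LVV) (le_trans VUB UBA).
by have -> := eqA _ LAV (le_trans LVV (le_trans VUB UBA)).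
Qed.
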